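(* For every $q > 2$ and every $\alpha > 0$ there is a compact set $K \subset \mathbb{T}$ which supports a non-zero Schwartz distribution $S$ such that $$\sum_{n \in \mathbb{Z},\ \widehat{S}(n) \neq 0} |\widehat{S}(n)|^q \log^{\alpha}\big(e + |\widehat{S}(n)|^{-1}\big) < \infty,$$ but which does not support any non-zero finite complex Borel measure $\mu$ satisfying the same condition, namely $$\sum_{n \in \mathbb{Z},\ \widehat{\mu}(n) \neq 0} |\widehat{\mu}(n)|^q \log^{\alpha}\big(e + |\widehat{\mu}(n)|^{-1}\big) < \infty.$$
   Context: $\mathbb{T} = \mathbb{R}/2\pi\mathbb{Z}$ is the circle; $\widehat{S}(n)$, $n\in\mathbb{Z}$, denotes the Fourier coefficients of a distribution or measure $S$ on $\mathbb{T}$; a compact set $K$ supports a distribution or measure if the support of the latter is contained in $K$. *)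

(* Defs.v *)
From HB Require Import structures.
From mathcomp Require Import all_boot all_order all_algebra.
From mathcomp Require Import generic_quotient.
From mathcomp Require Import all_classical all_reals all_analysis.
From mathcomp Require Import complex.

Set Implicit Arguments.
Unset Strict Implicit.
Unset Printing Implicit Defensive.

Import Order.TTheory GRing.Theory Num.Theory.
Import numFieldNormedType.Exports.
Import ComplexField.Normc.

Local Open Scope classical_set_scope.
Local Open Scope ring_scope.
Local Open Scope complex_scope.

Section Circle.
Variable R : realType.
Local Open Scope quotient_scope.

Definition congr_2pi (x y : R) : bool :=
  `[< exists k : int, x = y + (pi *+ 2) *~ k >].

Lemma congr_2pi_refl : reflexive congr_2pi.
Proof. by move=> x; apply/asboolP; exists 0; rewrite mulr0z addr0. Qed.

Lemma congr_2pi_sym : symmetric congr_2pi.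
Proof.
suff H x y : congr_2pi x y -> congr_2pi y x.
  by move=> x y; apply/idP/idP; exact: H.
move=> /asboolP[k ->]; apply/asboolP; exists (- k).
by rewrite mulrNz addrK.
Qed.

Lemma congr_2pi_trans : transitive congr_2pi.
Proof.
move=> y x z /asboolP[k ->] /asboolP[l ->]; apply/asboolP; exists (l + k).
by rewrite mulrzDr addrA.
Qed.

Definition circle_rel :=
  EquivRel congr_2pi congr_2pi_refl congr_2pi_sym congr_2pi_trans.

Definition circle := {eq_quot circle_rel}.
HB.instance Definition _ :=
  PointedTopological.copy circle (quotient_topology circle).
HB.instance Definition _ := Quotient.on circle.

Definition circle_proj (x : R) : circle := \pi_circle x.

Lemma repr_circle_proj (x : R) :
  exists k : int, repr (circle_proj x) = x + (pi *+ 2) *~ k.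
Proof.
have : repr (circle_proj x) = x %[mod circle] by rewrite reprK.
by move=> /eqmodP /asboolP.
Qed.

(* t |-> e^{i n t}; [characterE] shows that the choice of the representative
   [repr t] is irrelevant. *)
Definition character (n : int) (t : circle) : R[i] :=
  cos (n%:~R * repr t) +i* sin (n%:~R * repr t).

Lemma characterE (n : int) (x : R) :
  character n (circle_proj x) = cos (n%:~R * x) +i* sin (n%:~R * x).
Proof.
have per (f : R -> R) : periodic f (pi *+ 2) ->
    forall (k : int) a, f (a + (pi *+ 2) *~ k) = f a.
  move=> pf [k|k] a; first exact: periodicn.
  by rewrite NegzE mulrNz -(periodicn pf k.+1) subrK.
rewrite /character; have [k ->] := repr_circle_proj x.
rewrite mulrDr [_ * (_ *~ k)]mulrzl -mulrzA.
by rewrite !per//; [exact: sinD2pi|exact: cosD2pi].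
Qed.

(* [f] is lifted to a 2 pi-periodic function on the line, which is
   differentiated componentwise. *)
Definition lift_Re (f : circle -> R[i]) (x : R) : R := complex.Re (f (circle_proj x)).
Definition lift_Im (f : circle -> R[i]) (x : R) : R := complex.Im (f (circle_proj x)).

Definition smooth (f : circle -> R[i]) : Prop :=
  forall (k : nat) (x : R),
    derivable (derive1n k (lift_Re f)) x 1 /\ derivable (derive1n k (lift_Im f)) x 1.

Definition deriv_circle (k : nat) (f : circle -> R[i]) (x : R) : R[i] :=
  derive1n k (lift_Re f) x +i* derive1n k (lift_Im f) x.

Definition deriv_norm (k : nat) (f : circle -> R[i]) : R :=
  sup [set normc (deriv_circle k f x) | x in [set: R]].

(* A continuous linear functional on the Frechet space of smooth functions; the
   values at functions that are not smooth are irrelevant. *)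
Record schwartz_distribution := SchwartzDistribution {
  dist_fun :> (circle -> R[i]) -> R[i];
  dist_linear : forall (a : R[i]) (f g : circle -> R[i]),
    smooth f -> smooth g ->
    dist_fun (fun t => a * f t + g t) = a * dist_fun f + dist_fun g;
  dist_continuous : exists (N : nat) (C : R), forall f : circle -> R[i],
    smooth f -> normc (dist_fun f) <= C * \sum_(k < N.+1) deriv_norm k f }.

Definition dist_nonzero (S : schwartz_distribution) : Prop :=
  exists2 f, smooth f & S f != 0.

Definition dist_support (S : schwartz_distribution) : set circle :=
  [set t | forall U : set circle, open U -> U t ->
     exists f, [/\ smooth f, closure [set s | f s != 0] `<=` U & S f != 0]].

Definition dist_fourier (S : schwartz_distribution) (n : int) : R[i] :=
  S (character (- n)).

Definition borel_circle := g_sigma_algebraType (@open circle).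

(* A finite complex Borel measure is given by its real and imaginary parts,
   which are finite signed measures. *)
Record complex_measure := ComplexMeasure {
  cm_Re : {charge set borel_circle -> \bar R};
  cm_Im : {charge set borel_circle -> \bar R} }.

Definition cm_val (mu : complex_measure) (A : set borel_circle) : R[i] :=
  fine (cm_Re mu A) +i* fine (cm_Im mu A).
Coercion cm_val : complex_measure >-> Funclass.

Definition cm_nonzero (mu : complex_measure) : Prop :=
  exists2 A : set borel_circle, measurable A & mu A != 0.

(* The complement is the largest open set that is null for |mu|, that is, all
   of whose Borel subsets have measure zero. *)
Definition cm_support (mu : complex_measure) : set circle :=
  [set t | forall U : set circle, open U -> U t ->
     exists A : set borel_circle, [/\ measurable A, A `<=` U & mu A != 0]].

(* Integral with respect to the Jordan decomposition of [nu], which does not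
   depend on the Hahn decomposition that is chosen. *)
Definition charge_integral (nu : {charge set borel_circle -> \bar R})
    (f : borel_circle -> R) : R :=
  let: exist P exN := cid (Hahn_decomposition nu) in
  let: exist N nuPN := cid exN in
  Rintegral (jordan_pos nuPN) setT f - Rintegral (jordan_neg nuPN) setT f.

Definition cm_integral (mu : complex_measure) (f : borel_circle -> R[i]) : R[i] :=
  (charge_integral (cm_Re mu) (fun t => complex.Re (f t))
   - charge_integral (cm_Im mu) (fun t => complex.Im (f t)))
  +i* (charge_integral (cm_Re mu) (fun t => complex.Im (f t))
   + charge_integral (cm_Im mu) (fun t => complex.Re (f t))).

Definition cm_fourier (mu : complex_measure) (n : int) : R[i] :=
  cm_integral mu (character (- n)).

Definition log_summable (q alpha : R) (c : int -> R[i]) : Prop :=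
  (\esum_(n in [set n : int | (c n != 0)%R])
     (normc (c n) `^ q * ln (expR 1 + (normc (c n))^-1) `^ alpha)%R%:E < +oo)%E.

End Circle.

(* Main.v *)
Require Import Defs.
From mathcomp Require Import all_boot all_order all_algebra.
From mathcomp Require Import generic_quotient.
From mathcomp Require Import all_classical all_reals all_analysis.
From mathcomp Require Import measurable_realfun complex zify ring lra.

Set Implicit Arguments.
Unset Strict Implicit.
Unset Printing Implicit Defensive.

Import Order.TTheory GRing.Theory Num.Theory.
Import numFieldNormedType.Exports.
Import ComplexField.Normc.

Local Open Scope classical_set_scope.
Local Open Scope ring_scope.

(* A Piatetski-Shapiro type construction. For a list [w] of frequencies let
   [freq_avg w x] be the mean of the [cos (v x)], [v] in [w]. The set [K] consists of the points
   where [freq_avg (w j) >= c] for all [j], with [c > 0] fixed and frequencies in [w j] tending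
   to infinity.

   If a measure [mu] on [K] has coefficients tending to zero and [g] is a trigonometric
   polynomial, then [\int g (1 - freq_avg (w j)) dmu] tends to [\int g dmu]; iterating this [n]
   times, [|\int g dmu| <= (1 - c)^n |g| |mu| + o(1)], so all coefficients of [mu] vanish.

   The distribution is the limit of products of blocks [T * (1 - cutoff)], where
   [T = \sum_i rho_i \prod_v (1 + s_i cos (v x))] is a signed combination of Riesz products
   with [s_i] in [[a, 2 a]], [\sum rho_i = 1] and [\sum rho_i s_i^k = 0] for [1 <= k <= l].
   With [n] frequencies, the cancellation makes [T - 1] small in [l^q] as soon as [l] is large
   compared to [n a^q], at the price [\sum |rho_i| <= 8^l]; by a Chernoff bound the part of
   [T] on [freq_avg < c] has [L^2] norm at most [8^l exp (- a^2 n / 32)], which is small as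
   soon as [l] is small compared to [n a^2]. Since [q > 2], both hold for small [a] and a
   suitable [l] proportional to [n]. Working with the exponent [(q + 2) / 2] instead of [q]
   absorbs the logarithm. *)

(** * Sequences with bounded q-norm *)

Section LqSequences.
Variable R : realType.
Implicit Types (q B D e t : R) (a b d : int -> R).

(** Multiplying by [1 + s cos (v x)] with [v] large puts two copies of the spectrum, scaled by
    [s / 2], far away from the original. The q-th power sum therefore grows only by the factor
    [1 + 2^(1 - q) s^q], whereas the triangle inequality would give [1 + s] for the norm. A single
    Riesz product keeps its terms of low degree in the cosines, which are not small in l^q; the
    vanishing moments remove the degrees 1 to [l]. A degree [k > l] may be weighted by [z^(k - l)]
    with [z >= 1], and the resulting factor [z^(-l)] pays for the mass [8^l] of the signed weights.
    That mass is also why the approximants are only controlled in the dual of C^1 and not as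
    measures. The threshold [c] has to be fixed before the function that a block multiplies is
    known, because the argument against measures iterates with one [c]; only [l], and with it the
    number of frequencies, adapts to that function. The cutoff is a C^1 function rather than an
    indicator, so that the product can be tested against high frequencies again in the next
    block. *)

Definition lq_bounded q a B :=
  forall F : seq int, uniq F -> \sum_(n <- F) `|a n| `^ q <= B.

Lemma lq_bounded_ge0 q a B : lq_bounded q a B -> 0 <= B.
Proof. by move=> /(_ [::] isT); rewrite big_nil. Qed.

Lemma lq_bounded_le q a B B' : lq_bounded q a B -> B <= B' -> lq_bounded q a B'.
Proof. by move=> aB BB' F uF; exact: le_trans (aB F uF) BB'. Qed.

Lemma lq_bounded_norm q a b B : 0 <= q -> (forall n, `|b n| <= `|a n|) ->
  lq_bounded q a B -> lq_bounded q b B.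
Proof.
move=> q0 ba aB F uF; apply: le_trans (aB F uF); apply: ler_sum => n _.
by apply: ge0_ler_powR => //; rewrite nnegrE.
Qed.

Lemma lq_bounded_shift q a B (k : int) :
  lq_bounded q a B -> lq_bounded q (fun n => a (n + k)) B.
Proof.
move=> aB F uF.
have := aB [seq n + k | n <- F]; rewrite big_map; apply.
by rewrite map_inj_uniq// => x y /addIr.
Qed.

(** Either [|y| <= t |x|] or [|x| < |y| / t], and in each case one term alone dominates. The
    constant in front of [x] can be brought close to 1, so that a small perturbation does not
    multiply the bound by a fixed factor. *)
Lemma powR_normD_le q t (x y : R) : 0 < q -> 0 < t ->
  `|x + y| `^ q <= (1 + t) `^ q * `|x| `^ q + (1 + t^-1) `^ q * `|y| `^ q.
Proof.
move=> q0 t0; have ti0 : 0 < t^-1 by rewrite invr_gt0.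
rewrite -!powRM ?normr_ge0//; try by apply: ltW; lra.
have [yx|xy] := leP `|y| (t * `|x|).
  apply: (@le_trans _ _ (((1 + t) * `|x|) `^ q)); last by rewrite lerDl powR_ge0.
  apply: ge0_ler_powR; rewrite ?nnegrE ?(ltW q0)//.
    by rewrite mulr_ge0//; lra.
  by apply: le_trans (ler_normD _ _) _; rewrite mulrDl mul1r lerD2l.
apply: (@le_trans _ _ (((1 + t^-1) * `|y|) `^ q)); last by rewrite lerDr powR_ge0.
apply: ge0_ler_powR; rewrite ?nnegrE ?(ltW q0)//.
  by rewrite mulr_ge0//; lra.
apply: le_trans (ler_normD _ _) _; rewrite mulrDl mul1r addrC lerD2l.
by rewrite mulrC ler_pdivlMr// mulrC ltW.
Qed.

Lemma lq_boundedD q t a d B D : 0 < q -> 0 < t ->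
  lq_bounded q a B -> lq_bounded q d D ->
  lq_bounded q (fun n => a n + d n) ((1 + t) `^ q * B + (1 + t^-1) `^ q * D).
Proof.
move=> q0 t0 aB dD F uF.
apply: (@le_trans _ _ (\sum_(n <- F) ((1 + t) `^ q * `|a n| `^ q +
    (1 + t^-1) `^ q * `|d n| `^ q))).
  by apply: ler_sum => n _; exact: powR_normD_le.
rewrite big_split/= -!mulr_sumr; apply: lerD; apply: ler_wpM2l;
  by [exact: powR_ge0|exact: aB|exact: dD].
Qed.

Lemma lq_bounded_perturb q B B' : 0 < q -> B < B' ->
  exists2 e, 0 < e & forall a d, lq_bounded q a B -> lq_bounded q d e ->
    lq_bounded q (fun n => a n + d n) B'.
Proof.
move=> q0 BB'.
(* No sequence has a negative bound, so the first case is vacuous. *)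
have [B0|B0] := ltP B 0.
  exists 1 => // a d /lq_bounded_ge0; lra.
have [t t0 tB] : exists2 t, 0 < t & (1 + t) `^ q * B < B'.
  (* Dividing [B'] by the midpoint of [B] and [B'] rather than by [B] keeps the inequality strict
     and covers [B = 0]. *)
  pose r := B' / (B + (B' - B) / 2).
  have den0 : 0 < B + (B' - B) / 2 by lra.
  have r1 : 1 < r by rewrite /r ltr_pdivlMr//; lra.
  have r0 : 0 < r by lra.
  exists (r `^ q^-1 - 1).
    have : 1 `^ q^-1 < r `^ q^-1.
      by apply: gt0_ltr_powR; rewrite ?invr_gt0// nnegrE; lra.
    by rewrite powR1 => ?; lra.
  rewrite addrC subrK -powRrM mulVf ?gt_eqF// powRr1 ?ltW//.
  by rewrite /r mulrAC ltr_pdivrMr// ltr_pM2l; lra.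
have c0 : 0 < (1 + t^-1) `^ q.
  by apply: powR_gt0; rewrite addr_gt0 ?invr_gt0.
exists ((B' - (1 + t) `^ q * B) / (1 + t^-1) `^ q).
  by rewrite divr_gt0// subr_gt0.
move=> a d aB dD; apply: lq_bounded_le (lq_boundedD q0 t0 aB dD) _.
by rewrite [X in _ + X]mulrC divfK ?gt_eqF// addrC subrK.
Qed.

(** A finite set of indices that nearly attains the supremum of the partial sums leaves less than
    [e] for every set of indices disjoint from it. *)
Lemma lq_bounded_tail q a B e : 0 < q -> lq_bounded q a B -> 0 < e ->
  exists N : nat, lq_bounded q (fun n => if (N < `|n|)%N then a n else 0) e.
Proof.
move=> q0 aB e0.
pose E := [set x : R | exists2 F : seq int, uniq F & x = \sum_(n <- F) `|a n| `^ q].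
have hE : has_sup E.
  split; first by exists 0, [::]; rewrite ?big_nil.
  by exists B => x [F uF ->]; exact: aB.
have [x [F0 uF0 ->] xE] := sup_adherent e0 hE.
exists (\max_(n <- F0) `|n|%N) => F uF.
pose G := [seq n <- F | (\max_(n <- F0) `|n| < `|n|)%N].
have -> : \sum_(n <- F) `|if (\max_(n0 <- F0) `|n0| < `|n|)%N then a n else 0| `^ q =
    \sum_(n <- G) `|a n| `^ q.
  rewrite big_filter [RHS]big_mkcond/=; apply: eq_bigr => n _.
  by case: ifP => //; rewrite normr0 powR0// gt_eqF.
have uGF : uniq (F0 ++ G).
  rewrite cat_uniq uF0 filter_uniq// andbT/=; apply/hasPn => n.
  rewrite mem_filter => /andP[+ _]; apply: contraL => nF0.
  rewrite -leqNgt; exact: (@leq_bigmax_seq _ F0 xpredT (fun n : int => `|n|%N)).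
have : \sum_(n <- F0 ++ G) `|a n| `^ q <= sup E.
  by apply: ub_le_sup; [exact: hE.2|exists (F0 ++ G)].
by rewrite big_cat/= => ?; lra.
Qed.

(** For large [w] the sequences [b], [a (n - w)] and [a (n + w)] live essentially on disjoint sets,
    so their q-th powers add up; the two halves contribute [2 (1 / 2)^q = 2^(1 - q)]. *)
Lemma lq_bounded_cos q a b B1 B2 e : 0 < q ->
  lq_bounded q b B1 -> lq_bounded q a B2 -> 0 < e ->
  exists N : nat, forall w : nat, (N <= w)%N ->
    lq_bounded q (fun n => b n + (a (n - w%:Z) + a (n + w%:Z)) / 2)
      (B1 + 2 `^ (1 - q) * B2 + e).
Proof.
move=> q0 bB aB e0.
have [|d d0 dP] := @lq_bounded_perturb q (B1 + 2 `^ (1 - q) * B2)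
  (B1 + 2 `^ (1 - q) * B2 + e) q0; first by lra.
(* The constant lost when the triangle inequality with [t = 1] is applied twice to the three tails,
   each of size [d / k]. *)
pose k := (1 + 1) `^ q + (1 + 1^-1) `^ q * ((1 + 1) `^ q + (1 + 1^-1) `^ q) : R.
have k0 : 0 < k.
  by rewrite /k addr_gt0 ?mulr_ge0 ?addr_ge0 ?powR_gt0 ?mulr_gt0 ?addr_gt0 ?powR_gt0 ?invr1.
have dk0 : 0 < d / k by rewrite divr_gt0.
have [Na aN] := lq_bounded_tail q0 aB dk0.
have [Nb bN] := lq_bounded_tail q0 bB dk0.
pose N := maxn Na Nb.
pose tail (c : int -> R) n := if (N < `|n|)%N then c n else 0.
pose main (c : int -> R) n := if (N < `|n|)%N then 0 else c n.
have split_c c n : c n = main c n + tail c n.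
  by rewrite /main /tail; case: ifP; rewrite ?add0r ?addr0.
have aT : lq_bounded q (tail a) (d / k).
  apply: lq_bounded_norm (ltW q0) _ aN => n; rewrite /tail.
  by case: ifPn => [|_]; rewrite ?normr0// gtn_max => /andP[-> _].
have bT : lq_bounded q (tail b) (d / k).
  apply: lq_bounded_norm (ltW q0) _ bN => n; rewrite /tail.
  by case: ifPn => [|_]; rewrite ?normr0// gtn_max => /andP[_ ->].
have half (x : R) : `|x / 2| <= `|x|.
  by rewrite normrM [`|2^-1|]gtr0_norm ?invr_gt0// ler_pdivrMr// ler_peMr//; lra.
exists (N.*2.+1) => w wN.
have -> : (fun n => b n + (a (n - w%:Z) + a (n + w%:Z)) / 2) =
  (fun n => (main b n + (main a (n - w%:Z) + main a (n + w%:Z)) / 2) +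
            (tail b n + (tail a (n - w%:Z) / 2 + tail a (n + w%:Z) / 2))).
  by apply/funext => n; rewrite (split_c b n) (split_c a (n - _)) (split_c a (n + _)); field.
apply: dP; last first.
  have Tm : lq_bounded q (fun n => tail a (n - w%:Z) / 2) (d / k).
    apply: lq_bounded_norm (ltW q0) _ (lq_bounded_shift (- w%:Z) aT) => n.
    exact: half.
  have Tp : lq_bounded q (fun n => tail a (n + w%:Z) / 2) (d / k).
    apply: lq_bounded_norm (ltW q0) _ (lq_bounded_shift w%:Z aT) => n.
    exact: half.
  apply: lq_bounded_le (lq_boundedD q0 ltr01 bT (lq_boundedD q0 ltr01 Tm Tp)) _.
  rewrite -!mulrDl mulrA -mulrDl -/k.
  by rewrite mulrC divfK ?gt_eqF.
(* for each [n], at most one of [n], [n - w], [n + w] has absolute value at most [N] *)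
have pt n : `|main b n + (main a (n - w%:Z) + main a (n + w%:Z)) / 2| `^ q <=
    `|b n| `^ q + 2 `^ (- q) * `|a (n - w%:Z)| `^ q + 2 `^ (- q) * `|a (n + w%:Z)| `^ q.
  have z0 x : 0 <= `|x| `^ q :> R by exact: powR_ge0.
  have h0 x : 0 <= 2 `^ (- q) * `|x| `^ q :> R by rewrite mulr_ge0 ?powR_ge0.
  have hE (x : R) : `|x / 2| `^ q = 2 `^ (- q) * `|x| `^ q.
    rewrite normrM powRM// mulrC; congr (_ * _).
    by rewrite gtr0_norm ?invr_gt0// -powR_inv1// -powRrM mulN1r.
  rewrite /main; case: ifPn => h1; case: ifPn => h2; case: ifPn => h3;
    rewrite ?addr0 ?add0r ?mul0r ?addr0 ?normr0 ?powR0 ?gt_eqF// ?hE ?addr_ge0//.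
  - by rewrite lerDr addr_ge0.
  - by rewrite -addrA [X in _ <= X]addrCA lerDl addr_ge0.
  - exfalso; lia.
  - by rewrite -addrA lerDl addr_ge0.
  - exfalso; lia.
  - exfalso; lia.
  - exfalso; lia.
move=> F uF; apply: le_trans (ler_sum _ (fun n _ => pt n)) _.
rewrite !big_split/= -!mulr_sumr -addrA lerD ?bB//.
have -> : 2 `^ (1 - q) * B2 = 2 `^ (- q) * B2 + 2 `^ (- q) * B2.
  rewrite powRD; last by rewrite pnatr_eq0 implybT.
  by rewrite powRr1// -mulrA mulrDl mul1r.
apply: lerD; apply: ler_wpM2l; rewrite ?powR_ge0//.
  exact: (lq_bounded_shift (- w%:Z) aB).
exact: (lq_bounded_shift w%:Z aB).
Qed.

End LqSequences.

(** * Signed weights with vanishing moments *)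

Section VanishingMoments.
Variable R : realType.

(** The sign is opposite to the usual forward difference, so that all iterates of [1 / n] are
    positive. *)
Definition fdiff (f : nat -> R) (n : nat) : R := f n - f n.+1.

(** Only the mass of the weights and the range of the shifts matter later, so the signed binomial
    coefficients stay abstract. *)
Lemma iter_fdiff_weights (l : nat) : exists r : seq (R * nat),
  [/\ forall p, p \in r -> (p.2 <= l)%N, \sum_(p <- r) `|p.1| <= 2 ^+ l &
      forall f n, iter l fdiff f n = \sum_(p <- r) p.1 * f (n + p.2)%N].
Proof.
elim: l => [|l [r [rl r2 rE]]].
  exists [:: (1, 0%N)]; split.
  - by move=> p; rewrite inE => /eqP ->.
  - by rewrite big_seq1 normr1 expr0.
  - by move=> f n; rewrite big_seq1 mul1r addn0.
exists (r ++ [seq (- p.1, p.2.+1) | p <- r]); split.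
- move=> p; rewrite mem_cat => /orP[/rl /leqW//|/mapP[p' /rl pl ->]].
  by rewrite ltnS.
- rewrite big_cat big_map/=; under [X in _ + X]eq_bigr do rewrite normrN.
  by rewrite exprS mulrDl mul1r lerD.
- move=> f n; rewrite iterS {1}/fdiff !rE big_cat big_map/=; congr (_ + _).
  by rewrite -sumrN; apply: eq_bigr => p _; rewrite addnS addSn mulNr.
Qed.

(** One difference lowers the degree; the weight form supplies the linearity of the remaining
    iterate. *)
Lemma iter_fdiff_exp (l k n : nat) : (k < l)%N ->
  iter l fdiff (fun n => n%:R ^+ k) n = 0.
Proof.
elim: l k n => // l IH k n; rewrite ltnS => kl.
have [r [_ _ rE]] := iter_fdiff_weights l.
have dE m : fdiff (fun n => n%:R ^+ k) m =
    - \sum_(j < k) m%:R ^+ j *+ 'C(k, j).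
  rewrite /fdiff -[X in _ - X ^+ _]natr1 exprD1n big_ord_recr/= binn mulr1n.
  by rewrite opprD addrCA subrr addr0.
rewrite iterSr rE (eq_bigr (fun p => - \sum_(j < k)
    p.1 * ((n + p.2)%:R ^+ j *+ 'C(k, j)))); last first.
  by move=> p _; rewrite dE mulrN mulr_sumr.
rewrite sumrN exchange_big/= big1 ?oppr0// => j _.
have := IH j n (leq_trans (ltn_ord j) kl); rewrite rE.
under eq_bigr do rewrite mulrnAr.
by rewrite sumrMnl => ->; rewrite mul0rn.
Qed.

Lemma iter_fdiff_inv (l n : nat) : (0 < n)%N ->
  iter l fdiff (fun n => n%:R^-1) n = l`!%:R / \prod_(i < l.+1) (n + i)%:R.
Proof.
elim: l n => [|l IH] n n0; first by rewrite big_ord1 addn0 fact0 mul1r.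
rewrite iterS {1}/fdiff !IH//.
pose Q : R := \prod_(i < l) (n.+1 + i)%:R.
have E1 : \prod_(i < l.+1) (n + i)%:R = n%:R * Q.
  by rewrite big_ord_recl addn0; congr (_ * _); apply: eq_bigr => i _; rewrite addSnnS.
have E2 : \prod_(i < l.+1) (n.+1 + i)%:R = Q * (n%:R + l%:R + 1).
  by rewrite big_ord_recr/= -natrD natr1 addSn.
have E3 : \prod_(i < l.+2) (n + i)%:R = n%:R * Q * (n%:R + l%:R + 1).
  by rewrite big_ord_recr/= E1 -natrD natr1 addnS.
rewrite E1 E2 E3 factS natrM -natr1.
have Q0 : Q != 0 by apply/prodf_neq0 => i _; rewrite pnatr_eq0.
have n0' : n%:R != 0 :> R by rewrite pnatr_eq0 -lt0n.
have m0' : n%:R + l%:R + 1 != 0 :> R by rewrite -natrD natr1 pnatr_eq0.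
by field; rewrite n0' Q0 m0'.
Qed.

(** The weights of the l-th difference at [l] are divided by [(l + i) Z] and placed at the nodes
    [(l + i) / l]. The moments of order 1 to [l] then become l-th differences of powers with
    exponent below [l], and the moment of order 0 is the l-th difference of [1 / n], normalised by
    [Z]. The mass is at most [2^l] times [1 / (l Z) = 'C(2 l, l) <= 4^l], which is the origin of
    [8^l]. *)
Lemma vanishing_moments (l : nat) : (0 < l)%N -> exists r : seq (R * R),
  [/\ forall p, p \in r -> 1 <= p.2 <= 2, \sum_(p <- r) p.1 = 1,
      forall k, (0 < k <= l)%N -> \sum_(p <- r) p.1 * p.2 ^+ k = 0 &
      \sum_(p <- r) `|p.1| <= 8 ^+ l].
Proof.
move=> l0; have [r [rl r2 rE]] := iter_fdiff_weights l.
have lR0 : 0 < l%:R :> R by rewrite ltr0n.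
pose Z := iter l fdiff (fun n => n%:R^-1) l.
have ZE : Z = (l%:R * 'C(l + l, l)%:R)^-1.
  rewrite /Z iter_fdiff_inv// big_ord_recl/= addn0.
  have PE : l`!%:R * \prod_(i < l) (l + bump 0 i)%:R = (l + l)`!%:R :> R.
    have : forall k, l`!%:R * \prod_(i < k) (l + bump 0 i)%:R = (l + k)`!%:R :> R.
      elim=> [|k IH]; first by rewrite big_ord0 mulr1 addn0.
      rewrite big_ord_recr mulrA IH/= -natrM /bump leq0n add1n.
      by rewrite addnS factS mulnC.
    exact.
  have := @bin_fact (l + l) l (leq_addr _ _).
  rewrite addnK => /(congr1 (fun n => n%:R : R)); rewrite -PE !natrM => H.
  have lf0 : l`!%:R != 0 :> R by rewrite pnatr_eq0 -lt0n fact_gt0.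
  have c0 : 'C(l + l, l)%:R != 0 :> R.
    by rewrite pnatr_eq0 -lt0n bin_gt0 leq_addr.
  have -> : \prod_(i < l) (l + bump 0 i)%:R = 'C(l + l, l)%:R * l`!%:R :> R.
    by apply: (mulfI lf0); rewrite -H; ring.
  by field; rewrite lf0 c0 gt_eqF.
have C0 : 0 < 'C(l + l, l)%:R :> R by rewrite ltr0n bin_gt0 leq_addr.
have Z0 : 0 < Z by rewrite ZE invr_gt0 mulr_gt0.
exists [seq (p.1 / ((l + p.2)%:R * Z), (l + p.2)%:R / l%:R) | p <- r]; split.
- move=> _ /mapP[p /rl pl ->] /=; rewrite ler_pdivlMr// ler_pdivrMr// mul1r.
  by rewrite -natrM !ler_nat leq_addr mul2n -addnn leq_add2l.
- rewrite big_map/=; transitivity (Z / Z); last by rewrite mulfV ?gt_eqF.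
  have {2}-> : Z = \sum_(p <- r) p.1 * (l + p.2)%:R^-1 by rewrite /Z rE.
  rewrite mulr_suml.
  by apply: eq_bigr => p _; rewrite invfM mulrA.
- case=> // k kl; rewrite big_map/=.
  have := @iter_fdiff_exp l k l kl; rewrite rE => /(congr1 ( *%R^~ (Z * l%:R ^+ k.+1)^-1)).
  rewrite mul0r => H; apply: etrans H; rewrite mulr_suml; apply: eq_bigr => p _.
  have : (l + p.2)%:R != 0 :> R by rewrite pnatr_eq0; lia.
  move: (l + p.2)%:R => x x0; rewrite expr_div_n [x ^+ k.+1]exprS /=.
  by field; rewrite x0 !lt0r_neq0// exprn_gt0.
- rewrite big_map/=.
  apply: (@le_trans _ _ (\sum_(p <- r) `|p.1| * 'C(l + l, l)%:R)).
    apply: ler_sum => p _; rewrite normrM ler_wpM2l// normfV.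
    have lp0 : 0 < (l + p.2)%:R :> R by rewrite ltr0n addn_gt0 l0.
    rewrite (gtr0_norm (mulr_gt0 lp0 Z0)) ZE invfM invrK mulrA.
    rewrite ler_piMl// ?(ltW C0)// mulrC ler_pdivrMr// mul1r ler_nat.
    exact: leq_addr.
  rewrite -mulr_suml.
  have -> : 8 ^+ l = 2 ^+ l * 4 ^+ l :> R by rewrite -exprMn; congr (_ ^+ _); ring.
  apply: ler_pM => //; first by rewrite sumr_ge0.
  rewrite -natrX ler_nat.
  have -> : (4 ^ l = (1 + 1) ^ (l + l))%N by rewrite [(l + l)%N]addnn -mul2n expnM.
  rewrite expnDn; under eq_bigr do rewrite !exp1n !muln1.
  have ll : (l < (l + l).+1)%N by rewrite ltnS leq_addr.
  by rewrite (bigD1 (Ordinal ll))//= leq_addr.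
Qed.

End VanishingMoments.

(** * Integration over a period *)

Section CircleIntegral.
Variable R : realType.
Implicit Types (f g h : R -> R) (w : nat).

Definition circle_int f : R :=
  \int[lebesgue_measure]_(x in `[0 : R, pi *+ 2]) f x.

Definition C1 f := exists2 g, continuous g & forall x, is_derive x (1 : R) f (g x).

Lemma C1_continuous f : C1 f -> continuous f.
Proof.
move=> [g _ fg] x; apply: differentiable_continuous.
by apply/derivable1_diffP; have [] := fg x.
Qed.

Lemma C1_cst (c : R) : C1 (fun=> c).
Proof.
by exists (fun=> 0) => [x|x]; [exact: cst_continuous|exact: is_derive_cst].
Qed.

Lemma C1D f g : C1 f -> C1 g -> C1 (fun x => f x + g x).
Proof.
move=> [f' cf df] [g' cg dg]; exists (fun x => f' x + g' x) => [x|x].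
  by apply: cvgD; [exact: cf|exact: cg].
exact: (is_deriveD (df x) (dg x)).
Qed.

Lemma C1M f g : C1 f -> C1 g -> C1 (fun x => f x * g x).
Proof.
move=> Cf Cg; have cf := C1_continuous Cf; have cg := C1_continuous Cg.
move: Cf Cg => [f' cf' df] [g' cg' dg].
exists (fun x => f x * g' x + g x * f' x) => [x|x].
  by apply: cvgD; apply: cvgM; [exact: cf|exact: cg'|exact: cg|exact: cf'].
exact: (is_deriveM (df x) (dg x)).
Qed.

Lemma C1_comp f g : C1 f -> C1 g -> C1 (fun x => f (g x)).
Proof.
move=> [f' cf df] Cg; have cg := C1_continuous Cg; move: Cg => [g' cg' dg].
exists (fun x => f' (g x) * g' x) => [x|x].
  apply: cvgM; last exact: cg'.
  by apply: continuous_comp; [exact: cg|exact: cf].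
exact: (is_derive1_comp (df _) (dg x)).
Qed.

Lemma C1_sum (T : Type) (r : seq T) (F : T -> R -> R) :
  (forall i, C1 (F i)) -> C1 (fun x => \sum_(i <- r) F i x).
Proof.
move=> CF; elim: r => [|i r IH].
  by under eq_fun do rewrite big_nil; exact: C1_cst.
by under eq_fun do rewrite big_cons; exact: C1D.
Qed.

Lemma C1_prod (T : Type) (r : seq T) (F : T -> R -> R) :
  (forall i, C1 (F i)) -> C1 (fun x => \prod_(i <- r) F i x).
Proof.
move=> CF; elim: r => [|i r IH].
  by under eq_fun do rewrite big_nil; exact: C1_cst.
by under eq_fun do rewrite big_cons; exact: C1M.
Qed.

Lemma is_derive_scale (a x : R) : is_derive x (1 : R) (fun x => a * x) a.
Proof. by have := is_deriveZ a (is_derive_id x (1 : R)); rewrite [_ *: _]mulr1. Qed.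

Lemma C1_scale (a : R) : C1 (fun x => a * x).
Proof. by exists (fun=> a) => [x|x]; [exact: cst_continuous|exact: is_derive_scale]. Qed.

Lemma C1_cos : C1 (@cos R).
Proof.
exists (fun x => - sin x) => [x|x]; last exact: is_derive_cos.
by apply: cvgN; exact: continuous_sin.
Qed.

Lemma C1_sin : C1 (@sin R).
Proof. by exists cos => [|x]; [exact: continuous_cos|exact: is_derive_sin]. Qed.

Lemma C1_expR : C1 (@expR R).
Proof. by exists expR => [|x]; [exact: continuous_expR|exact: is_derive_expR]. Qed.

Lemma C1_cosz (a : R) : C1 (fun x => cos (a * x)).
Proof. exact: C1_comp C1_cos (C1_scale a). Qed.

Lemma C1_sinz (a : R) : C1 (fun x => sin (a * x)).
Proof. exact: C1_comp C1_sin (C1_scale a). Qed.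

Lemma continuous_integrable f : continuous f ->
  lebesgue_measure.-integrable `[0 : R, pi *+ 2] (EFin \o f).
Proof.
move=> cf; apply: continuous_compact_integrable; first exact: segment_compact.
exact: continuous_subspaceT.
Qed.

Lemma continuous_bounded_on f : continuous f ->
  exists2 M, 0 <= M & forall x, x \in `[0, pi *+ 2] -> `|f x| <= M.
Proof.
move=> cf; have cn : {within `[0, pi *+ 2], continuous (fun x => `|f x|)}.
  apply: continuous_subspaceT => x.
  by apply: continuous_comp; [exact: cf|exact: norm_continuous].
have pi2 : (0 : R) <= pi *+ 2 by rewrite mulrn_wge0// pi_ge0.
have [c _ cM] := EVT_max pi2 cn.
by exists `|f c|.
Qed.

Let mI : measurable (`[0 : R, pi *+ 2]%classic : set R). Proof. by []. Qed.

Lemma circle_intD f g : continuous f -> continuous g ->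
  circle_int (fun x => f x + g x) = circle_int f + circle_int g.
Proof. by move=> cf cg; apply: RintegralD => //; exact: continuous_integrable. Qed.

Lemma circle_intZ (c : R) f : continuous f ->
  circle_int (fun x => c * f x) = c * circle_int f.
Proof. by move=> cf; apply: RintegralZl => //; exact: continuous_integrable. Qed.

Lemma circle_int_cst (c : R) : circle_int (fun=> c) = c * (pi *+ 2).
Proof.
rewrite /circle_int Rintegral_cst//= lebesgue_measure_itv/= lte_fin.
by rewrite mulrn_wgt0 ?pi_gt0//= subr0.
Qed.

Lemma circle_int_sum (T : Type) (r : seq T) (F : T -> R -> R) :
  (forall i, continuous (F i)) ->
  circle_int (fun x => \sum_(i <- r) F i x) = \sum_(i <- r) circle_int (F i).
Proof.
move=> cF; elim: r => [|i r IH].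
  by rewrite big_nil; under eq_fun do rewrite big_nil; rewrite circle_int_cst mul0r.
rewrite big_cons -IH -circle_intD//; first by under eq_fun do rewrite big_cons.
move=> x; elim: r {IH} => [|j r IH].
  by under eq_fun do rewrite big_nil; exact: cst_continuous.
under eq_fun do rewrite big_cons.
by apply: cvgD; [exact: cF|exact: IH].
Qed.

Lemma circle_int_le f g : continuous f -> continuous g ->
  (forall x, x \in `[0, pi *+ 2] -> f x <= g x) -> circle_int f <= circle_int g.
Proof. by move=> cf cg fg; apply: le_Rintegral => //; exact: continuous_integrable. Qed.

Lemma circle_int_norm_le f g : continuous f -> continuous g ->
  (forall x, x \in `[0, pi *+ 2] -> `|f x| <= g x) ->
  `|circle_int f| <= circle_int g.
Proof.
move=> cf cg fg; apply: le_trans (le_normr_Rintegral _ _) _ => //.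
  exact: continuous_integrable.
apply: (@circle_int_le (fun x => `|f x|)) => // x.
by apply: continuous_comp; [exact: cf|exact: norm_continuous].
Qed.

(** The boundary terms vanish because [sin (w x)] does at [0] and [2 pi], whatever the values of [f]
    there. *)
Lemma circle_int_cos_parts f g w : (0 < w)%N -> continuous g ->
  (forall x, is_derive x (1 : R) f (g x)) ->
  circle_int (fun x => f x * cos (w%:R * x)) =
  - (w%:R^-1 * circle_int (fun x => g x * sin (w%:R * x))).
Proof.
move=> w0 cg df; have cf : continuous f by apply: C1_continuous; exists g.
have wn0 : w%:R != 0 :> R by rewrite pnatr_eq0 -lt0n.
pose G x : R := w%:R^-1 * sin (w%:R * x).
have dG x : is_derive x (1 : R) G (cos (w%:R * x)).
  have -> : cos (w%:R * x) = w%:R^-1 * (cos (w%:R * x) * w%:R) :> R.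
    by rewrite mulrCA mulVf// mulr1.
  apply: (is_deriveZ w%:R^-1).
  exact: (is_derive1_comp (is_derive_sin _) (is_derive_scale _ _)).
have cG : continuous G by apply: C1_continuous; exists (fun x => cos (w%:R * x)) => //;
  exact/C1_continuous/C1_cosz.
have pi2 : (0 : R) < pi *+ 2 by rewrite mulrn_wgt0// pi_gt0.
rewrite /circle_int (@Rintegration_by_parts R f G g (fun x => cos (w%:R * x)) 0 (pi *+ 2)) //.
- rewrite /G mulr0 sin0 !mulr0.
  have -> : w%:R * (pi *+ 2) = 0 + (pi *+ 2) *+ w :> R by rewrite add0r mulr_natl.
  rewrite (periodicn (@sinD2pi R)) sin0 !mulr0 subr0 sub0r; congr (- _).
  have := @circle_intZ w%:R^-1 (fun x => g x * sin (w%:R * x)).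
  rewrite /circle_int => <-.
    by apply: eq_Rintegral => x _; rewrite mulrCA.
  by move=> x; apply: cvgM; [exact: cg|exact/C1_continuous/C1_sinz].
- exact: continuous_subspaceT.
- split; [move=> x _; by have [] := df x| |];
    by [apply: cvg_at_right_filter; exact: cf|apply: cvg_at_left_filter; exact: cf].
- by move=> x _; rewrite derive1E; have [_ ->] := df x.
- by apply: continuous_subspaceT; exact/C1_continuous/C1_cosz.
- split; [move=> x _; by have [] := dG x| |];
    by [apply: cvg_at_right_filter; exact: cG|apply: cvg_at_left_filter; exact: cG].
- by move=> x _; rewrite derive1E; have [_ ->] := dG x.
Qed.

(* The rate is uniform in [f] once [f] and [f'] are bounded; this is what makes the limit
   functional a distribution of order one. *)
Lemma riemann_lebesgue h e : C1 h -> 0 < e ->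
  exists N : nat, forall w, (N <= w)%N -> forall f g F0 F1, continuous g ->
    (forall x, is_derive x (1 : R) f (g x)) ->
    (forall x, x \in `[0, pi *+ 2] -> `|f x| <= F0) ->
    (forall x, x \in `[0, pi *+ 2] -> `|g x| <= F1) ->
    `|circle_int (fun x => h x * f x * cos (w%:R * x))| <= e * (F0 + F1).
Proof.
move=> Ch e0; have ch := C1_continuous Ch.
move: Ch => [h' ch' dh].
have [A A0 hA] := continuous_bounded_on ch.
have [B B0 hB] := continuous_bounded_on ch'.
have p0 := pi_gt0 R.
pose N := (Num.truncn ((A + B) * (pi *+ 2) / e)).+1.
exists N => w Nw f g F0 F1 cg df fF gF.
have w0 : (0 < w)%N by apply: leq_trans Nw.
have wR0 : 0 < w%:R :> R by rewrite ltr0n.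
have cf : continuous f by apply: C1_continuous; exists g.
have ge0 : 0 <= F0 /\ 0 <= F1.
  have z : (0 : R) \in `[0, pi *+ 2].
    by rewrite in_itv/= lexx mulrn_wge0// ltW.
  by split; apply: le_trans (normr_ge0 _) _; [exact: fF z|exact: gF z].
have cd : continuous (fun x => h x * g x + f x * h' x).
  by move=> x; apply: cvgD; apply: cvgM; [exact: ch|exact: cg|exact: cf|exact: ch'].
have -> := circle_int_cos_parts w0 cd (fun x => is_deriveM (dh x) (df x)).
rewrite normrN normrM gtr0_norm ?invr_gt0// mulrC ler_pdivrMr//.
apply: (@le_trans _ _ ((A + B) * (F0 + F1) * (pi *+ 2))).
  rewrite -circle_int_cst; apply: circle_int_norm_le.
  - by move=> x; apply: cvgM; [exact: cd|exact/C1_continuous/C1_sinz].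
  - by move=> x; exact: cst_continuous.
  move=> x xI; rewrite normrM -[leRHS]mulr1 ler_pM ?sin_max//.
  apply: le_trans (ler_normD _ _) _; rewrite !normrM.
  have := hA x xI; have := hB x xI; have := fF x xI; have := gF x xI.
  move: (normr_ge0 (h x)) (normr_ge0 (h' x)) (normr_ge0 (f x)) (normr_ge0 (g x)).
  move: ge0 => [F00 F10] *.
  have : `|h x| * `|g x| <= A * F1 by rewrite ler_pM.
  have : `|f x| * `|h' x| <= F0 * B by rewrite ler_pM.
  have : 0 <= A * F0 by rewrite mulr_ge0.
  have : 0 <= B * F1 by rewrite mulr_ge0.
  by rewrite mulrDl !mulrDr (mulrC F0 B); lra.
rewrite [leLHS]mulrAC [leRHS]mulrAC ler_wpM2r ?addr_ge0 ?ge0.1 ?ge0.2//.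
rewrite [leRHS]mulrC -ler_pdivrMr//.
apply: ltW; apply: lt_le_trans (truncnS_gt _) _.
by rewrite ler_nat.
Qed.

Lemma circle_int_cos0 (k : int) : k != 0 -> circle_int (fun x => cos (k%:~R * x)) = 0.
Proof.
move=> k0.
have -> : (fun x : R => cos (k%:~R * x)) = (fun x => 1 * cos (`|k|%N%:R * x)).
  apply/funext => x; rewrite mul1r -[RHS]cos_norm -[LHS]cos_norm !normrM.
  by rewrite normr_nat natr_absz intr_norm.
rewrite (@circle_int_cos_parts (fun=> 1) (fun=> 0)) ?absz_gt0//.
- under eq_fun do rewrite mul0r.
  by rewrite circle_int_cst mul0r mulr0 oppr0.
- by move=> x; exact: cst_continuous.
Qed.

(** The family is orthogonal but not normalised. With [P] the sum of the [c n * e n], the bound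
    results from expanding the integral of the square of [f - P / (2 pi)]. *)
Lemma bessel f (e : int -> R -> R) (F : seq int) : continuous f ->
  (forall n, continuous (e n)) -> uniq F ->
  {in F &, forall n m, n != m -> circle_int (fun x => e n x * e m x) = 0} ->
  {in F, forall n, circle_int (fun x => e n x * e n x) <= pi *+ 2} ->
  \sum_(n <- F) circle_int (fun x => f x * e n x) ^+ 2 <=
  pi *+ 2 * circle_int (fun x => f x ^+ 2).
Proof.
move=> cf ce uF orth ee; have p0 : 0 < pi *+ 2 :> R by rewrite mulrn_wgt0 ?pi_gt0.
pose c n := circle_int (fun x => f x * e n x).
pose P x := \sum_(n <- F) c n * e n x.
have cfM (u v : R -> R) : continuous u -> continuous v -> continuous (fun x => u x * v x).
  by move=> cu cv x; apply: cvgM; [exact: cu|exact: cv].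
have cC (k : R) : continuous (fun _ : R => k) by move=> x; exact: cst_continuous.
have cP : continuous P.
  rewrite /P; elim: (F) => [|n s IH].
    by under eq_fun do rewrite big_nil; exact: cC.
  under eq_fun do rewrite big_cons.
  by move=> x; apply: cvgD; [exact: (cfM _ _ (cC _) (ce n))|exact: IH].
have intP (u : R -> R) : continuous u ->
    circle_int (fun x => u x * P x) = \sum_(n <- F) c n * circle_int (fun x => u x * e n x).
  move=> cu; under eq_fun do rewrite mulr_sumr.
  rewrite circle_int_sum; last by move=> n; exact: (cfM _ _ cu (cfM _ _ (cC _) (ce n))).
  apply: eq_bigr => n _; rewrite -circle_intZ; last exact: (cfM _ _ cu (ce n)).
  by congr circle_int; apply/funext => x; rewrite mulrCA.
set L := \sum_(n <- F) _.
have fP : circle_int (fun x => f x * P x) = L by rewrite intP.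
have PP : circle_int (fun x => P x * P x) <= pi *+ 2 * L.
  rewrite intP// /L mulr_sumr big_seq [leRHS]big_seq; apply: ler_sum => n nF.
  have -> : circle_int (fun x => P x * e n x) = c n * circle_int (fun x => e n x * e n x).
    under eq_fun do rewrite mulrC.
    rewrite intP// (bigD1_seq n)//= big_seq_cond big1 ?addr0// => m /andP[mF mn].
    by rewrite orth ?mulr0// eq_sym.
  by rewrite mulrA mulrC ler_wpM2r// ?sqr_ge0// ee.
have : 0 <= circle_int (fun x => (f x - (pi *+ 2)^-1 * P x) ^+ 2).
  by apply: Rintegral_ge0 => x _; exact: sqr_ge0.
have -> : (fun x => (f x - (pi *+ 2)^-1 * P x) ^+ 2) = (fun x => f x ^+ 2 +
    (- (2 / (pi *+ 2)) * (f x * P x) + (pi *+ 2)^-1 ^+ 2 * (P x * P x))).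
  by apply/funext => x; ring.
rewrite circle_intD; [|exact: (cfM _ _ cf cf)|]; last first.
  by move=> x; apply: cvgD; [exact: (cfM _ _ (cC _) (cfM _ _ cf cP))|
    exact: (cfM _ _ (cC _) (cfM _ _ cP cP))].
rewrite circle_intD; [|exact: (cfM _ _ (cC _) (cfM _ _ cf cP))|
  exact: (cfM _ _ (cC _) (cfM _ _ cP cP))].
rewrite !circle_intZ; [|exact: (cfM _ _ cP cP)|exact: (cfM _ _ cf cP)].
rewrite fP => H0.
have : (pi *+ 2)^-1 ^+ 2 * circle_int (fun x => P x * P x) <= (pi *+ 2)^-1 * L.
  rewrite expr2 -mulrA ler_pM2l ?invr_gt0//.
  by rewrite mulrC ler_pdivrMr// mulrC.
move=> H1; rewrite mulrC -ler_pdivrMr//; move: H0 H1.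
by rewrite mulNr -mulrA [L / _]mulrC; lra.
Qed.

Lemma continuous_cosz (a : R) : continuous (fun x : R => cos (a * x)).
Proof. exact/C1_continuous/C1_cosz. Qed.

Lemma continuous_sinz (a : R) : continuous (fun x : R => sin (a * x)).
Proof. exact/C1_continuous/C1_sinz. Qed.

Lemma continuous_mul f g : continuous f -> continuous g -> continuous (fun x => f x * g x).
Proof. by move=> cf cg x; apply: cvgM; [exact: cf|exact: cg]. Qed.

Lemma continuous_add f g : continuous f -> continuous g -> continuous (fun x => f x + g x).
Proof. by move=> cf cg x; apply: cvgD; [exact: cf|exact: cg]. Qed.

Lemma cosMcos (x y : R) : cos x * cos y = 2^-1 * cos (x - y) + 2^-1 * cos (x + y).
Proof. by rewrite cosB cosD; field. Qed.

Lemma sinMsin (x y : R) : sin x * sin y = 2^-1 * cos (x - y) + - 2^-1 * cos (x + y).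
Proof. by rewrite cosB cosD; field. Qed.

Lemma sinMcos (x y : R) : sin x * cos y = 2^-1 * sin (x - y) + 2^-1 * sin (x + y).
Proof. by rewrite sinB sinD; field. Qed.

(** The indices [n] and [- n] give the same function up to sign, so orthogonality holds only among
    nonnegative and among negative indices. Bessel's inequality for each half turns [2 pi] into
    [4 pi]. The parameter [s] treats cosine and sine at once. *)
Lemma bessel_int (e : R -> R) (s : R) f (F : seq int) : continuous f ->
  continuous e -> (forall x, `|e x| <= 1) ->
  (forall x y, e x * e y = 2^-1 * cos (x - y) + s * cos (x + y)) -> uniq F ->
  \sum_(n <- F) circle_int (fun x => f x * e (n%:~R * x)) ^+ 2 <=
  pi *+ 4 * circle_int (fun x => f x ^+ 2).
Proof.
move=> cf ce e1 eM uF.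
have cen (n : int) : continuous (fun x : R => e (n%:~R * x)).
  by move=> x; apply: continuous_comp; [exact: (C1_continuous (C1_scale _))|exact: ce].
have orth (n m : int) : n - m != 0 -> n + m != 0 ->
    circle_int (fun x => e (n%:~R * x) * e (m%:~R * x)) = 0.
  move=> nm nm'; under eq_fun do rewrite eM -mulrBl -mulrDl -rmorphB -rmorphD/=.
  rewrite circle_intD ?circle_intZ ?circle_int_cos0 ?mulr0 ?addr0//;
    try exact: continuous_cosz;
    by apply: continuous_mul; [move=> ?; exact: cst_continuous|exact: continuous_cosz].
have nrm (n : int) : circle_int (fun x => e (n%:~R * x) * e (n%:~R * x)) <= pi *+ 2.
  rewrite -[leRHS]mul1r -circle_int_cst; apply: circle_int_le.
  - exact: (continuous_mul (cen n) (cen n)).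
  - by move=> x; exact: cst_continuous.
  by move=> x _; rewrite -expr2 -real_normK ?num_real// exprn_ile1.
rewrite (bigID (fun n : int => 0 <= n))/= -big_filter -[X in _ + X]big_filter.
have -> : pi *+ 4 = pi *+ 2 + pi *+ 2 :> R by rewrite -mulrnDr.
rewrite mulrDl; apply: lerD.
- apply: (bessel (e := fun n x => e (n%:~R * x)) cf cen); rewrite ?filter_uniq//.
  move=> n m; rewrite !mem_filter => /andP[n0 _] /andP[m0 _] nm; apply: orth; lia.
- apply: (bessel (e := fun n x => e (n%:~R * x)) cf cen); rewrite ?filter_uniq//.
  move=> n m; rewrite !mem_filter => /andP[n0 _] /andP[m0 _] nm; apply: orth; lia.
Qed.

(** Indexing by all of [int] lets multiplication by [cos (w x)] act by shifts in both directions;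
    without the factor [1 / (2 pi)] the Fourier coefficient is [cos_coef f n - i sin_coef f n]. *)
Definition cos_coef f (n : int) := circle_int (fun x => f x * cos (n%:~R * x)).
Definition sin_coef f (n : int) := circle_int (fun x => f x * sin (n%:~R * x)).

Lemma bessel_cos f (F : seq int) : continuous f -> uniq F ->
  \sum_(n <- F) cos_coef f n ^+ 2 <= pi *+ 4 * circle_int (fun x => f x ^+ 2).
Proof.
move=> cf uF; apply: (bessel_int (s := 2^-1)) => //; [exact: continuous_cos|
  exact: cos_max|exact: cosMcos].
Qed.

Lemma bessel_sin f (F : seq int) : continuous f -> uniq F ->
  \sum_(n <- F) sin_coef f n ^+ 2 <= pi *+ 4 * circle_int (fun x => f x ^+ 2).
Proof.
move=> cf uF; apply: (bessel_int (s := - 2^-1)) => //; [exact: continuous_sin|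
  exact: sin_max|exact: sinMsin].
Qed.

Lemma cos_coefD f g n : continuous f -> continuous g ->
  cos_coef (fun x => f x + g x) n = cos_coef f n + cos_coef g n.
Proof.
move=> cf cg; rewrite /cos_coef; under eq_fun do rewrite mulrDl.
by rewrite circle_intD//; exact/continuous_mul/continuous_cosz.
Qed.

Lemma sin_coefD f g n : continuous f -> continuous g ->
  sin_coef (fun x => f x + g x) n = sin_coef f n + sin_coef g n.
Proof.
move=> cf cg; rewrite /sin_coef; under eq_fun do rewrite mulrDl.
by rewrite circle_intD//; exact/continuous_mul/continuous_sinz.
Qed.

Lemma cos_coefMcos f w n : continuous f ->
  cos_coef (fun x => f x * cos (w%:R * x)) n =
  (cos_coef f (n - w%:Z) + cos_coef f (n + w%:Z)) / 2.
Proof.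
move=> cf; rewrite /cos_coef mulrC -circle_intD;
  try exact: (continuous_mul cf (@continuous_cosz _)).
rewrite -circle_intZ; last first.
  by move=> x; apply: cvgD; exact: (continuous_mul cf (@continuous_cosz _)).
congr circle_int; apply/funext => x; rewrite -mulrA [cos _ * cos _]mulrC cosMcos.
by rewrite rmorphB rmorphD/= !mulrDl mulNr; ring.
Qed.

Lemma sin_coefMcos f w n : continuous f ->
  sin_coef (fun x => f x * cos (w%:R * x)) n =
  (sin_coef f (n - w%:Z) + sin_coef f (n + w%:Z)) / 2.
Proof.
move=> cf; rewrite /sin_coef mulrC -circle_intD;
  try exact: (continuous_mul cf (@continuous_sinz _)).
rewrite -circle_intZ; last first.
  by move=> x; apply: cvgD; exact: (continuous_mul cf (@continuous_sinz _)).
congr circle_int; apply/funext => x; rewrite -mulrA [cos _ * sin _]mulrC sinMcos.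
by rewrite rmorphB rmorphD/= !mulrDl mulNr; ring.
Qed.

End CircleIntegral.

(** * Riesz products *)

Section RieszProducts.
Variable R : realType.
Implicit Types (f g : R -> R) (m : nat -> R) (w : seq nat) (q B D y e kappa : R).

(* [\sum_k m_k e_k(cos(w_1 x), ..., cos(w_n x))] with the elementary symmetric
   polynomials [e_k]; for [m_k = s^k] it is the Riesz product [\prod_i (1 + s cos(w_i x))]. *)
Fixpoint riesz m w (x : R) : R :=
  if w is v :: w' then riesz m w' x + riesz (fun k => m k.+1) w' x * cos (v%:R * x)
  else m 0%N.

Lemma C1_riesz m w : C1 (riesz m w).
Proof.
elim: w m => [|v w IH] m /=; first exact: C1_cst.
by apply: C1D; [exact: IH|apply: C1M; [exact: IH|exact: C1_cosz]].
Qed.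

Lemma riesz_power_sum (T : Type) (r : seq T) (c s : T -> R) w x :
  riesz (fun k => \sum_(p <- r) c p * s p ^+ k) w x =
  \sum_(p <- r) c p * \prod_(v <- w) (1 + s p * cos (v%:R * x)).
Proof.
elim: w c => [|v w IH] c /=.
  by apply: eq_bigr => p _; rewrite big_nil expr0.
have -> : (fun k => \sum_(p <- r) c p * s p ^+ k.+1) =
    (fun k => \sum_(p <- r) c p * s p * s p ^+ k).
  by apply/funext => k; apply: eq_bigr => p _; rewrite exprS mulrA.
rewrite !IH mulr_suml -big_split/=; apply: eq_bigr => p _.
by rewrite big_cons; ring.
Qed.

Lemma riesz_sub m w x : riesz m w x - m 0%N = riesz (fun k => if k is 0 then 0 else m k) w x.
Proof.
elim: w => [|v w IH] /=; first by rewrite subrr.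
by rewrite -IH addrAC.
Qed.

Lemma eventually_uniform (P : nat -> nat -> Prop) (J : nat) :
  (forall j, (j <= J)%N -> exists N, forall v, (N <= v)%N -> P j v) ->
  exists N, forall v, (N <= v)%N -> forall j, (j <= J)%N -> P j v.
Proof.
elim: J => [|J IH] H.
  have [N NP] := H 0%N isT; exists N => v Nv j; rewrite leqn0 => /eqP ->; exact: NP.
have [j jJ|N NP] := IH; first by apply: H; exact: leqW.
have [N' NP'] := H J.+1 (leqnn _).
exists (maxn N N') => v; rewrite geq_max => /andP[Nv Nv'] j.
by rewrite leq_eqVlt => /predU1P[->|]; [exact: NP'|rewrite ltnS; exact: NP].
Qed.

Lemma lq_boundedZ q (a : int -> R) B (c : R) :
  lq_bounded q a B -> lq_bounded q (fun n => c * a n) (`|c| `^ q * B).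
Proof.
move=> aB F uF; under eq_bigr do rewrite normrM powRM//.
by rewrite -mulr_sumr ler_wpM2l ?powR_ge0 ?aB.
Qed.

Lemma cos_coefZ (c : R) f n : continuous f ->
  cos_coef (fun x => f x * c) n = c * cos_coef f n.
Proof.
move=> cf; rewrite /cos_coef -circle_intZ; last exact: (continuous_mul cf (@continuous_cosz _ _)).
by congr circle_int; apply/funext => x; ring.
Qed.

Lemma sin_coefZ (c : R) f n : continuous f ->
  sin_coef (fun x => f x * c) n = c * sin_coef f n.
Proof.
move=> cf; rewrite /sin_coef -circle_intZ; last exact: (continuous_mul cf (@continuous_sinz _ _)).
by congr circle_int; apply/funext => x; ring.
Qed.

(* The frequencies are chosen one at a time, each one large compared to its predecessors;
   in the limit the [q]-norms then add up and the factors become independent. *)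
Lemma riesz_frequencies (S : R -> R) q B m D y kappa (n Om : nat) e :
  0 < q -> 1 <= q -> C1 S -> lq_bounded q (cos_coef S) B -> lq_bounded q (sin_coef S) B ->
  0 <= D -> 0 <= y -> (forall k, `|m k| `^ q <= D * y ^+ k) -> 0 <= kappa <= 2 -> 0 < e ->
  exists w, [/\ size w = n, all (fun v => Om < v)%N w,
    lq_bounded q (cos_coef (fun x => S x * riesz m w x))
      (D * (1 + 2 `^ (1 - q) * y) ^+ n * B + e) /\
    lq_bounded q (sin_coef (fun x => S x * riesz m w x))
      (D * (1 + 2 `^ (1 - q) * y) ^+ n * B + e),
    forall f g F0 F1, continuous g -> (forall x, is_derive x (1 : R) f (g x)) ->
      (forall x, x \in `[0, pi *+ 2] -> `|f x| <= F0) ->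
      (forall x, x \in `[0, pi *+ 2] -> `|g x| <= F1) ->
      `|circle_int (fun x => S x * (riesz m w x - m 0%N) * f x)| <= e * (F0 + F1) &
    circle_int (fun x => \prod_(v <- w) (1 - kappa * cos (v%:R * x) ^+ 2)) <=
      (1 - kappa / 2) ^+ n * (pi *+ 2) + e].
Proof.
move=> q0 q1 CS cB sB D0 y0 mD /andP[k0 k2] e0.
have cS := C1_continuous CS.
set c := 1 + 2 `^ (1 - q) * y.
have p0 : 0 < 2 `^ (1 - q) :> R by rewrite powR_gt0.
have p1 : 2 `^ (1 - q) <= 1 :> R.
  by rewrite -[leRHS](powRr0 2); apply: ler_powR; rewrite ?ler1n//; lra.
pose mj j k := m (j + k)%N.
(* Prepending a frequency also calls [riesz] on the shifted weights, so the induction has to carry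
   every shift [mj j] that the remaining frequencies can still reach. *)
suff : forall n0, (n0 <= n)%N -> forall e, 0 < e -> exists w,
    [/\ size w = n0, all (fun v => Om < v)%N w,
    forall j, (j <= n - n0)%N ->
      lq_bounded q (cos_coef (fun x => S x * riesz (mj j) w x)) (D * y ^+ j * c ^+ n0 * B + e) /\
      lq_bounded q (sin_coef (fun x => S x * riesz (mj j) w x)) (D * y ^+ j * c ^+ n0 * B + e),
    forall f g F0 F1, continuous g -> (forall x, is_derive x (1 : R) f (g x)) ->
      (forall x, x \in `[0, pi *+ 2] -> `|f x| <= F0) ->
      (forall x, x \in `[0, pi *+ 2] -> `|g x| <= F1) ->
      `|circle_int (fun x => S x * (riesz m w x - m 0%N) * f x)| <= e * (F0 + F1) &
    circle_int (fun x => \prod_(v <- w) (1 - kappa * cos (v%:R * x) ^+ 2)) <=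
      (1 - kappa / 2) ^+ n0 * (pi *+ 2) + e].
  move=> /(_ n (leqnn n) e e0)[w [sw aw wB wf wk]]; exists w; split => //.
  by have := wB 0%N (leq0n _); rewrite expr0 mulr1.
elim=> [|n0 IH] n0n {}e {}e0.
  exists [::]; split => //=.
  - move=> j _; rewrite /mj addn0 expr0 mulr1.
    have le : `|m j| `^ q * B <= D * y ^+ j * B + e.
      apply: (@le_trans _ _ (D * y ^+ j * B)); last by rewrite lerDl ltW.
      by rewrite ler_wpM2r// (lq_bounded_ge0 cB).
    split.
      have -> : cos_coef (fun x => S x * m j) = fun n => m j * cos_coef S n.
        by apply/funext => k; exact: cos_coefZ.
      exact: lq_bounded_le (lq_boundedZ _ cB) le.
    have -> : sin_coef (fun x => S x * m j) = fun n => m j * sin_coef S n.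
      by apply/funext => k; exact: sin_coefZ.
    exact: lq_bounded_le (lq_boundedZ _ sB) le.
  - move=> f g F0 F1 _ _ fF gF; under eq_fun do rewrite subrr mulr0 mul0r.
    rewrite circle_int_cst mul0r normr0 mulr_ge0 ?(ltW e0)// addr_ge0//.
      by apply: le_trans (fF 0 _); rewrite // in_itv/= lexx mulrn_wge0// pi_ge0.
    by apply: le_trans (gF 0 _); rewrite // in_itv/= lexx mulrn_wge0// pi_ge0.
  - by under eq_fun do rewrite big_nil; rewrite circle_int_cst expr0 lerDl ltW.
have e30 : 0 < e / 3 by rewrite divr_gt0.
have [w [sw aw wB wf wk]] := IH (ltnW n0n) _ e30.
have cR j : continuous (fun x => S x * riesz (mj j) w x).
  exact: (continuous_mul cS (C1_continuous (C1_riesz _ _))).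
have rieszE v j x : riesz (mj j) (v :: w) x =
    riesz (mj j) w x + riesz (mj j.+1) w x * cos (v%:R * x).
  rewrite /=; congr (_ + riesz _ _ _ * _).
  by apply/funext => k; rewrite /mj addnS addSn.
(* The main terms combine by [c = 1 + 2^(1 - q) y]; the three errors fit into [e] because the factor
   [2^(1 - q)] of the middle one is at most 1. *)
have bnd j : D * y ^+ j * c ^+ n0 * B + e / 3 +
      2 `^ (1 - q) * (D * y ^+ j.+1 * c ^+ n0 * B + e / 3) + e / 3 <=
    D * y ^+ j * c ^+ n0.+1 * B + e.
  have -> : D * y ^+ j * c ^+ n0.+1 * B = D * y ^+ j * c ^+ n0 * B +
      2 `^ (1 - q) * (D * y ^+ j.+1 * c ^+ n0 * B).
    by rewrite !exprS [in LHS]/c; ring.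
  rewrite mulrDr; have : 2 `^ (1 - q) * (e / 3) <= 1 * (e / 3).
    by rewrite ler_wpM2r// ltW.
  by lra.
have [N1 NP1] : exists N, forall v, (N <= v)%N -> forall j, (j <= n - n0.+1)%N ->
    lq_bounded q (cos_coef (fun x => S x * riesz (mj j) (v :: w) x))
      (D * y ^+ j * c ^+ n0.+1 * B + e) /\
    lq_bounded q (sin_coef (fun x => S x * riesz (mj j) (v :: w) x))
      (D * y ^+ j * c ^+ n0.+1 * B + e).
  apply: eventually_uniform => j jn.
  have [|c1 s1] := wB j; first by move: jn n0n; clear; lia.
  have [|c2 s2] := wB j.+1; first by move: jn n0n; clear; lia.
  have [Nc NcP] := lq_bounded_cos q0 c1 c2 e30.
  have [Ns NsP] := lq_bounded_cos q0 s1 s2 e30.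
  exists (maxn Nc Ns) => v; rewrite geq_max => /andP[vc vs].
  have -> : (fun x => S x * riesz (mj j) (v :: w) x) = (fun x => S x * riesz (mj j) w x +
      S x * riesz (mj j.+1) w x * cos (v%:R * x)).
    by apply/funext => x; rewrite rieszE; ring.
  have cRv := continuous_mul (cR j.+1) (@continuous_cosz _ v%:R).
  split.
    rewrite (_ : cos_coef _ = fun n => cos_coef (fun x => S x * riesz (mj j) w x) n +
      (cos_coef (fun x => S x * riesz (mj j.+1) w x) (n - v%:Z) +
       cos_coef (fun x => S x * riesz (mj j.+1) w x) (n + v%:Z)) / 2).
      by apply: lq_bounded_le (NcP v vc) _; exact: bnd.
    by apply/funext => k; rewrite (cos_coefD _ (cR j) cRv) (cos_coefMcos _ _ (cR _)).
  rewrite (_ : sin_coef _ = fun n => sin_coef (fun x => S x * riesz (mj j) w x) n +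
      (sin_coef (fun x => S x * riesz (mj j.+1) w x) (n - v%:Z) +
       sin_coef (fun x => S x * riesz (mj j.+1) w x) (n + v%:Z)) / 2).
    by apply: lq_bounded_le (NsP v vs) _; exact: bnd.
  by apply/funext => k; rewrite (sin_coefD _ (cR j) cRv) (sin_coefMcos _ _ (cR _)).
have [N2 NP2] := riemann_lebesgue (C1M CS (C1_riesz (mj 1%N) w)) e30.
pose h x := \prod_(v <- w) (1 - kappa * cos (v%:R * x) ^+ 2).
have Ch : C1 h.
  apply: C1_prod => v; apply: C1D; first exact: C1_cst.
  rewrite (_ : (fun x => _) = fun x => - kappa * (cos (v%:R * x) * cos (v%:R * x))).
    by apply: C1M; [exact: C1_cst|apply: C1M; exact: C1_cosz].
  by apply/funext => x; rewrite mulNr expr2.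
have [N3 NP3] := riemann_lebesgue Ch e30.
pose v := maxn (maxn N1 N2) (maxn N3 Om.+1).
have [vN1 vN2 vN3 vOm] : [/\ N1 <= v, N2 <= v, N3 <= v & Om < v]%N by rewrite /v; clear; split; lia.
exists (v :: w); split => /=; first by rewrite sw.
- by rewrite vOm.
- exact: NP1.
- move=> f g F0 F1 cg df fF gF; have cf : continuous f by apply: C1_continuous; exists g.
  rewrite (_ : (fun x => _) = fun x => S x * (riesz m w x - m 0%N) * f x +
      S x * riesz (mj 1%N) w x * f x * cos (v%:R * x)); last first.
    apply/funext => x; have /= := rieszE v 0%N x.
    by rewrite /mj/=; rewrite (_ : (fun k => m (0 + k)%N) = m)// => ->; ring.
  have cR1 : continuous (fun x => S x * (riesz m w x - m 0%N)).
    apply: continuous_mul => //.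
    by apply: continuous_add; [exact/C1_continuous/C1_riesz|move=> x; exact: cst_continuous].
  rewrite circle_intD; [|exact: (continuous_mul cR1 cf)|
    exact: (continuous_mul (continuous_mul (cR 1%N) cf) (@continuous_cosz _ _))].
  apply: le_trans (ler_normD _ _) _.
  have H1 := wf f g F0 F1 cg df fF gF.
  have H2 := NP2 v vN2 f g F0 F1 cg df fF gF.
  apply: le_trans (lerD H1 H2) _.
  have : 0 <= e / 3 * (F0 + F1) by apply: le_trans H1.
  by rewrite -mulrDl; lra.
- have ch := C1_continuous Ch.
  (* Since [cos^2 = (1 + cos (2 v x)) / 2], the new factor is its mean [1 - kappa / 2] minus an
     oscillation of frequency [2 v]; hence the Riemann-Lebesgue bound at [v.*2]. *)
  rewrite (_ : (fun x => _) = fun x => (1 - kappa / 2) * h x +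
      (- (kappa / 2)) * (h x * 1 * cos ((v.*2)%:R * x))); last first.
    apply/funext => x; rewrite big_cons -/(h x).
    have -> : (v.*2)%:R * x = (v%:R * x) *+ 2 by rewrite -muln2 natrM mulr2n; ring.
    by rewrite cos_mulr2n mulr2n; field.
  have chc : continuous (fun x => h x * 1 * cos ((v.*2)%:R * x)).
    apply: continuous_mul; last exact: continuous_cosz.
    by apply: continuous_mul => // x; exact: cst_continuous.
  rewrite circle_intD; last 2 first.
    by apply: continuous_mul => // x; exact: cst_continuous.
    by apply: continuous_mul => // x; exact: cst_continuous.
  rewrite !circle_intZ//.
  have v2 : (N3 <= v.*2)%N by rewrite -addnn; move: vN3; clear; lia.
  have H3 : `|circle_int (fun x => h x * 1 * cos (v.*2%:R * x))| <= e / 3.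
    have c0 : continuous (fun _ : R => 0 : R) by move=> x; exact: cst_continuous.
    have d0 (x : R) : is_derive x (1 : R) (fun=> 1 : R) ((fun=> 0) x).
      exact: is_derive_cst.
    have := NP3 v.*2 v2 (fun=> 1) (fun=> 0) 1 0 c0 d0; rewrite addr0 mulr1; apply.
    - by move=> x _; rewrite normr1.
    - by move=> x _; rewrite normr0.
  have kh : 0 <= 1 - kappa / 2 by lra.
  have H4 : (1 - kappa / 2) * circle_int h <=
      (1 - kappa / 2) ^+ n0.+1 * (pi *+ 2) + (1 - kappa / 2) * (e / 3).
    by rewrite exprS -mulrA -mulrDr ler_wpM2l.
  have H5 : - (kappa / 2) * circle_int (fun x => h x * 1 * cos (v.*2%:R * x)) <=
      kappa / 2 * (e / 3).
    rewrite mulNr -mulrN ler_wpM2l//; first lra.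
    by apply: le_trans (ler_norm _) _; rewrite normrN.
  apply: le_trans (lerD H4 H5) _; rewrite -addrA -mulrDl subrK mul1r.
  by lra.
Qed.

End RieszProducts.

(** * The cutoff, the Chernoff bound and the choice of parameters *)

Section RieszStep.
Variable R : realType.
Implicit Types (f g S : R -> R) (m : nat -> R) (w : seq nat) (q B D a s t : R).

Lemma is_derive_quadratic f (x l : R) :
  (forall h, `|f (h + x) - f x - l * h| <= h ^+ 2) -> is_derive x (1 : R) f l.
Proof.
move=> H.
have Hl : h^-1 *: ((f \o shift x) (h *: (1 : R)) - f x) @[h --> 0^'] --> l.
  apply/cvgrPdist_le => e e0; near=> h.
  have h0 : h != 0 by near: h; exact: nbhs_dnbhs_neq.
  rewrite /= [h *: 1]mulr1 [_ *: _]/(_ * _).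
  have -> : l - h^-1 * (f (h + x) - f x) = - (h^-1 * (f (h + x) - f x - l * h)).
    by field.
  rewrite normrN normrM normfV ler_pdivrMl ?normr_gt0//.
  apply: le_trans (H h) _; rewrite -[h ^+ 2]ger0_norm ?sqr_ge0// expr2 normrM.
  rewrite ler_pM2l ?normr_gt0//; near: h.
  by apply: dnbhs0_le.
apply: DeriveDef; first exact: cvgP Hl.
exact: cvg_lim Hl.
Unshelve. all: by end_near. Qed.

(** The square makes the positive part differentiable at 0: the cutoff can equal 1 exactly below the
    threshold and still be C^1. *)
Definition sqr_pos (u : R) := Num.max 0 u ^+ 2.

Lemma C1_sqr_pos : C1 sqr_pos.
Proof.
exists (fun u => 2 * Num.max 0 u) => [u|u].
  apply: cvgM; first exact: cvg_cst.
  by apply: (@continuous_max _ _ (fun=> 0) id) => //; exact: cst_continuous.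
apply: is_derive_quadratic => h; rewrite /sqr_pos ler_norml.
by case: (leP 0 (h + u)); case: (leP 0 u) => H1 H2; apply/andP; split; nra.
Qed.

Definition freq_avg w (x : R) := (\sum_(v <- w) cos (v%:R * x)) / (size w)%:R.

Lemma C1_freq_avg w : C1 (freq_avg w).
Proof.
rewrite /freq_avg; apply: C1M; last exact: C1_cst.
by apply: C1_sum => v; exact: C1_cosz.
Qed.

(** The left side behaves like [1 - y^2] near 0, and this second-order loss is the source of the
    Gaussian decay. The lower bound [(1 + y / 2)^4] for [expR (2 * y)] makes the claim
    polynomial. *)
Lemma sqr_expR_le (y : R) : `|y| <= 1 / 2 ->
  (1 + y) ^+ 2 * expR (- (2 * y)) <= 1 - y ^+ 2 / 4.
Proof.
rewrite ler_norml => /andP[y1 y2].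
rewrite expRN ler_pdivrMr ?expR_gt0//.
have e1 : 1 + y / 2 <= expR (y / 2) by exact: expR_ge1Dx.
have e4 : (1 + y / 2) ^+ 4 <= expR (2 * y).
  have -> : expR (2 * y) = expR (y / 2) ^+ 4.
    by rewrite -expRM_natl; congr expR; field.
  by rewrite ler_pXn2r// nnegrE ?expR_ge0//; lra.
apply: (@le_trans _ _ ((1 - y ^+ 2 / 4) * (1 + y / 2) ^+ 4)); last first.
  by rewrite ler_wpM2l//; nra.
have -> : (1 - y ^+ 2 / 4) * (1 + y / 2) ^+ 4 = (1 + y) ^+ 2 +
   y ^+ 2 * (1 / 4 - 5 / 16 * y ^+ 2 - 1 / 8 * y ^+ 3 - 1 / 64 * y ^+ 4) by field.
rewrite lerDl mulr_ge0 ?sqr_ge0//.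
have y22 : y ^+ 2 <= 1 / 4 by nra.
have -> : y ^+ 3 = y * y ^+ 2 by ring.
have -> : y ^+ 4 = y ^+ 2 * y ^+ 2 by ring.
have := sqr_ge0 y; nra.
Qed.

(* [64 n = a n / (2 c)] for the threshold [c = a / 128]; this makes the cutoff smaller than
   the exponential tilt [exp (2 s (2 c n - \sum cos))] for every [s <= 2 a]. *)
Definition cutoff a w (x : R) :=
  expR (- (64 * (size w)%:R * sqr_pos (freq_avg w x - a / 128))).

Lemma C1_cutoff a w : C1 (cutoff a w).
Proof.
apply: (C1_comp (@C1_expR R)).
rewrite (_ : (fun x => _) = fun x => - (64 * (size w)%:R) * sqr_pos (freq_avg w x + - (a / 128))).
  apply: C1M; first exact: C1_cst.
  apply: (C1_comp C1_sqr_pos); apply: C1D; [exact: C1_freq_avg|exact: C1_cst].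
by apply/funext => x; rewrite mulNr.
Qed.

Lemma cutoff_tilt a s w x : 0 < a -> a <= s <= 2 * a -> (0 < size w)%N ->
  cutoff a w x ^+ 2 <=
  expR (a ^+ 2 / 16 * (size w)%:R) * \prod_(v <- w) expR (- (2 * (s * cos (v%:R * x)))).
Proof.
move=> a0 /andP[s1 s2] w0.
set n : R := (size w)%:R.
have n0 : 0 < n by rewrite ltr0n.
have -> : \prod_(v <- w) expR (- (2 * (s * cos (v%:R * x)))) =
    expR (- (2 * s * n * freq_avg w x)).
  rewrite -expR_sum; congr expR; rewrite sumrN; congr (- _).
  rewrite /freq_avg -/n -!mulr_sumr; field; exact: lt0r_neq0.
rewrite /cutoff -expRM_natl -expRD ler_expR -/n /sqr_pos.
set u := freq_avg w x.
have sa : s * a <= 2 * a ^+ 2 by nra.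
(* Shifting [u] by [a / 64], twice the threshold, costs the factor [exp (a^2 n / 16)], because
   [s a <= 2 a^2]. *)
suff : 2 * s * (u - a / 64) <= 2 * (64 * Num.max 0 (u - a / 128) ^+ 2).
  move=> H; have : n * (2 * s * (u - a / 64)) <= n * (2 * (64 * Num.max 0 (u - a / 128) ^+ 2)).
    by rewrite ler_wpM2l// ltW.
  have : n * (s * a) <= n * (2 * a ^+ 2) by rewrite ler_wpM2l// ltW.
  by nra.
case: (leP 0 (u - a / 128)) => hu; last by nra.
set d := u - a / 128 in hu *; have -> : u - a / 64 = d - a / 128 by rewrite /d; field.
have : 2 * s * (d - a / 128) <= Num.max 0 (4 * a * (d - a / 128)).
  have [da|da] := leP 0 (d - a / 128).
    by rewrite le_max; apply/orP; right; nra.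
  by rewrite le_max; apply/orP; left; nra.
move=> /le_trans; apply; rewrite ge_max; apply/andP; split; first by nra.
(* The difference of the two sides is [2 (8 d - a / 8)^2]: the constant 64 of the cutoff makes the
   line tangent to the parabola. *)
have := sqr_ge0 (d - a / 64); have := sqr_ge0 (8 * d - a / 8); nra.
Qed.

(** The tilt hands each squared factor of the Riesz product an [exp (- 2 y)] with [y = s cos (v x)],
    so [sqr_expR_le] applies factor by factor. Bounding [s] below by [a] makes the result
    independent of [s]. *)
Lemma riesz_cutoff_le a s w x : 0 < a <= 1 / 4 -> a <= s <= 2 * a -> (0 < size w)%N ->
  (\prod_(v <- w) (1 + s * cos (v%:R * x)) * cutoff a w x) ^+ 2 <=
  expR (a ^+ 2 / 16 * (size w)%:R) * \prod_(v <- w) (1 - a ^+ 2 / 4 * cos (v%:R * x) ^+ 2).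
Proof.
move=> /andP[a0 a4] sa w0; have /andP[s1 s2] := sa.
rewrite exprMn.
apply: le_trans (ler_wpM2l (sqr_ge0 _) (cutoff_tilt x a0 sa w0)) _.
rewrite mulrCA ler_wpM2l ?expR_ge0// -prodrXl -big_split/=.
rewrite big_seq [leRHS]big_seq; apply: ler_prod => v _.
set t := cos _; rewrite mulr_ge0 ?sqr_ge0 ?expR_ge0//=.
have : -1 <= t <= 1 by rewrite cos_geN1 cos_le1.
move: t => t /andP[t1 t2].
apply: le_trans (sqr_expR_le _) _.
  by rewrite ler_norml; apply/andP; split; nra.
have : 0 <= (s ^+ 2 - a ^+ 2) * t ^+ 2 by rewrite mulr_ge0 ?sqr_ge0//; nra.
by rewrite exprMn; lra.
Qed.

(** The bound for a single product does not depend on its parameter, so a signed combination loses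
    only its mass. *)
Lemma riesz_combination_le (r : seq (R * R)) a (M : R) w x : 0 < a <= 1 / 4 ->
  (forall p, p \in r -> 1 <= p.2 <= 2) -> \sum_(p <- r) `|p.1| <= M -> (0 < size w)%N ->
  (\sum_(p <- r) p.1 * \prod_(v <- w) (1 + a * p.2 * cos (v%:R * x)) * cutoff a w x) ^+ 2 <=
  M ^+ 2 * (expR (a ^+ 2 / 16 * (size w)%:R) *
    \prod_(v <- w) (1 - a ^+ 2 / 4 * cos (v%:R * x) ^+ 2)).
Proof.
move=> aa rP rM w0; have /andP[a0 a4] := aa.
set W := expR _ * _.
(* The empty combination is separate because the nonnegativity of [W] is otherwise read off from the
   bound for one term. *)
have [r0|[p0 p0r]] : r = [::] \/ exists p, p \in r.
  by case: (r) => [|p r']; [left|right; exists p; rewrite inE eqxx].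
  move: rM; rewrite r0 !big_nil expr0n/= => M0.
  rewrite mulr_ge0 ?sqr_ge0// mulr_ge0 ?expR_ge0// big_seq.
  apply: prodr_ge0 => v _; have := cos_max (v%:R * x).
  move: (cos _) => t; rewrite ler_norml => /andP[t1 t2].
  have : t ^+ 2 <= 1 by nra.
  have : a ^+ 2 <= 1 by nra.
  by have := sqr_ge0 t; have := sqr_ge0 a; nra.
have rs p : p \in r -> a <= a * p.2 <= 2 * a.
  by move=> /rP /andP[h1 h2]; apply/andP; split; nra.
have W0 : 0 <= W by apply: le_trans (sqr_ge0 _) (riesz_cutoff_le x aa (rs _ p0r) w0).
have sW p : p \in r ->
    `|\prod_(v <- w) (1 + a * p.2 * cos (v%:R * x)) * cutoff a w x| <= Num.sqrt W.
  move=> pr; rewrite -sqrtr_sqr ler_wsqrtr//.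
  exact: riesz_cutoff_le (rs _ pr) _.
have H : `|\sum_(p <- r) p.1 * \prod_(v <- w) (1 + a * p.2 * cos (v%:R * x)) * cutoff a w x|
    <= M * Num.sqrt W.
  apply: le_trans (ler_norm_sum _ _ _) _.
  apply: (@le_trans _ _ (\sum_(p <- r) `|p.1| * Num.sqrt W)).
    rewrite big_seq [leRHS]big_seq; apply: ler_sum => p pr.
    by rewrite -mulrA normrM ler_wpM2l// sW.
  by rewrite -mulr_suml ler_wpM2r// sqrtr_ge0.
rewrite -[leLHS]ger0_norm ?sqr_ge0// normrX.
have -> : M ^+ 2 * W = (M * Num.sqrt W) ^+ 2 by rewrite exprMn sqr_sqrtr.
by rewrite lerXn2r ?nnegrE ?normr_ge0// (le_trans (normr_ge0 _) H).
Qed.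

(** [N0] is the number of frequencies per vanishing moment. The first inequality limits the l^q
    growth to [expR 1] per moment, against the gain [1 / z] and the cost [8^q] of the weights. The
    second gives [exp (- 112 / 16)] per moment in the squared L^2 norm, against [8^2]. They are
    compatible because [a^q / a^2] tends to 0 with [a]. *)
Lemma riesz_params q : 2 < q -> exists a (N0 : nat),
  [/\ 0 < a <= 1 / 4, (0 < N0)%N,
      2 * a `^ q * (2 * expR 1 * 8 `^ q) * N0%:R <= 1 & 112 <= a ^+ 2 * N0%:R].
Proof.
move=> q2; set z := 2 * expR 1 * 8 `^ q.
have z0 : 0 < z by rewrite !mulr_gt0 ?expR_gt0 ?powR_gt0.
(* [N0] will be about [112 / a^2], so that [a^2 N0 <= 113]; then [226 = 2 * 113]. *)
have [Y YE Y0] : exists2 Y, Y = 226 * z & 0 < Y.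
  by exists (226 * z) => //; apply: mulr_gt0 => //; rewrite ltr0n.
pose b := Y^-1 `^ (q - 2)^-1.
have b0 : 0 < b by apply: powR_gt0; rewrite invr_gt0.
pose a := Num.min (1 / 4) b.
have a0 : 0 < a by rewrite lt_min b0 andbT; lra.
have a4 : a <= 1 / 4 by rewrite ge_min lexx.
have ab : a `^ (q - 2) <= Y^-1.
  have -> : Y^-1 = b `^ (q - 2).
    rewrite -powRrM mulVf ?powRr1//; last by lra.
    by rewrite invr_ge0 ltW.
  apply: ge0_ler_powR; rewrite ?nnegrE ?(ltW a0) ?(ltW b0)//; first by lra.
  by rewrite ge_min lexx orbT.
have a20 : 0 < a ^+ 2 by rewrite exprn_gt0.
have qE : a `^ q = a `^ (q - 2) * a ^+ 2.
  rewrite -(powR_mulrn _ (ltW a0)) -powRD; first by congr (_ `^ _); ring.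
  by rewrite (gt_eqF a0) implybT.
pose N0 := (Num.truncn (112 / a ^+ 2)).+1.
have h0 : 0 <= 112 / a ^+ 2 by rewrite divr_ge0// ltW.
exists a, N0; split => //; first by rewrite a0.
- have /andP[h _] := truncn_itv h0.
  have N0le : a ^+ 2 * N0%:R <= 113.
    rewrite /N0 -natr1 mulrDr mulr1.
    have : a ^+ 2 * (Num.truncn (112 / a ^+ 2))%:R <= 112.
      by rewrite mulrC -ler_pdivlMr.
    by nra.
  rewrite qE.
  have -> : 2 * (a `^ (q - 2) * a ^+ 2) * z * N0%:R =
    a `^ (q - 2) * (2 * z * (a ^+ 2 * N0%:R)) by ring.
  apply: (@le_trans _ _ (Y^-1 * (2 * z * 113))).
    apply: ler_pM => //; first exact: powR_ge0.
      by rewrite !mulr_ge0// ?ltW// ltr0n.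
    by rewrite ler_pM2l// mulr_gt0.
  have -> : Y^-1 * (2 * z * 113) = 1 by rewrite YE; field; rewrite gt_eqF.
  by [].
- rewrite mulrC -ler_pdivrMr//; apply: ltW.
  exact: truncnS_gt.
Qed.

End RieszStep.

(** * The construction *)

Section Step.
Variable R : realType.
Implicit Types (f g S H U : R -> R) (w : seq nat) (q B : R).

Lemma half_expn_lt (e : R) : 0 < e -> exists2 l : nat, (0 < l)%N & 2^-1 ^+ l < e.
Proof.
move=> e0; have h1 : `|2^-1 : R| < 1 by rewrite gtr0_norm ?invr_gt0//; lra.
have /cvgrPdist_lt /(_ e e0) [N _ HN] := cvg_expr h1.
exists N.+1 => //; have := HN N.+1 (leqnSn N).
by rewrite /= sub0r normrN ger0_norm// exprn_ge0.
Qed.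

Lemma powR_exprn q (b : R) (n : nat) : 0 <= b -> (b ^+ n) `^ q = (b `^ q) ^+ n.
Proof.
move=> b0; elim: n => [|n IH]; first by rewrite !expr0 powR1.
by rewrite !exprS powRM ?exprn_ge0// IH.
Qed.

(** The new function is [S T (1 - cutoff) = S + (H - U)]. The error is kept in two parts that are
    small for different reasons: [H = S (T - 1)] in l^q and against C^1 functions, by the choice of
    the frequencies, and [U = S T cutoff] in L^2, by the Chernoff bound. The threshold precedes [S],
    so that one value serves the whole sequence. *)
Lemma riesz_step_core q : 2 < q -> exists2 c : R, 0 < c &
  forall S B e (Om : nat), C1 S -> lq_bounded q (cos_coef S) B ->
  lq_bounded q (sin_coef S) B -> 0 < e ->
  exists w H U,
  [/\ ((0 < size w)%N /\ all (fun v => Om < v)%N w) /\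
        C1 (fun x => S x + (H x - U x)),
      forall x, S x + (H x - U x) != 0 -> S x != 0 /\ c <= freq_avg w x,
      (continuous H /\ continuous U) /\
        (lq_bounded q (cos_coef H) e /\ lq_bounded q (sin_coef H) e),
      forall f g F0 F1, continuous g -> (forall x, is_derive x (1 : R) f (g x)) ->
        (forall x, x \in `[0, pi *+ 2] -> `|f x| <= F0) ->
        (forall x, x \in `[0, pi *+ 2] -> `|g x| <= F1) ->
        `|circle_int (fun x => H x * f x)| <= e * (F0 + F1) &
      circle_int (fun x => U x ^+ 2) <= e].
Proof.
move=> q2; have [q0 q1] : 0 < q /\ 1 <= q by split; lra.
have [a [N0 [aa N00 aN0 aN1]]] := riesz_params q2.
have /andP[a0 a4] := aa.
exists (a / 128); first by rewrite divr_gt0.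
move=> S B e Om CS cB sB e0; have cS := C1_continuous CS.
have B0 := lq_bounded_ge0 cB.
have [A A0 SA] := continuous_bounded_on cS.
have p0 : 0 < pi *+ 2 :> R by rewrite mulrn_wgt0 ?pi_gt0.
(* [2^(-l) Q] dominates both [2^(-l) B], the main term of the l^q bound for [H], and
   [2^(-l) A^2 (2 pi + 1)], the squared L^2 bound for [U]. *)
pose Q := B + A ^+ 2 * (pi *+ 2 + 1) + 1.
have Q0 : 0 < Q.
  by rewrite /Q ltr_wpDl// addr_ge0// mulr_ge0 ?sqr_ge0// addr_ge0// ltW.
have [l l0 lQ] : exists2 l : nat, (0 < l)%N & 2^-1 ^+ l < e / 2 / Q.
  by apply: half_expn_lt; rewrite !divr_gt0.
have hl0 : 0 <= 2^-1 ^+ l :> R by rewrite exprn_ge0.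
have lB : 2^-1 ^+ l * B <= e / 2.
  apply: (@le_trans _ _ (2^-1 ^+ l * Q)); last by rewrite -ler_pdivlMr// ltW.
  rewrite ler_wpM2l// /Q -addrA lerDl addr_ge0// mulr_ge0 ?sqr_ge0// addr_ge0//.
  exact: ltW.
have lA : 2^-1 ^+ l * (A ^+ 2 * (pi *+ 2 + 1)) <= e.
  apply: (@le_trans _ _ (2^-1 ^+ l * Q)); last first.
    by apply: le_trans (_ : e / 2 <= _); [rewrite -ler_pdivlMr// ltW|lra].
  by rewrite ler_wpM2l// /Q; lra.
have [r [rP r1 rk rM]] := vanishing_moments R l0.
pose m k := \sum_(p <- r) p.1 * (a * p.2) ^+ k.
have m0 : m 0%N = 1 by rewrite /m; under eq_bigr do rewrite expr0 mulr1.
have ml k : (0 < k <= l)%N -> m k = 0.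
  move=> kl; rewrite /m; under eq_bigr do rewrite exprMn mulrCA.
  by rewrite -mulr_sumr rk// mulr0.
have mle k : `|m k| <= 8 ^+ l * (2 * a) ^+ k.
  apply: le_trans (ler_norm_sum _ _ _) _.
  apply: (@le_trans _ _ (\sum_(p <- r) `|p.1| * (2 * a) ^+ k)).
    rewrite big_seq [leRHS]big_seq; apply: ler_sum => p /rP /andP[h1 h2].
    have p20 : 0 <= p.2 by apply: le_trans h1.
    rewrite normrM ler_wpM2l// normrX (ger0_norm (mulr_ge0 (ltW a0) p20)).
    by rewrite lerXn2r ?nnegrE ?mulr_ge0 ?(ltW a0)// mulrC ler_wpM2r// ltW.
  rewrite -mulr_suml ler_wpM2r// exprn_ge0// mulr_ge0//; exact: ltW.
set z := 2 * expR 1 * 8 `^ q in aN0.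
have P8 : 0 < 8 `^ q :> R by rewrite powR_gt0.
have E1 : 1 <= expR 1 :> R by apply: le_trans (expR_ge1Dx 1); rewrite lerDl.
have Q8 : 1 <= 8 `^ q :> R.
  by rewrite -[leLHS](powRr0 8); apply: ler_powR; rewrite ?ler1n//; lra.
have z1 : 1 <= z.
  rewrite /z -[leLHS](mulr1 1) ler_pM// -[leLHS](mulr1 1) ler_pM//; lra.
have z0 : 0 < z by apply: lt_le_trans z1.
pose m' k := if k is 0%N then 0 else m k.
pose y := (2 * a) `^ q * z.
have y0 : 0 <= y by rewrite mulr_ge0 ?powR_ge0 ?(ltW z0).
pose D := (8 `^ q / z) ^+ l.
have D0 : 0 <= D by rewrite exprn_ge0// divr_ge0 ?(ltW P8) ?(ltW z0).
have m'D k : `|m' k| `^ q <= D * y ^+ k.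
  (* Up to [l] the moments vanish; beyond [l] the factor [z^(k - l) >= 1] is inserted for free. It
     puts [z^(-l)] into [D] at the price of one factor [z] in [y]. *)
  have [kl|lk] := leqP k l.
    have -> : m' k = 0 by case: k kl => // k kl; rewrite /m' ml.
    by rewrite normr0 powR0 ?gt_eqF// mulr_ge0// exprn_ge0.
  have -> : m' k = m k by case: k lk.
  apply: (@le_trans _ _ ((8 ^+ l * (2 * a) ^+ k) `^ q)).
    apply: ge0_ler_powR; rewrite ?nnegrE ?(ltW q0) ?normr_ge0 ?mle//.
    exact: le_trans (normr_ge0 _) (mle k).
  rewrite powRM ?exprn_ge0 ?mulr_ge0 ?(ltW a0)// !powR_exprn ?mulr_ge0 ?(ltW a0)//.
  rewrite /D /y exprMn [(_ * z) ^+ k]exprMn exprVn.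
  have -> : (8 `^ q) ^+ l / z ^+ l * (((2 * a) `^ q) ^+ k * z ^+ k) =
    (8 `^ q) ^+ l * ((2 * a) `^ q) ^+ k * (z ^+ k / z ^+ l) by ring.
  rewrite ler_peMr ?mulr_ge0 ?exprn_ge0 ?powR_ge0//.
  by rewrite ler_pdivlMr ?exprn_gt0// mul1r ler_weXn2l// ltnW.
pose N := (l * N0)%N.
have N_gt0 : (0 < N)%N by rewrite muln_gt0 l0.
have NE : N%:R = l%:R * N0%:R :> R by rewrite natrM.
pose kappa := a ^+ 2 / 4.
have kap : 0 <= kappa <= 2 by rewrite /kappa; move: a0 a4; clear; nra.
have k8 : 0 < 1 - kappa / 2 by rewrite /kappa; move: a0 a4; clear; nra.
(* The second bound keeps the error in the integral of the product comparable to its exponentially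
   small main term. *)
pose e' := Num.min (e / 2) ((1 - kappa / 2) ^+ N).
have e'0 : 0 < e' by rewrite lt_min divr_gt0// exprn_gt0.
have [w [sw aw [cw sinw] fw kw]] :=
  riesz_frequencies N Om q0 q1 CS cB sB D0 y0 m'D kap e'0.
have sw0 : (0 < size w)%N by rewrite sw.
have DN : D * (1 + 2 `^ (1 - q) * y) ^+ N <= 2^-1 ^+ l.
  have yE : 2 `^ (1 - q) * y = 2 * a `^ q * z.
    rewrite /y powRM ?(ltW a0)// mulrA mulrA -powRD; last by rewrite pnatr_eq0 implybT.
    by rewrite subrK powRr1.
  have : (1 + 2 `^ (1 - q) * y) ^+ N <= expR 1 ^+ l.
    apply: (@le_trans _ _ (expR (2 * a `^ q * z) ^+ N)).
      apply: lerXn2r; rewrite ?nnegrE ?expR_ge0//; last by rewrite yE; exact: expR_ge1Dx.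
      by rewrite addr_ge0// mulr_ge0 ?powR_ge0.
    rewrite -!expRM_natl ler_expR mulr1 NE -mulrA ler_piMr//.
    by rewrite mulrC.
  move=> /(ler_wpM2l D0) /le_trans; apply.
  (* By the definition of [z], [8^q / z * expR 1] is exactly [1 / 2]. *)
  rewrite /D -exprMn ler_pXn2r ?nnegrE ?invr_ge0//.
    by rewrite /z; have := gt_eqF P8; have := gt_eqF (expR_gt0 (1 : R)) => h1 h2;
       rewrite le_eqVlt; apply/orP; left; apply/eqP; field; rewrite h1 h2.
  by rewrite mulr_ge0 ?expR_ge0// divr_ge0 ?(ltW P8) ?(ltW z0).
pose T := riesz m w.
have TE x : T x = 1 + riesz m' w x by rewrite -riesz_sub m0 addrC subrK.
pose H x := S x * riesz m' w x.
pose U x := S x * T x * cutoff a w x.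
have CU : C1 U.
  apply: C1M; last exact: C1_cutoff.
  by apply: C1M; [exact: CS|exact: C1_riesz].
have CH : C1 H by apply: C1M; [exact: CS|exact: C1_riesz].
have S'E x : S x + (H x - U x) = S x * (T x * (1 - cutoff a w x)).
  by rewrite /H /U TE; ring.
exists w, H, U; split.
- split; first by [].
  rewrite (_ : (fun x => _) = (fun x => S x + (H x + -1 * U x))).
    apply: C1D => //; apply: C1D => //; apply: C1M => //; exact: C1_cst.
  by apply/funext => x; rewrite mulN1r.
- move=> x; rewrite S'E mulf_eq0 negb_or => /andP[Sx].
  rewrite mulf_eq0 negb_or => /andP[_ cx]; split => //.
  (* Below the threshold the cutoff is exactly 1, so the factor [1 - cutoff] vanishes. *)
  move: cx; apply: contraR; rewrite -ltNge => h.
  rewrite /cutoff /sqr_pos max_l; last by rewrite subr_le0 ltW.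
  by rewrite expr0n mulr0 oppr0 expR0 subrr.
- split; first by split; exact: C1_continuous.
  have le : D * (1 + 2 `^ (1 - q) * y) ^+ N * B + e' <= e.
    have : D * (1 + 2 `^ (1 - q) * y) ^+ N * B <= 2^-1 ^+ l * B by rewrite ler_wpM2r.
    have : e' <= e / 2 by rewrite ge_min lexx.
    by lra.
  by split; [exact: lq_bounded_le cw le|exact: lq_bounded_le sinw le].
- move=> f g F0 F1 cg df fF gF.
  have := fw f g F0 F1 cg df fF gF; under eq_fun do rewrite subr0.
  move=> /le_trans; apply; rewrite ler_wpM2r//.
    have z01 : (0 : R) \in `[0, pi *+ 2] by rewrite in_itv/= lexx ltW.
    by rewrite addr_ge0//; [exact: le_trans (fF 0 z01)|exact: le_trans (gF 0 z01)].
  by apply: (@le_trans _ _ (e / 2)); [rewrite ge_min lexx|lra].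
- pose W x := \prod_(v <- w) (1 - kappa * cos (v%:R * x) ^+ 2).
  pose M := A ^+ 2 * ((8 ^+ l) ^+ 2 * expR (a ^+ 2 / 16 * N%:R)).
  have M0 : 0 <= M by rewrite !mulr_ge0 ?sqr_ge0 ?expR_ge0.
  have cW : continuous W.
    apply/C1_continuous/C1_prod => v; apply: C1D; first exact: C1_cst.
    rewrite (_ : (fun x => _) = fun x => - kappa * (cos (v%:R * x) * cos (v%:R * x))).
      by apply: C1M; [exact: C1_cst|apply: C1M; exact: C1_cosz].
    by apply/funext => x; rewrite mulNr expr2.
  have cU := C1_continuous CU.
  apply: (@le_trans _ _ (circle_int (fun x => M * W x))).
    apply: circle_int_le.
    - exact: (continuous_mul cU cU).
    - by apply: continuous_mul => // x; exact: cst_continuous.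
    move=> x xI; rewrite /U -mulrA exprMn /M -mulrA ler_pM ?sqr_ge0//.
      rewrite -[leLHS]ger0_norm ?sqr_ge0// normrX lerXn2r ?nnegrE ?normr_ge0//.
      exact: SA.
    have Hx := riesz_combination_le x aa rP rM sw0.
    rewrite sw in Hx; rewrite /T /m riesz_power_sum mulr_suml -[leRHS]mulrA.
    exact: Hx.
  rewrite circle_intZ//.
  apply: (@le_trans _ _ (M * ((1 - kappa / 2) ^+ N * (pi *+ 2 + 1)))).
    rewrite ler_wpM2l//; apply: le_trans kw _.
    have : e' <= (1 - kappa / 2) ^+ N by rewrite ge_min lexx orbT.
    have -> : (1 - kappa / 2) ^+ N * (pi *+ 2 + 1) =
      (1 - kappa / 2) ^+ N * (pi *+ 2) + (1 - kappa / 2) ^+ N by ring.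
    by rewrite lerD2l.
  apply: le_trans _ lA.
  have -> : M * ((1 - kappa / 2) ^+ N * (pi *+ 2 + 1)) =
    ((8 ^+ l) ^+ 2 * expR (a ^+ 2 / 16 * N%:R) * (1 - kappa / 2) ^+ N) *
    (A ^+ 2 * (pi *+ 2 + 1)) by rewrite /M; ring.
  rewrite ler_wpM2r//; first by rewrite mulr_ge0 ?sqr_ge0// addr_ge0// ltW.
  have h1 : (1 - kappa / 2) ^+ N <= expR (- (a ^+ 2 / 8 * N%:R)).
    apply: (@le_trans _ _ (expR (- (kappa / 2)) ^+ N)).
      by rewrite ler_pXn2r ?nnegrE ?expR_ge0 ?(ltW k8)//; exact: expR_ge1Dx.
    by rewrite -expRM_natl ler_expR /kappa; nra.
  apply: (@le_trans _ _ ((8 ^+ l) ^+ 2 * expR (a ^+ 2 / 16 * N%:R) *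
      expR (- (a ^+ 2 / 8 * N%:R)))).
    by rewrite ler_wpM2l// mulr_ge0 ?sqr_ge0 ?expR_ge0.
  rewrite -mulrA -expRD.
  have -> : a ^+ 2 / 16 * N%:R + - (a ^+ 2 / 8 * N%:R) = l%:R * - (a ^+ 2 * N0%:R / 16).
    by rewrite NE; field.
  rewrite expRM_natl exprAC -exprMn.
  apply: lerXn2r; rewrite ?nnegrE ?invr_ge0 ?(mulr_ge0 (sqr_ge0 _) (expR_ge0 _))//.
  (* [112 / 16 = 7] and [expR 1 >= 2]; the surplus over [8^2 = 2^6] is the remaining factor
     [1 / 2]. *)
  have h7 : expR (- (a ^+ 2 * N0%:R / 16)) <= (2 ^+ 7)^-1.
    apply: (@le_trans _ _ (expR (- (7%:R * 1)))).
      by rewrite ler_expR lerN2; lra.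
    rewrite expRN expRM_natl lef_pV2 ?posrE ?exprn_gt0 ?expR_gt0//.
    rewrite ler_pXn2r ?nnegrE ?expR_ge0//.
    exact: le_trans (expR_ge1Dx 1).
  apply: le_trans (ler_wpM2l (sqr_ge0 _) h7) _.
  by have -> : 8 ^+ 2 * (2 ^+ 7)^-1 = 2^-1 :> R by field.
Qed.

End Step.

(** * Iteration of the step *)

Section Sequence.
Variable R : realType.
Implicit Types (f g S H U : R -> R) (w : seq nat) (q B D : R).

(** A total of at most 1 forces every entry into [[-1, 1]], where the q-th power is below the
    square; this converts Bessel's inequality into an l^q bound. *)
Lemma lq_bounded_sqr q (a : int -> R) D : 2 <= q -> D <= 1 ->
  (forall F : seq int, uniq F -> \sum_(n <- F) a n ^+ 2 <= D) -> lq_bounded q a D.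
Proof.
move=> q2 D1 aD F uF; apply: le_trans (aD F uF); apply: ler_sum => n _.
have an : `|a n| <= 1.
  have := aD [:: n] isT; rewrite big_seq1 => h.
  by rewrite -[leRHS]normr1 -ler_sqr ?nnegrE// !real_normK ?num_real// expr1n (le_trans h).
rewrite -[leRHS]real_normK ?num_real// -powR_mulrn//.
have [->|a0] := eqVneq `|a n| 0; first by rewrite !powR0// gt_eqF//; lra.
by apply: ger_powR => //; rewrite lt_neqAle eq_sym a0 normr_ge0.
Qed.

(** The L^2 part [U] enters the l^q bound through Bessel's inequality and the pairing with [f]
    through [|U| <= eta + U^2 / eta]. *)
Lemma riesz_step q : 2 < q -> exists2 c : R, 0 < c &
  forall S B B' e (Om : nat), C1 S -> lq_bounded q (cos_coef S) B ->
  lq_bounded q (sin_coef S) B -> B < B' -> 0 < e ->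
  exists w S',
  [/\ (0 < size w)%N /\ all (fun v => Om < v)%N w, C1 S',
      forall x, S' x != 0 -> S x != 0 /\ c <= freq_avg w x,
      lq_bounded q (cos_coef S') B' /\ lq_bounded q (sin_coef S') B' &
      forall f g F0 F1, continuous g -> (forall x, is_derive x (1 : R) f (g x)) ->
        (forall x, x \in `[0, pi *+ 2] -> `|f x| <= F0) ->
        (forall x, x \in `[0, pi *+ 2] -> `|g x| <= F1) ->
        `|circle_int (fun x => (S' x - S x) * f x)| <= e * (F0 + F1)].
Proof.
move=> q2; have [q0 q2'] : 0 < q /\ 2 <= q by split; lra.
have [c c0 core] := riesz_step_core q2.
exists c => // S B B' e Om CS cB sB BB' e0.
have [d d0 dP] := lq_bounded_perturb q0 BB'.
have p0 : 0 < pi :> R := pi_gt0 R.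
have p2 : 0 < pi *+ 2 :> R by rewrite mulrn_wgt0.
have p4 : 0 < pi *+ 4 :> R by rewrite mulrn_wgt0.
pose K : R := (1 + 1) `^ q + (1 + 1^-1) `^ q * (pi *+ 4).
have K0 : 0 < K.
  have h (x : R) : 0 < x -> 0 < (1 + x) `^ q by move=> x0; rewrite powR_gt0 ?addr_gt0.
  by rewrite /K addr_gt0 ?mulr_gt0 ?h ?invr_gt0.
(* [eta] integrates to [e / 4] over a period, and [t <= eta * (e / 4)] gives the same bound for the
   integral of [U^2 / eta]. *)
pose eta := e / 4 / (pi *+ 2).
have eta0 : 0 < eta by rewrite !divr_gt0.
pose t := Num.min (Num.min (d / K) (pi *+ 4)^-1) (Num.min (e / 2) (eta * (e / 4))).
have e4 : 0 < e / 4 by rewrite divr_gt0.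
have t0 : 0 < t.
  by rewrite /t !lt_min (divr_gt0 d0 K0) invr_gt0 p4 (mulr_gt0 eta0 e4) divr_gt0.
have [td [tp [te tn]]] : t <= d / K /\ t <= (pi *+ 4)^-1 /\ t <= e / 2 /\ t <= eta * (e / 4).
  by rewrite /t !ge_min !lexx ?orbT; do ?split.
have [w [H [U [[sw CS'] S'0 [[cH cU] [cosH sinH]] Hf UU]]]] := core S B t Om CS cB sB t0.
exists w, (fun x => S x + (H x - U x)); split => //.
- have cS := C1_continuous CS.
  have cU' : continuous (fun x => - U x) by move=> x; apply: cvgN; exact: cU.
  have UU' : pi *+ 4 * circle_int (fun x => (- U x) ^+ 2) <= pi *+ 4 * t.
    by rewrite ler_pM2l//; under eq_fun do rewrite sqrrN.
  have pt1 : pi *+ 4 * t <= 1 by rewrite mulrC -ler_pdivlMr ?div1r.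
  have tK : (1 + 1) `^ q * t + (1 + 1^-1) `^ q * (pi *+ 4 * t) <= d.
    by rewrite mulrA -mulrDl -/K mulrC -ler_pdivlMr.
  have cHU : continuous (fun x => H x + - U x) := continuous_add cH cU'.
  split.
    rewrite (_ : cos_coef _ = fun n => cos_coef S n +
      (cos_coef H n + cos_coef (fun x => - U x) n)); last first.
      by apply/funext => n; rewrite (cos_coefD _ cS cHU) (cos_coefD _ cH cU').
    apply: dP => //; apply: lq_bounded_le tK; apply: lq_boundedD => //.
    by apply: lq_bounded_sqr => // F uF; apply: le_trans (bessel_cos cU' uF) UU'.
  rewrite (_ : sin_coef _ = fun n => sin_coef S n +
    (sin_coef H n + sin_coef (fun x => - U x) n)); last first.
    by apply/funext => n; rewrite (sin_coefD _ cS cHU) (sin_coefD _ cH cU').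
  apply: dP => //; apply: lq_bounded_le tK; apply: lq_boundedD => //.
  by apply: lq_bounded_sqr => // F uF; apply: le_trans (bessel_sin cU' uF) UU'.
- move=> f g F0 F1 cg df fF gF.
  have z01 : (0 : R) \in `[0, pi *+ 2] by rewrite in_itv/= lexx ltW.
  have F00 : 0 <= F0 by apply: le_trans (fF 0 z01).
  have F10 : 0 <= F1 by apply: le_trans (gF 0 z01).
  have cf : continuous f by apply: C1_continuous; exists g.
  have cst (k : R) : continuous (fun _ : R => k) by move=> x; exact: cst_continuous.
  rewrite (_ : (fun x => _) = fun x => H x * f x + -1 * (U x * f x)); last first.
    by apply/funext => x; ring.
  have cUf := continuous_mul cU cf.
  rewrite circle_intD; [|exact: (continuous_mul cH cf)|exact: (continuous_mul (cst _) cUf)].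
  rewrite circle_intZ// mulN1r; apply: le_trans (ler_normB _ _) _.
  have H1 := Hf f g F0 F1 cg df fF gF.
  have H2 : `|circle_int (fun x => U x * f x)| <= F0 * (e / 2).
    apply: (@le_trans _ _ (circle_int (fun x => F0 * (eta + eta^-1 * U x ^+ 2)))).
      apply: circle_int_norm_le => //.
        apply: (continuous_mul (cst _)); apply: (continuous_add (cst _)).
        exact: (continuous_mul (cst _) (continuous_mul cU cU)).
      move=> x xI; rewrite normrM mulrC ler_pM// ?fF//.
      rewrite -(ler_pM2l eta0) mulrDr mulVKf ?gt_eqF//.
      rewrite -[U x ^+ 2]real_normK ?num_real//.
      by have := normr_ge0 (U x); move: `|U x| eta0 => u; clear; nra.
    rewrite circle_intZ; last first.
      apply: (continuous_add (cst _)).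
      exact: (continuous_mul (cst _) (continuous_mul cU cU)).
    rewrite ler_wpM2l// circle_intD//; last first.
      exact: (continuous_mul (cst _) (continuous_mul cU cU)).
    rewrite circle_int_cst circle_intZ; last exact: (continuous_mul cU cU).
    have -> : eta * (pi *+ 2) = e / 4 by rewrite /eta divfK ?gt_eqF.
    have : eta^-1 * circle_int (fun x => U x ^+ 2) <= e / 4.
      by rewrite mulrC ler_pdivrMr// mulrC; apply: le_trans UU tn.
    by move: (eta^-1 * _) => Y; clear; lra.
  apply: le_trans (lerD H1 H2) _.
  have : t * (F0 + F1) <= e / 2 * (F0 + F1) by rewrite ler_wpM2r// addr_ge0.
  have : 0 <= e / 2 * F1 by rewrite mulr_ge0// divr_ge0// ltW.
  by move: (t * _) => Y; clear; lra.
Qed.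

(** The errors [2^-1 ^+ j.+2] sum to [1 / 2], too little to destroy the mass of [S 0 = 1]. Choosing
    [Om = j] in the step sends the frequencies to infinity. *)
Lemma riesz_sequence q : 2 < q -> exists (c B : R) (S : nat -> R -> R) (w : nat -> seq nat),
  [/\ 0 < c, S 0%N = (fun=> 1) /\ (forall j, C1 (S j)),
     forall j, (0 < size (w j))%N /\ all (fun v => j < v)%N (w j),
     forall j x, S j.+1 x != 0 -> S j x != 0 /\ c <= freq_avg (w j) x &
     (forall j, lq_bounded q (cos_coef (S j)) B /\ lq_bounded q (sin_coef (S j)) B) /\
     forall j f g F0 F1, continuous g -> (forall x, is_derive x (1 : R) f (g x)) ->
        (forall x, x \in `[0, pi *+ 2] -> `|f x| <= F0) ->
        (forall x, x \in `[0, pi *+ 2] -> `|g x| <= F1) ->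
        `|circle_int (fun x => (S j.+1 x - S j x) * f x)| <= 2^-1 ^+ j.+2 * (F0 + F1)].
Proof.
move=> q2; have [c c0 step] := riesz_step q2.
have c1 : continuous (fun _ : R => 1 : R) by move=> x; exact: cst_continuous.
pose D : R := pi *+ 4 * circle_int (fun=> 1 ^+ 2).
have [B0 [cB0 sB0]] : exists B0, lq_bounded q (cos_coef (fun=> 1 : R)) B0 /\
    lq_bounded q (sin_coef (fun=> 1 : R)) B0.
  have D0 : 0 < D + 1.
    have i0 : 0 <= circle_int (fun=> 1 ^+ 2 : R).
      by rewrite circle_int_cst expr1n mul1r mulrn_wge0// pi_ge0.
    by rewrite ltr_wpDl// /D mulr_ge0// mulrn_wge0// pi_ge0.
  (* The sum of squares may exceed 1, so the sequence is scaled by [Num.sqrt (D + 1)] before squares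
     are compared with q-th powers. *)
  have sc (a : int -> R) : (forall F : seq int, uniq F -> \sum_(n <- F) a n ^+ 2 <= D) ->
      lq_bounded q a (Num.sqrt (D + 1) `^ q * 1).
    move=> aD; pose s := Num.sqrt (D + 1).
    have s0 : 0 < s by rewrite sqrtr_gt0.
    have -> : a = fun n => s * (s^-1 * a n) by apply/funext => n; rewrite mulVKf// gt_eqF.
    rewrite -[X in X `^ q](gtr0_norm s0); apply: lq_boundedZ.
    apply: lq_bounded_sqr; [by lra|by []|move=> F uF].
    under eq_bigr do rewrite exprMn; rewrite -mulr_sumr exprVn /s (sqr_sqrtr (ltW D0)).
    rewrite ler_pdivrMl// mulr1; apply: le_trans (aD F uF) _.
    by rewrite lerDl.
  exists (Num.sqrt (D + 1) `^ q * 1); split; apply: sc => F uF.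
    exact: bessel_cos.
  exact: bessel_sin.
pose B := B0 + 1.
pose valid (SB : (R -> R) * R) := [/\ C1 SB.1, lq_bounded q (cos_coef SB.1) SB.2,
  lq_bounded q (sin_coef SB.1) SB.2 & SB.2 < B].
pose state := {SB : (R -> R) * R | valid SB}.
pose next (p : nat * state) (p' : seq nat * state) :=
  let S := (sval p.2).1 in let S' := (sval p'.2).1 in let w := p'.1 in let j := p.1 in
  [/\ (0 < size w)%N /\ all (fun v => j < v)%N w,
     forall x, S' x != 0 -> S x != 0 /\ c <= freq_avg w x &
     forall f g F0 F1, continuous g -> (forall x, is_derive x (1 : R) f (g x)) ->
        (forall x, x \in `[0, pi *+ 2] -> `|f x| <= F0) ->
        (forall x, x \in `[0, pi *+ 2] -> `|g x| <= F1) ->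
        `|circle_int (fun x => (S' x - S x) * f x)| <= 2^-1 ^+ j.+2 * (F0 + F1)].
have nextP p : exists p', next p p'.
  case: p => j [[S B1] /= vS]; have [CS cS sS BB] := vS; rewrite /= in CS cS sS BB.
  (* Moving to the midpoint keeps every bound strictly below [B] and leaves room for the next
     step. *)
  have B12 : B1 < (B1 + B) / 2 by lra.
  have e0 : 0 < 2^-1 ^+ j.+2 :> R by rewrite exprn_gt0// invr_gt0.
  have [w [S' [wj CS' S'0 [cS' sS'] S'f]]] := step S B1 _ _ j CS cS sS B12 e0.
  have vS' : valid (S', (B1 + B) / 2) by split => //=; lra.
  by exists (w, exist _ _ vS').
have [nx nxP] := choice nextP.
have v0 : valid ((fun=> 1), B0) by split => //=; [exact: C1_cst|rewrite /B ltrDl].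
pose st := fix st j : state := if j is j'.+1 then (nx (j', st j')).2 else exist _ _ v0.
exists c, B, (fun j => (sval (st j)).1), (fun j => (nx (j, st j)).1); split => //.
- by split => // j; have [] := svalP (st j).
- by move=> j; have [] := nxP (j, st j).
- by move=> j; have [] := nxP (j, st j).
- split => j; last by have [] := nxP (j, st j).
  by have [_ h1 h2 /ltW h] := svalP (st j); split; [exact: lq_bounded_le h1 h|
    exact: lq_bounded_le h2 h].
Qed.

End Sequence.

(** * The circle *)

Section CircleTopology.
Variable R : realType.
Local Open Scope quotient_scope.

Lemma reduce_2pi (x : R) : exists (k : int) (y : R), y \in `[0, pi *+ 2] /\
  x = y + (pi *+ 2) *~ k.
Proof.
have p2 : 0 < pi *+ 2 :> R by rewrite mulrn_wgt0 ?pi_gt0.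
exists (Num.floor (x / (pi *+ 2))), (x - (pi *+ 2) *~ Num.floor (x / (pi *+ 2))).
split; last by rewrite subrK.
have /andP[h1 h2] := floor_itv (x / (pi *+ 2)).
rewrite -mulrzr in_itv/=; apply/andP; split.
  by rewrite subr_ge0 mulrC -ler_pdivlMr.
rewrite lerBlDr; move: h2; rewrite ltr_pdivrMr// rmorphD/= mulrDl mul1r => /ltW.
by rewrite addrC [X in _ + X]mulrC.
Qed.

Lemma circle_projD2pi (x : R) (k : int) : circle_proj (x + (pi *+ 2) *~ k) = circle_proj x.
Proof. by apply/eqmodP/asboolP; exists k. Qed.

Lemma circle_proj_repr (t : circle R) : circle_proj (repr t) = t.
Proof. exact: reprK. Qed.

Lemma continuous_circle_proj : continuous (@circle_proj R).
Proof. exact: pi_continuous. Qed.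

(** Functions written with [repr] get their continuity from the composition with the projection,
    since [repr] itself cannot be continuous. *)
Lemma continuous_on_circle (Z : topologicalType) (f : circle R -> Z) :
  continuous (fun x : R => f (circle_proj x)) -> continuous f.
Proof. by move=> cf; apply/quotient_continuous. Qed.

Lemma compact_circle : compact [set: circle R].
Proof.
rewrite (_ : [set: circle R] = @circle_proj R @` `[0, pi *+ 2]).
  apply: continuous_compact; last exact: segment_compact.
  exact/continuous_subspaceT/continuous_circle_proj.
apply/seteqP; split => // t _; have [k [y [yI ty]]] := reduce_2pi (repr t).
by exists y => //; rewrite -(circle_projD2pi y k) -ty circle_proj_repr.
Qed.

Lemma cos_repr_proj (n : int) (x : R) :
  cos (n%:~R * repr (circle_proj x)) = cos (n%:~R * x).
Proof. by have [] := characterE n x. Qed.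

Lemma sin_repr_proj (n : int) (x : R) :
  sin (n%:~R * repr (circle_proj x)) = sin (n%:~R * x).
Proof. by have [] := characterE n x. Qed.

Lemma continuous_cos_repr (n : int) :
  continuous (fun t : circle R => cos (n%:~R * repr t)).
Proof.
apply: continuous_on_circle; under eq_fun do rewrite cos_repr_proj.
exact: continuous_cosz.
Qed.

Lemma continuous_sin_repr (n : int) :
  continuous (fun t : circle R => sin (n%:~R * repr t)).
Proof.
apply: continuous_on_circle; under eq_fun do rewrite sin_repr_proj.
exact: continuous_sinz.
Qed.

Lemma freq_avg_repr_proj w (x : R) :
  freq_avg w (repr (circle_proj x)) = freq_avg w x.
Proof.
rewrite /freq_avg; congr (_ / _); apply: eq_bigr => v _.
exact: (cos_repr_proj v%:Z).
Qed.

Lemma continuous_freq_avg_repr w : continuous (fun t : circle R => freq_avg w (repr t)).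
Proof.
apply: continuous_on_circle; under eq_fun do rewrite freq_avg_repr_proj.
exact/C1_continuous/C1_freq_avg.
Qed.

Definition freq_avg_set (c : R) (w : nat -> seq nat) : set (circle R) :=
  [set t | forall j, c <= freq_avg (w j) (repr t)].

Lemma closed_freq_avg_set c w : closed (freq_avg_set c w).
Proof.
rewrite (_ : freq_avg_set c w =
  \bigcap_j ((fun t : circle R => freq_avg (w j) (repr t)) @^-1` [set x | c <= x])).
  apply: closed_bigI => j _; apply: closed_comp; last exact: closed_ge.
  by move=> x _; exact: continuous_freq_avg_repr.
by apply/seteqP; split => t /= H j; [move=> _; exact: H|exact: H].
Qed.

Lemma compact_freq_avg_set c w : compact (freq_avg_set c w).
Proof.
apply: (@subclosed_compact _ _ [set: circle R]) => //; last exact: compact_circle.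
exact: closed_freq_avg_set.
Qed.

End CircleTopology.

(** * The limit distribution *)

Section LimitFunctional.
Variable R : realType.
Implicit Types (f g u v : R -> R) (S : nat -> R -> R) (q B : R).

(** A Cauchy condition in the dual of C^1, with rates that sum to [1 / 2]. *)
Definition fast_cauchy S :=
  [/\ S 0%N = (fun=> 1), (forall j, C1 (S j)) &
     forall j f g F0 F1, continuous g -> (forall x, is_derive x (1 : R) f (g x)) ->
        (forall x, x \in `[0, pi *+ 2] -> `|f x| <= F0) ->
        (forall x, x \in `[0, pi *+ 2] -> `|g x| <= F1) ->
        `|circle_int (fun x => (S j.+1 x - S j x) * f x)| <= 2^-1 ^+ j.+2 * (F0 + F1)].

Definition lim_int S u : R := limn (fun j => circle_int (fun x => S j x * u x)).

Lemma fast_cauchy_dist S f g F0 F1 (m n : nat) : fast_cauchy S -> continuous g ->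
  (forall x, is_derive x (1 : R) f (g x)) ->
  (forall x, x \in `[0, pi *+ 2] -> `|f x| <= F0) ->
  (forall x, x \in `[0, pi *+ 2] -> `|g x| <= F1) -> (m <= n)%N ->
  `|circle_int (fun x => S n x * f x) - circle_int (fun x => S m x * f x)| <=
  2^-1 ^+ m.+1 * (F0 + F1).
Proof.
move=> [_ CS Sc] cg df fF gF mn.
have cf : continuous f by apply: C1_continuous; exists g.
have p2 : 0 < pi *+ 2 :> R by rewrite mulrn_wgt0 ?pi_gt0.
have z01 : (0 : R) \in `[0, pi *+ 2] by rewrite in_itv/= lexx ltW.
have F00 : 0 <= F0 by apply: le_trans (fF 0 z01).
have F10 : 0 <= F1 by apply: le_trans (gF 0 z01).
(* The exact partial geometric sum is what the induction on [n] reproduces. *)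
apply: (@le_trans _ _ ((2^-1 ^+ m.+1 - 2^-1 ^+ n.+1) * (F0 + F1))); last first.
  by rewrite ler_wpM2r ?addr_ge0// gerBl exprn_ge0.
elim: n mn => [|n IH].
  by rewrite leqn0 => /eqP ->; rewrite !subrr normr0 mul0r.
rewrite leq_eqVlt => /predU1P[->|]; first by rewrite !subrr normr0 mul0r.
rewrite ltnS => mn.
set In := circle_int (fun x => S n x * f x).
set Im := circle_int (fun x => S m x * f x).
have cSf j : continuous (fun x => S j x * f x).
  exact: (continuous_mul (C1_continuous (CS j)) cf).
have -> : circle_int (fun x => S n.+1 x * f x) - Im =
    circle_int (fun x => (S n.+1 x - S n x) * f x) + (In - Im).
  rewrite addrA; congr (_ - _); rewrite /In -circle_intD//; last first.
    apply: continuous_mul => //; apply: continuous_add; first exact/C1_continuous/CS.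
    by move=> x; apply: cvgN; exact: (C1_continuous (CS n)).
  by congr circle_int; apply/funext => x; ring.
apply: le_trans (ler_normD _ _) _.
apply: le_trans (lerD (Sc n f g F0 F1 cg df fF gF) (IH mn)) _.
rewrite -mulrDl ler_wpM2r ?addr_ge0//.
have -> : 2^-1 ^+ n.+1 = 2 * 2^-1 ^+ n.+2 :> R by rewrite [in RHS]exprS; field.
lra.
Qed.

Lemma C1_bounds u : C1 u -> exists g F0 F1, [/\ continuous g,
  forall x, is_derive x (1 : R) u (g x),
  forall x, x \in `[0, pi *+ 2] -> `|u x| <= F0 &
  forall x, x \in `[0, pi *+ 2] -> `|g x| <= F1].
Proof.
move=> Cu; have cu := C1_continuous Cu; have [g cg du] := Cu.
have [F0 _ uF] := continuous_bounded_on cu.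
have [F1 _ gF] := continuous_bounded_on cg.
by exists g, F0, F1.
Qed.

Lemma half_expn_cvg0 (F : R) : 2^-1 ^+ n.+1 * F @[n --> \oo] --> 0.
Proof.
rewrite -(mul0r F); apply: cvgMl; rewrite (cvg_shiftS (fun n => 2^-1 ^+ n : R)).
by apply: cvg_expr; rewrite gtr0_norm ?invr_gt0//; lra.
Qed.

Lemma is_cvg_lim_int S u : fast_cauchy S -> C1 u ->
  cvgn (fun j => circle_int (fun x => S j x * u x)).
Proof.
move=> fS Cu; have [g [F0 [F1 [cg du uF gF]]]] := C1_bounds Cu.
apply/cauchy_cvgP/cauchy_exP => e e0.
have /cvgrPdist_lt /(_ e e0) [N _ HN] := half_expn_cvg0 (F0 + F1).
exists (circle_int (fun x => S N x * u x)); exists N => // n /= Nn.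
rewrite /ball/= distrC.
apply: le_lt_trans (fast_cauchy_dist fS cg du uF gF Nn) _.
have := HN N (leqnn N); rewrite sub0r normrN.
by apply: le_lt_trans; exact: ler_norm.
Qed.

Lemma lim_int_dist S f g F0 F1 (m : nat) : fast_cauchy S -> continuous g ->
  (forall x, is_derive x (1 : R) f (g x)) ->
  (forall x, x \in `[0, pi *+ 2] -> `|f x| <= F0) ->
  (forall x, x \in `[0, pi *+ 2] -> `|g x| <= F1) ->
  `|lim_int S f - circle_int (fun x => S m x * f x)| <= 2^-1 ^+ m.+1 * (F0 + F1).
Proof.
move=> fS cg df fF gF.
have cvI : cvgn (fun j => circle_int (fun x => S j x * f x)).
  by apply: is_cvg_lim_int => //; exists g.
have cvN : `|circle_int (fun x => S j x * f x) - circle_int (fun x => S m x * f x)|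
    @[j --> \oo] --> `|lim_int S f - circle_int (fun x => S m x * f x)|.
  by apply: cvg_norm; apply: cvgB => //; exact: cvg_cst.
rewrite -(cvg_lim _ cvN)//; apply: limr_le; first exact: cvgP cvN.
by exists m => // n /= mn; exact: fast_cauchy_dist fS cg df fF gF mn.
Qed.

Lemma lim_intD S (c : R) u v : fast_cauchy S -> C1 u -> C1 v ->
  lim_int S (fun x => c * u x + v x) = c * lim_int S u + lim_int S v.
Proof.
move=> fS Cu Cv; have [_ CS _] := fS; apply/cvg_lim => //.
have cu := is_cvg_lim_int fS Cu; have cv := is_cvg_lim_int fS Cv.
rewrite (_ : (fun j => _) = (fun j => c * circle_int (fun x => S j x * u x) +
    circle_int (fun x => S j x * v x))).
  exact: (cvgD (cvgMr cu) cv).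
apply/funext => j; have cS := C1_continuous (CS j).
have cSu := continuous_mul cS (C1_continuous Cu).
have cSv := continuous_mul cS (C1_continuous Cv).
rewrite -circle_intZ// -circle_intD//.
  by congr circle_int; apply/funext => x; ring.
by apply: continuous_mul => // x; exact: cst_continuous.
Qed.

(** Continuity of the power comes from its derivative at positive points; the limit 0 is treated
    directly. *)
Lemma cvg_norm_powR q (a : nat -> R) (b : R) : 0 < q -> a j @[j --> \oo] --> b ->
  `|a j| `^ q @[j --> \oo] --> `|b| `^ q.
Proof.
move=> q0 /cvg_norm; have [->|b0] := eqVneq b 0; last first.
  move=> ab; have nb0 : 0 < `|b| by rewrite normr_gt0.
  apply: (@continuous_cvg _ _ _ _ _ (fun j => `|a j|) (fun x => x `^ q)) ab.
  apply: differentiable_continuous; apply/derivable1_diffP.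
  by have [] := is_derive1_powR q nb0.
rewrite normr0 powR0 ?gt_eqF// => /cvgrPdist_le a0; apply/cvgrPdist_le => e e0.
have eq0 : 0 < e `^ q^-1 by rewrite powR_gt0.
have [N _ HN] := a0 _ eq0; exists N => // n Nn.
have := HN n Nn; rewrite /= !sub0r !normrN normr_id => h.
rewrite ger0_norm ?powR_ge0//.
have -> : e = (e `^ q^-1) `^ q by rewrite -powRrM mulVf ?gt_eqF// powRr1// ltW.
by apply: ge0_ler_powR; rewrite ?nnegrE ?(ltW q0) ?(ltW eq0).
Qed.

(** [lq_bounded] speaks of finite sums only, so pointwise convergence suffices. *)
Lemma lq_bounded_lim q B (a : nat -> int -> R) (b : int -> R) : 0 < q ->
  (forall j, lq_bounded q (a j) B) -> (forall n, a j n @[j --> \oo] --> b n) ->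
  lq_bounded q b B.
Proof.
move=> q0 aB ab F uF.
have H : \sum_(n <- F) `|a j n| `^ q @[j --> \oo] --> \sum_(n <- F) `|b n| `^ q.
  elim: F {uF} => [|n F IH].
    by under eq_fun do rewrite big_nil; rewrite big_nil; exact: cvg_cst.
  under eq_fun do rewrite big_cons; rewrite big_cons; apply: cvgD => //.
  exact: cvg_norm_powR.
rewrite -(cvg_lim _ H)//; apply: limr_le; first exact: cvgP H.
by apply: nearW => j; exact: aB.
Qed.

End LimitFunctional.

(** * The limit as a Schwartz distribution *)

Section LimitDistribution.
Local Open Scope complex_scope.
Variable R : realType.
Implicit Types (f : circle R -> R[i]) (u : R -> R) (S : nat -> R -> R) (q B : R).

Lemma normr_Re_le_normc (a b : R) : `|a| <= normc (a +i* b).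
Proof. by rewrite -sqrtr_sqr /normc ler_wsqrtr// lerDl sqr_ge0. Qed.

Lemma normr_Im_le_normc (a b : R) : `|b| <= normc (a +i* b).
Proof. by rewrite -sqrtr_sqr /normc ler_wsqrtr// lerDr sqr_ge0. Qed.

Lemma normc_le_normrD (a b : R) : normc (a +i* b) <= `|a| + `|b|.
Proof.
rewrite /normc -[leRHS]ger0_norm ?addr_ge0// -[leRHS]sqrtr_sqr ler_wsqrtr//.
rewrite sqrrD !real_normK ?num_real// -addrA lerD2l lerDr.
by rewrite mulrn_wge0// mulr_ge0.
Qed.

Lemma smooth_derive f (k : nat) : smooth f ->
  ((forall x, is_derive x (1 : R) (derive1n k (lift_Re f)) (derive1n k.+1 (lift_Re f) x)) /\
   (forall x, is_derive x (1 : R) (derive1n k (lift_Im f)) (derive1n k.+1 (lift_Im f) x))) /\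
  (continuous (derive1n k (lift_Re f)) /\ continuous (derive1n k (lift_Im f))).
Proof.
move=> sf; split; split => x; have [d1 d2] := sf k x.
- by apply: DeriveDef; [exact: d1|rewrite derive1nS derive1E].
- by apply: DeriveDef; [exact: d2|rewrite derive1nS derive1E].
- by apply: differentiable_continuous; apply/derivable1_diffP.
- by apply: differentiable_continuous; apply/derivable1_diffP.
Qed.

Lemma smooth_C1 f : smooth f -> C1 (lift_Re f) /\ C1 (lift_Im f).
Proof.
move=> sf; have [[d1 d2] _] := smooth_derive 0 sf.
have [_ [c1 c2]] := smooth_derive 1 sf.
by split; [exists (derive1n 1 (lift_Re f))|exists (derive1n 1 (lift_Im f))].
Qed.

Lemma derive1n_periodic u (k : nat) : periodic u (pi *+ 2) ->
  periodic (derive1n k u) (pi *+ 2).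
Proof.
move=> pu; elim: k => [//|k IH] x.
rewrite derive1nS /derive1.
rewrite (_ : (fun h => _ *: (_ (h + (x + _)) - _)) =
  (fun h => h^-1 *: (derive1n k u (h + x) - derive1n k u x)))//.
by apply/funext => h; rewrite addrA !IH.
Qed.

Lemma deriv_circle_periodic f (k : nat) (x : R) (n : int) :
  deriv_circle k f (x + (pi *+ 2) *~ n) = deriv_circle k f x.
Proof.
have pR : periodic (lift_Re f) (pi *+ 2).
  by move=> y; rewrite /lift_Re -[pi *+ 2]mulr1z circle_projD2pi.
have pI : periodic (lift_Im f) (pi *+ 2).
  by move=> y; rewrite /lift_Im -[pi *+ 2]mulr1z circle_projD2pi.
have per (u : R -> R) : periodic u (pi *+ 2) -> u (x + (pi *+ 2) *~ n) = u x.
  move=> pu; case: n => n; first exact: periodicn.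
  by rewrite NegzE mulrNz -(periodicn pu n.+1) subrK.
by rewrite /deriv_circle !per//; exact: derive1n_periodic.
Qed.

(** The supremum in [deriv_norm] runs over the whole line; periodicity reduces it to a compact
    period, where continuity makes it finite. *)
Lemma deriv_norm_ub f (k : nat) (x : R) : smooth f ->
  normc (deriv_circle k f x) <= deriv_norm k f.
Proof.
move=> sf; apply: ub_le_sup; last by exists x.
have [_ [c1 c2]] := smooth_derive k sf.
have [M1 _ h1] := continuous_bounded_on c1; have [M2 _ h2] := continuous_bounded_on c2.
exists (M1 + M2) => _ [y _ <-]; have [n [z [zI ->]]] := reduce_2pi y.
rewrite deriv_circle_periodic.
by apply: le_trans (normc_le_normrD _ _) _; rewrite lerD ?h1 ?h2.
Qed.

Definition limit_fun S f : R[i] := lim_int S (lift_Re f) +i* lim_int S (lift_Im f).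

Lemma limit_fun_linear S (a : R[i]) f g : fast_cauchy S -> smooth f -> smooth g ->
  limit_fun S (fun t => a * f t + g t) = a * limit_fun S f + limit_fun S g.
Proof.
move=> fS sf sg; have [Rf If] := smooth_C1 sf; have [Rg Ig] := smooth_C1 sg.
case: a => a b; rewrite /limit_fun.
have cst0 : C1 (fun _ : R => 0 : R) by exact: C1_cst.
have -> : lift_Re (fun t => (a +i* b) * f t + g t) =
    (fun x => a * lift_Re f x + (- b * lift_Im f x + lift_Re g x)).
  apply/funext => x; rewrite /lift_Re /lift_Im.
  by case: (f _) => ? ?; case: (g _) => ? ? /=; ring.
have -> : lift_Im (fun t => (a +i* b) * f t + g t) =
    (fun x => a * lift_Im f x + (b * lift_Re f x + lift_Im g x)).
  apply/funext => x; rewrite /lift_Re /lift_Im.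
  by case: (f _) => ? ?; case: (g _) => ? ? /=; ring.
have CD (c : R) u v : C1 u -> C1 v -> C1 (fun x => c * u x + v x).
  by move=> Cu Cv; apply: C1D => //; apply: C1M => //; exact: C1_cst.
rewrite !lim_intD//; try exact: CD.
by simpc; congr (_ +i* _); ring.
Qed.

(** At stage 0 the function is constantly 1 and the pairing is at most [2 pi F0]; the limit differs
    from it by at most [(F0 + F1) / 2]. *)
Lemma lim_int_bound S u g F0 F1 : fast_cauchy S -> continuous g ->
  (forall x, is_derive x (1 : R) u (g x)) ->
  (forall x, x \in `[0, pi *+ 2] -> `|u x| <= F0) ->
  (forall x, x \in `[0, pi *+ 2] -> `|g x| <= F1) ->
  `|lim_int S u| <= (pi *+ 2 + 1) * (F0 + F1).
Proof.
move=> fS cg du uF gF; have cu : continuous u by apply: C1_continuous; exists g.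
have p2 : 0 < pi *+ 2 :> R by rewrite mulrn_wgt0 ?pi_gt0.
have z01 : (0 : R) \in `[0, pi *+ 2] by rewrite in_itv/= lexx ltW.
have F00 : 0 <= F0 by apply: le_trans (uF 0 z01).
have F10 : 0 <= F1 by apply: le_trans (gF 0 z01).
have [S0 _ _] := fS.
have := lim_int_dist 0 fS cg du uF gF; rewrite S0 expr1.
under eq_fun do rewrite mul1r.
have : `|circle_int u| <= F0 * (pi *+ 2).
  rewrite -circle_int_cst; apply: circle_int_norm_le => // x.
  exact: cst_continuous.
move: (lim_int S u) (circle_int u) => L I hI hL.
have -> : L = (L - I) + I by rewrite subrK.
apply: le_trans (ler_normD _ _) _; apply: le_trans (lerD hL hI) _.
have : 0 <= F1 * (pi *+ 2) by rewrite mulr_ge0// ltW.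
have -> : (pi *+ 2 + 1) * (F0 + F1) = F0 * (pi *+ 2) + F1 * (pi *+ 2) + F0 + F1 by ring.
by move: (F0 * _) (F1 * _) F00 F10 => X Y; clear; lra.
Qed.

Lemma limit_fun_continuous S : fast_cauchy S ->
  exists (N : nat) (C : R), forall f, smooth f ->
    normc (limit_fun S f) <= C * \sum_(k < N.+1) deriv_norm k f.
Proof.
(* The order is one; the factor 2 accounts for real and imaginary parts. *)
move=> fS; exists 1%N, ((pi *+ 2 + 1) * 2) => f sf.
rewrite big_ord_recr big_ord1/=.
have [[d1 d2] _] := smooth_derive 0 sf; have [_ [c1 c2]] := smooth_derive 1 sf.
apply: le_trans (normc_le_normrD _ _) _.
have dn k := fun x => @deriv_norm_ub f k x sf.
have h1 : `|lim_int S (lift_Re f)| <= (pi *+ 2 + 1) * (deriv_norm 0 f + deriv_norm 1 f).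
  apply: lim_int_bound d1 _ _ => // x _.
    exact: le_trans (normr_Re_le_normc _ _) (dn 0%N x).
  exact: le_trans (normr_Re_le_normc _ _) (dn 1%N x).
have h2 : `|lim_int S (lift_Im f)| <= (pi *+ 2 + 1) * (deriv_norm 0 f + deriv_norm 1 f).
  apply: lim_int_bound d2 _ _ => // x _.
    exact: le_trans (normr_Im_le_normc _ _) (dn 0%N x).
  exact: le_trans (normr_Im_le_normc _ _) (dn 1%N x).
apply: le_trans (lerD h1 h2) _.
by move: (deriv_norm 0 f) (deriv_norm 1 f) => X Y;
  rewrite le_eqVlt; apply/orP; left; apply/eqP; ring.
Qed.

Definition limit_distribution S (fS : fast_cauchy S) : schwartz_distribution R :=
  SchwartzDistribution (fun a f g sf sg => limit_fun_linear a fS sf sg)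
    (limit_fun_continuous fS).

Lemma derive1n_cst (k : nat) (c x : R) : derivable (derive1n k (fun=> c)) x 1.
Proof.
have -> : derive1n k (fun=> c) = fun=> (if k is 0%N then c else 0).
  elim: k => [//|k IH]; rewrite derive1nS IH; apply/funext => y.
  exact: derive1_cst.
exact: derivable_cst.
Qed.

(** Against the constant 1, stage 0 gives [2 pi >= 4], and all later stages together change this by
    at most [1 / 2]. *)
Lemma limit_distribution_nonzero S (fS : fast_cauchy S) :
  dist_nonzero (limit_distribution fS).
Proof.
exists (fun=> 1) => [k x|]; first by split; exact: derive1n_cst.
apply/eqP => /(congr1 (@complex.Re R)) /= L0.
have [S0 _ _] := fS.
have c0 : continuous (fun _ : R => 0 : R) by move=> x; exact: cst_continuous.
have d0 (x : R) : is_derive x (1 : R) (fun=> 1 : R) ((fun=> 0) x).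
  exact: is_derive_cst.
have h1 (x : R) : x \in `[0, pi *+ 2] -> `|1 : R| <= 1 by rewrite normr1.
have h0 (x : R) : x \in `[0, pi *+ 2] -> `|0 : R| <= 0 by rewrite normr0.
have := lim_int_dist 0 fS c0 d0 h1 h0.
rewrite (_ : lim_int S (fun=> 1) = 0); last exact: L0.
rewrite S0 addr0 mulr1 expr1 sub0r normrN circle_int_cst mul1r.
rewrite (ger0_norm (mulrn_wge0 2 (pi_ge0 R))).
by rewrite [pi *+ 2]mulr2n; have := pi_ge2 R; lra.
Qed.

(** A point outside the set violates the condition of some index [j] on a whole neighbourhood. Every
    [S n] with [n > j] vanishes there, so the pairings with a function supported in it are
    eventually 0. *)
Lemma limit_distribution_support S (fS : fast_cauchy S) (c : R) (w : nat -> seq nat) :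
  (forall j x, S j.+1 x != 0 -> S j x != 0 /\ c <= freq_avg (w j) x) ->
  dist_support (limit_distribution fS) `<=` freq_avg_set c w.
Proof.
move=> Sw t tS j; rewrite leNgt; apply/negP => tj.
pose U := [set s : circle R | freq_avg (w j) (repr s) < c].
have oU : open U.
  apply: (@open_comp _ _ (fun s : circle R => freq_avg (w j) (repr s)) [set y | y < c]).
    by move=> s _; exact: continuous_freq_avg_repr.
  exact: open_lt.
have [f [sf fU]] := tS U oU tj.
suff int0 : forall u, (forall x, f (circle_proj x) = 0 -> u x = 0) -> lim_int S u = 0.
  by move=> /eqP; apply; rewrite /= /limit_fun !int0// => x;
    rewrite /lift_Re /lift_Im => ->.
move=> u uf; apply/cvg_lim => //.
have Sj n x : (j < n)%N -> S n x != 0 -> c <= freq_avg (w j) x.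
  elim: n => // n IH; rewrite ltnS leq_eqVlt => /predU1P[->|jn] /Sw[Sn //].
  by move=> _; exact: IH.
rewrite -(cvg_shiftn j.+1) (_ : (fun n => _) = fun=> 0); first exact: cvg_cst.
apply/funext => n /=; rewrite (_ : (fun x => _) = fun=> 0).
  by rewrite circle_int_cst mul0r.
apply/funext => x; have [->|Sn] := eqVneq (S (n + j.+1)%N x) 0; first by rewrite mul0r.
rewrite uf ?mulr0//; apply/eqP; apply: contraT => fx.
have : U (circle_proj x) by apply: fU; exact: subset_closure.
rewrite /U/= freq_avg_repr_proj ltNge (Sj _ _ _ Sn)//.
by rewrite addnS ltnS leq_addl.
Qed.

Lemma limit_distribution_fourier S (fS : fast_cauchy S) (n : int) :
  dist_fourier (limit_distribution fS) n =
  limn (fun j => cos_coef (S j) n) +i* - limn (fun j => sin_coef (S j) n).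
Proof.
rewrite /dist_fourier/= /limit_fun.
have -> : lift_Re (character (R := R) (- n)) = fun x => cos (n%:~R * x).
  by apply/funext => x; rewrite /lift_Re characterE/= rmorphN/= mulNr cosN.
have -> : lift_Im (character (R := R) (- n)) = fun x => -1 * sin (n%:~R * x) + 0.
  by apply/funext => x; rewrite addr0 mulN1r /lift_Im characterE/= rmorphN/= mulNr sinN.
rewrite lim_intD//; [|exact: C1_sinz|exact: C1_cst].
congr (_ +i* _); rewrite mulN1r (_ : lim_int S (fun=> 0) = 0) ?addr0//.
apply/cvg_lim => //; rewrite (_ : (fun j => _) = fun=> 0); first exact: cvg_cst.
apply/funext => j; rewrite (_ : (fun x => _) = fun=> 0).
  by rewrite circle_int_cst mul0r.
by apply/funext => x; rewrite mulr0.
Qed.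

Lemma limit_distribution_lq S (fS : fast_cauchy S) q B : 0 < q ->
  (forall j, lq_bounded q (cos_coef (S j)) B /\ lq_bounded q (sin_coef (S j)) B) ->
  exists a b : int -> R, [/\ lq_bounded q a B, lq_bounded q b B &
    forall n, dist_fourier (limit_distribution fS) n = a n +i* b n].
Proof.
move=> q0 SB; exists (fun n => limn (fun j => cos_coef (S j) n)).
exists (fun n => - limn (fun j => sin_coef (S j) n)); split.
- apply: (lq_bounded_lim (a := fun j => cos_coef (S j))) => // [j|n].
    by have [] := SB j.
  exact: (is_cvg_lim_int fS (C1_cosz _)).
- apply: (lq_bounded_norm (a := fun n => limn (fun j => sin_coef (S j) n))).
  + exact: ltW.
  + by move=> n; rewrite normrN.
  apply: (lq_bounded_lim (a := fun j => sin_coef (S j))) => // [j|n].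
    by have [] := SB j.
  exact: (is_cvg_lim_int fS (C1_sinz _)).
- by move=> n; exact: limit_distribution_fourier.
Qed.

End LimitDistribution.

(** * The logarithmic weight *)

Section LogSummable.
Variable R : realType.
Local Open Scope complex_scope.
Implicit Types (q alpha B e : R) (c : int -> R[i]).

Lemma normc_nneg (z : R[i]) : 0 <= normc z.
Proof. by case: z => a b; exact: sqrtr_ge0. Qed.

Lemma ln_powR_le (delta x : R) : 0 < delta -> 0 < x -> ln x <= x `^ delta / delta.
Proof.
move=> d0 x0; rewrite ler_pdivlMr// mulrC -ln_powR.
have h : 0 < x `^ delta by rewrite powR_gt0.
have := expR_ge1Dx (ln (x `^ delta)); rewrite lnK ?posrE//.
by lra.
Qed.

(** For [delta = (q - q') / alpha], raising [ln X <= X^delta / delta] to the power [alpha] costs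
    [X^(q - q')]. The spare power [x^(q - q')] absorbs it, because [x X = expR 1 * x + 1] is
    bounded. *)
Lemma log_weight_le q q' alpha (b : R) : 0 < q' < q -> 0 < alpha -> 0 < b ->
  exists2 M, 0 <= M & forall x, 0 < x <= b ->
    x `^ q * ln (expR 1 + x^-1) `^ alpha <= M * x `^ q'.
Proof.
move=> /andP[q'0 qq] al0 b0; pose delta := (q - q') / alpha.
have qq0 : 0 < q - q' by rewrite subr_gt0.
have d0 : 0 < delta by rewrite divr_gt0.
pose M := (expR 1 * b + 1) `^ (q - q') * delta^-1 `^ alpha.
exists M => [|x /andP[x0 xb]]; first by rewrite mulr_ge0 ?powR_ge0.
pose X := expR 1 + x^-1.
have X0 : 0 < X by rewrite addr_gt0 ?expR_gt0 ?invr_gt0.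
have X1 : 1 <= X.
  have : 0 < x^-1 by rewrite invr_gt0.
  by have := expR_ge1Dx (1 : R); rewrite /X; lra.
have lX : ln X `^ alpha <= X `^ (q - q') * delta^-1 `^ alpha.
  have -> : X `^ (q - q') * delta^-1 `^ alpha = (X `^ delta / delta) `^ alpha.
    by rewrite powRM ?powR_ge0 ?invr_ge0 ?(ltW d0)// -powRrM /delta divfK ?gt_eqF.
  apply: ge0_ler_powR; rewrite ?nnegrE ?(ltW al0) ?ln_ge0 ?ln_powR_le//.
  by rewrite divr_ge0 ?powR_ge0 ?(ltW d0).
apply: le_trans (ler_wpM2l (powR_ge0 _ _) lX) _.
have -> : x `^ q = x `^ q' * x `^ (q - q').
  rewrite -powRD; last by rewrite (gt_eqF x0) implybT.
  by congr (_ `^ _); ring.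
have -> : x `^ q' * x `^ (q - q') * (X `^ (q - q') * delta^-1 `^ alpha) =
  (x * X) `^ (q - q') * delta^-1 `^ alpha * x `^ q'.
  by rewrite powRM ?(ltW x0) ?(ltW X0)//; ring.
rewrite ler_wpM2r ?powR_ge0// /M ler_wpM2r ?powR_ge0//.
have -> : x * X = expR 1 * x + 1 by rewrite /X mulrDr mulfV ?gt_eqF// mulrC.
apply: ge0_ler_powR; rewrite ?nnegrE ?(ltW qq0) ?addr_ge0 ?mulr_ge0 ?expR_ge0 ?(ltW x0) ?(ltW b0)//.
by rewrite lerD2r ler_wpM2l ?expR_ge0.
Qed.

Lemma lq_bounded_log_summable q q' alpha B (a b : int -> R) c : 0 < q' < q -> 0 < alpha ->
  lq_bounded q' a B -> lq_bounded q' b B -> (forall n, c n = a n +i* b n) ->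
  log_summable q alpha c.
Proof.
move=> qq al0 aB bB cE; have /andP[q'0 _] := qq.
have [B' cB] : exists B', lq_bounded q' (fun n => normc (c n)) B'.
  have nB (u : int -> R) : lq_bounded q' u B -> lq_bounded q' (fun n => `|u n|) B.
    by apply: lq_bounded_norm => [|n]; [exact: ltW|rewrite normr_id].
  have H := lq_boundedD q'0 ltr01 (nB _ aB) (nB _ bB).
  eexists; apply: lq_bounded_norm H => [|n]; first exact: ltW.
  rewrite (ger0_norm (normc_nneg _)) (ger0_norm (addr_ge0 (normr_ge0 _) (normr_ge0 _))) cE.
  exact: normc_le_normrD.
have B'0 := lq_bounded_ge0 cB.
(* The weight is controlled on bounded intervals only, so all coefficients are bounded first. *)
pose bd := (B' + 1) `^ q'^-1.
have bd0 : 0 < bd by rewrite powR_gt0// ltr_wpDl.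
have nc n : normc (c n) <= bd.
  have -> : normc (c n) = (`|normc (c n)| `^ q') `^ q'^-1.
    by rewrite -powRrM mulfV ?gt_eqF// powRr1// ger0_norm ?normc_nneg.
  apply: ge0_ler_powR; rewrite ?nnegrE ?invr_ge0 ?(ltW q'0) ?powR_ge0 ?addr_ge0//.
  have := cB [:: n] isT; rewrite big_seq1 => /le_trans; apply.
  by rewrite lerDl.
have [M M0 HM] := log_weight_le qq al0 bd0.
rewrite /log_summable; apply: (@le_lt_trans _ _ (M * B')%:E); last exact: ltry.
apply: ge_ereal_sup => _ [A [finA AS] <-].
rewrite fsbig_finite//= sumEFin lee_fin.
set F := finmap.enum_fset _.
have uF : uniq F by exact: finmap.fset_uniq.
apply: (@le_trans _ _ (\sum_(n <- F) M * `|normc (c n)| `^ q')).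
  rewrite big_seq [leRHS]big_seq; apply: ler_sum => n nF.
  have : n \in A by rewrite -(in_fset_set finA); exact: nF.
  rewrite inE => /AS /= cn.
  rewrite (ger0_norm (normc_nneg _)); apply: HM; rewrite nc andbT lt_neqAle normc_nneg andbT.
  by rewrite eq_sym; apply: contraNN cn => /eqP /eq0_normc ->.
by rewrite -mulr_sumr ler_wpM2l// cB.
Qed.

(** The logarithm is at least [ln (expR 1) = 1], so [k] coefficients of modulus at least [e]
    contribute at least [k e^q]. *)
Lemma log_summable_cvg0 q alpha c e : 0 < q -> 0 < alpha -> log_summable q alpha c -> 0 < e ->
  exists N : nat, forall n : int, (N <= `|n|)%N -> normc (c n) < e.
Proof.
move=> q0 al0 cS e0; apply: contrapT => /forallNP H.
have big N : exists n : int, (N <= `|n|)%N /\ e <= normc (c n).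
  have /existsNP[n /not_implyP[Nn /negP]] := H N.
  by rewrite -leNgt => en; exists n.
have lists k : exists F : seq int, [/\ uniq F, size F = k & forall n, n \in F -> e <= normc (c n)].
  elim: k => [|k [F [uF sF Fe]]]; first by exists [::].
  have [n [Nn ne]] := big (\max_(m <- F) `|m|%N).+1.
  exists (n :: F); split => /=; [|by rewrite sF|]; last first.
    by move=> m; rewrite inE => /predU1P[->//|]; exact: Fe.
  rewrite uF andbT; apply: contraL Nn => nF; rewrite -ltnNge ltnS.
  exact: (@leq_bigmax_seq _ F xpredT (fun n : int => `|n|%N)).
have eq0 : 0 < e `^ q by rewrite powR_gt0.
move: cS; rewrite /log_summable; set s := esum _ _ => sfin.
have s0 : (0 <= s)%E.
  by apply: esum_ge0 => n _; rewrite lee_fin mulr_ge0 ?powR_ge0.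
have sE : s = (fine s)%:E by rewrite fineK// ge0_fin_numE.
pose k := (Num.truncn (fine s / e `^ q)).+1.
have [F [uF sF Fe]] := lists k.
have : (\sum_(n <- F) (normc (c n) `^ q * ln (expR 1 + (normc (c n))^-1) `^ alpha)%:E <= s)%E.
  apply: ereal_sup_ubound; exists [set` F]; last by rewrite -fsbig_seq.
  split; first exact: finite_seq.
  move=> n /= /Fe; apply: contraTN => /eqP ->; rewrite -ltNge.
  by rewrite /normc/= expr0n/= addr0 sqrtr0.
rewrite sumEFin sE lee_fin => Hs.
have : e `^ q *+ k <= fine s.
  apply: le_trans Hs; rewrite -sF -(count_predT F) -iter_addr_0 -big_const_seq.
  rewrite big_seq [leRHS]big_seq; apply: ler_sum => n nF; have en := Fe n nF.
  have n0 : 0 < normc (c n) by apply: lt_le_trans en.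
  rewrite -[leLHS]mulr1; apply: ler_pM; rewrite ?powR_ge0//.
    by apply: ge0_ler_powR; rewrite ?nnegrE ?(ltW q0) ?(ltW e0) ?(ltW n0).
  apply: (@le_trans _ _ (1 `^ alpha)); first by rewrite powR1.
  apply: ge0_ler_powR; rewrite ?nnegrE ?(ltW al0)//.
    have nV : 0 < (normc (c n))^-1 by rewrite invr_gt0.
    by apply: ln_ge0; have := expR_ge1Dx (1 : R); lra.
  rewrite -[leLHS](expRK 1) ler_ln ?posrE ?expR_gt0 ?addr_gt0 ?expR_gt0 ?invr_gt0//.
  by rewrite lerDl invr_ge0 ltW.
rewrite -mulr_natr mulrC -ler_pdivlMr// leNgt.
by rewrite truncnS_gt.
Qed.

End LogSummable.

(** * Trigonometric polynomials determine measures *)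

Section TrigPolynomials.
Variable R : realType.
Implicit Types (f g : circle R -> R) (x y u v : R).

(** Without a constructor for products, linear statements follow by induction; closure under
    products comes from the product-to-sum formulas. *)
Inductive trig_poly : (circle R -> R) -> Prop :=
| trig_cos (n : int) : trig_poly (fun t => cos (n%:~R * repr t))
| trig_sin (n : int) : trig_poly (fun t => sin (n%:~R * repr t))
| trigD f g : trig_poly f -> trig_poly g -> trig_poly (fun t => f t + g t)
| trigZ (c : R) f : trig_poly f -> trig_poly (fun t => c * f t).

Lemma trig_cst (c : R) : trig_poly (fun=> c).
Proof.
rewrite (_ : (fun=> c) = fun t : circle R => c * cos (0%:~R * repr t)).
  exact/trigZ/trig_cos.
by apply/funext => t; rewrite mul0r cos0 mulr1.
Qed.

Lemma trigMcos f (n : int) : trig_poly f -> trig_poly (fun t => f t * cos (n%:~R * repr t)).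
Proof.
elim => [m|m|h k _ Hh _ Hk|c h _ Hh].
- rewrite (_ : (fun t => _) = fun t : circle R => 2^-1 * cos ((m - n)%:~R * repr t) +
    2^-1 * cos ((m + n)%:~R * repr t)).
    by apply: trigD; apply: trigZ; exact: trig_cos.
  by apply/funext => t; rewrite cosMcos rmorphB rmorphD/= mulrBl mulrDl.
- rewrite (_ : (fun t => _) = fun t : circle R => 2^-1 * sin ((m - n)%:~R * repr t) +
    2^-1 * sin ((m + n)%:~R * repr t)).
    by apply: trigD; apply: trigZ; exact: trig_sin.
  by apply/funext => t; rewrite sinMcos rmorphB rmorphD/= mulrBl mulrDl.
- by under eq_fun do rewrite mulrDl; exact: trigD.
- by under eq_fun do rewrite -mulrA; exact: trigZ.
Qed.

Lemma trigMsin f (n : int) : trig_poly f -> trig_poly (fun t => f t * sin (n%:~R * repr t)).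
Proof.
elim => [m|m|h k _ Hh _ Hk|c h _ Hh].
- under eq_fun do rewrite mulrC; exact/trigMcos/trig_sin.
- rewrite (_ : (fun t => _) = fun t : circle R => 2^-1 * cos ((m - n)%:~R * repr t) +
    - 2^-1 * cos ((m + n)%:~R * repr t)).
    by apply: trigD; apply: trigZ; exact: trig_cos.
  by apply/funext => t; rewrite sinMsin rmorphB rmorphD/= mulrBl mulrDl.
- by under eq_fun do rewrite mulrDl; exact: trigD.
- by under eq_fun do rewrite -mulrA; exact: trigZ.
Qed.

Lemma trigM f g : trig_poly f -> trig_poly g -> trig_poly (fun t => f t * g t).
Proof.
move=> tf; elim => [m|m|h k _ Hh _ Hk|c h _ Hh].
- exact: trigMcos.
- exact: trigMsin.
- by under eq_fun do rewrite mulrDr; exact: trigD.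
- by under eq_fun do rewrite mulrCA; exact: trigZ.
Qed.

Lemma trigX f (n : nat) : trig_poly f -> trig_poly (fun t => f t ^+ n).
Proof.
move=> tf; elim: n => [|n IH]; first exact: trig_cst.
by under eq_fun do rewrite exprS; exact: trigM.
Qed.

Lemma trig_continuous f : trig_poly f -> continuous f.
Proof.
elim => [m|m|h k _ Hh _ Hk|c h _ Hh].
- exact: continuous_cos_repr.
- exact: continuous_sin_repr.
- by move=> t; exact: (cvgD (Hh t) (Hk t)).
- by move=> t; exact: (cvgMr (Hh t)).
Qed.

Lemma trig_bounded f : trig_poly f -> exists M, forall t, `|f t| <= M.
Proof.
elim => [m|m|h k _ [A hA] _ [B kB]|c h _ [A hA]].
- by exists 1 => t; exact: cos_max.
- by exists 1 => t; exact: sin_max.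
- by exists (A + B) => t; apply: le_trans (ler_normD _ _) _; rewrite lerD.
- by exists (`|c| * A) => t; rewrite normrM ler_wpM2l.
Qed.

Lemma continuous_circle_measurable f : continuous f ->
  measurable_fun setT (f : borel_circle R -> R).
Proof.
move=> /continuousP cf; apply: (measurability _ (RGenOpens.measurableE R)).
move=> _ [_ [a [b ->] <-]]; rewrite setTI.
by apply: sub_sigma_algebra; apply: cf; exact: interval_open.
Qed.

(** A quarter of the squared distance between [e^(i t)] and [e^(i x)]: it measures distance and is
    itself a trigonometric polynomial. *)
Definition chord x (t : circle R) := (1 - cos (repr t - x)) / 2.

Lemma trig_chord x : trig_poly (chord x).
Proof.
rewrite (_ : chord x = fun t => 1 / 2 + (- (cos x / 2) * cos (1%:~R * repr t) +
   - (sin x / 2) * sin (1%:~R * repr t))).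
  by apply: trigD; [exact: trig_cst|apply: trigD; apply: trigZ; [exact: trig_cos|exact: trig_sin]].
by apply/funext => t; rewrite /chord cosB !mul1r; field.
Qed.

Lemma chord_itv x t : 0 <= chord x t <= 1.
Proof.
have := cos_geN1 (repr t - x); have := cos_le1 (repr t - x).
by rewrite /chord; move: (cos _) => c h1 h2; apply/andP; split; lra.
Qed.

(** This is [|u + v|^2 <= 2 |u|^2 + 2 |v|^2] for chords of the circle; the last term is twice the
    [chord] quantity between [x] and [y]. *)
Lemma chord_le x y t : chord x t <= 2 * chord y t + (1 - cos (x - y)).
Proof.
rewrite /chord (_ : repr t - x = (repr t - y) - (x - y)); last by ring.
rewrite cosB; have := cos2Dsin2 (repr t - y); have := cos2Dsin2 (x - y).
move: (cos (repr t - y)) (sin (repr t - y)) (cos (x - y)) (sin (x - y)) => c s c' s' h h'.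
have := sqr_ge0 (c + c' - 2); have := sqr_ge0 (s + s'); nra.
Qed.

Lemma Bernoulli_le (x : R) (n : nat) : -1 <= x -> 1 + n%:R * x <= (1 + x) ^+ n.
Proof.
move=> x1; elim: n => [|n IH]; first by rewrite mul0r addr0 expr0.
rewrite exprS; have x0 : 0 <= 1 + x by lra.
apply: le_trans (ler_wpM2l x0 IH); rewrite -natr1.
have := sqr_ge0 x; have : 0 <= n%:R :> R by []; nra.
Qed.

(** Each of the first [n] terms of the geometric series is at least [v ^+ n]. *)
Lemma geometric_partial_le v (n : nat) : 0 <= v < 1 -> n%:R * v ^+ n <= (1 - v)^-1.
Proof.
move=> /andP[v0 v1]; have v10 : 0 < 1 - v by lra.
rewrite -[leRHS]mul1r ler_pdivlMr//.
have H : (1 - v) * \sum_(i < n) v ^+ i = 1 - v ^+ n.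
  by rewrite -[RHS]opprB subrX1 -mulNr opprB.
apply: (@le_trans _ _ ((1 - v) * \sum_(i < n) v ^+ i)).
  rewrite mulrC ler_pM2l//.
  rewrite mulr_natl -[X in _ *+ X]card_ord -sumr_const; apply: ler_sum => i _.
  by apply: ler_wiXn2l => //; [exact: ltW|exact: ltnW].
by rewrite H gerBl exprn_ge0.
Qed.

(* The exponents are tuned so that the limit is the indicator of [u < 1 / (k + 1)] also at
   the boundary point [u = 1 / (k + 1)]. *)
Definition threshold (k n : nat) u := (1 - u ^+ (n + n)) ^+ (n * k.+1 ^ (n + n)).

Lemma threshold_itv k n u : 0 <= u <= 1 -> 0 <= threshold k n u <= 1.
Proof.
move=> /andP[u0 u1]; have : 0 <= u ^+ (n + n) <= 1 by rewrite exprn_ge0// exprn_ile1.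
by move=> /andP[h1 h2]; rewrite /threshold exprn_ge0 ?exprn_ile1//; lra.
Qed.

(** Put [v = (k + 1) u]. If [v < 1], Bernoulli's inequality gives the lower bound [1 - n v^(2 n)].
    If [v >= 1], then [(1 - x)^K <= 1 / (1 + K x)] with [K x = n v^(2 n) >= n]. *)
Lemma threshold_cvg k u : 0 <= u <= 1 ->
  threshold k n u @[n --> \oo] --> (if u < k.+1%:R^-1 then 1 else 0 : R).
Proof.
move=> u01; have /andP[u0 u1] := u01; pose v := k.+1%:R * u.
have v0 : 0 <= v by rewrite mulr_ge0.
have vE n : (n * k.+1 ^ (n + n))%:R * u ^+ (n + n) = n%:R * v ^+ (n + n) :> R.
  by rewrite natrM natrX exprMn mulrA.
have un n : 0 <= u ^+ (n + n) <= 1 by rewrite exprn_ge0// exprn_ile1.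
have [uk|ku] := ltP u k.+1%:R^-1.
  have v1 : v < 1 by rewrite /v mulrC -ltr_pdivlMr// div1r.
  have v10 : 0 < 1 - v by lra.
  apply: (@squeeze_cvgr _ _ _ _ (fun n => 1 - v ^+ n * (1 - v)^-1) (fun=> 1)).
  - apply: nearW => n; have /andP[_ ->] := threshold_itv k n u01; rewrite andbT.
    have := @Bernoulli_le (- u ^+ (n + n)) (n * k.+1 ^ (n + n)).
    rewrite mulrN vE -/(threshold k n u) => H; apply: le_trans (H _); last first.
      by have /andP[_] := un n; lra.
    rewrite lerB// exprD mulrA [leRHS]mulrC ler_wpM2r ?exprn_ge0//.
    by apply: geometric_partial_le; rewrite v0.
  - suff : (1 - v ^+ n * (1 - v)^-1) @[n --> \oo] --> 1 - 0 * (1 - v)^-1.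
      by rewrite mul0r subr0.
    apply: cvgB; first exact: cvg_cst.
    apply: cvgMl; apply: cvg_expr; by rewrite ger0_norm.
  - exact: cvg_cst.
have v1 : 1 <= v by rewrite /v mulrC -ler_pdivrMr// div1r.
apply: (@squeeze_cvgr _ _ _ _ (fun=> 0) (fun n => n.+1%:R^-1)).
- apply: nearW => n; have /andP[-> _] := threshold_itv k n u01 => /=.
  have n0 : 0 < n.+1%:R :> R by [].
  rewrite -[leRHS]mul1r ler_pdivlMr//.
  have /andP[h0 h1] := un n.
  set K := (n * k.+1 ^ (n + n))%N.
  apply: (@le_trans _ _ ((1 - u ^+ (n + n)) ^+ K * (1 + u ^+ (n + n)) ^+ K)).
    rewrite ler_wpM2l//; first by rewrite exprn_ge0//; lra.
    apply: le_trans (Bernoulli_le _ _); last by lra.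
    rewrite vE -natr1 addrC lerD2l ler_peMr// exprn_ege1//.
  rewrite -exprMn exprn_ile1//; nra.
- exact: cvg_cst.
- exact: cvg_harmonic.
Qed.

End TrigPolynomials.

(** * Uniqueness of finite measures with given trigonometric integrals *)

Section TrigUniqueness.
Variable R : realType.
Implicit Types (f g : circle R -> R).
Local Notation T := (borel_circle R).

Lemma bounded_integrable (m : {finite_measure set T -> \bar R}) f (M : R) :
  continuous f -> (forall t, `|f t| <= M) ->
  m.-integrable [set: T] (EFin \o (f : T -> R)).
Proof.
move=> cf fM; apply: measurable_bounded_integrable => //.
- exact: fin_num_fun_lty.
- exact: continuous_circle_measurable.
- by exists M; split; [exact: num_real|move=> N MN t _; apply: le_trans (fM t) (ltW MN)].
Qed.

Lemma trig_integrable (m : {finite_measure set T -> \bar R}) f : trig_poly f ->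
  m.-integrable [set: T] (EFin \o (f : T -> R)).
Proof.
move=> tf; have [M fM] := trig_bounded tf.
by apply: bounded_integrable fM; exact: trig_continuous.
Qed.

(** Dominated convergence transfers equality of trigonometric integrals to the measures of such
    sets, and products of polynomials make them a pi-system. *)
Definition trig_limit (A : set T) := measurable A /\
  exists p : nat -> circle R -> R, [/\ forall n, trig_poly (p n),
    forall n t, 0 <= p n t <= 1 & forall t, p n t @[n --> \oo] --> (\1_A t : R)].

Lemma trig_limitI (A B : set T) : trig_limit A -> trig_limit B -> trig_limit (A `&` B).
Proof.
move=> [mA [p [tp p01 pA]]] [mB [s [ts s01 sB]]]; split; first exact: measurableI.
exists (fun n t => p n t * s n t); split.
- by move=> n; exact: trigM.
- move=> n t; have /andP[h1 h2] := p01 n t; have /andP[h3 h4] := s01 n t.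
  by rewrite mulr_ge0//= mulr_ile1.
- by move=> t; rewrite indicI; exact: (cvgM (pA t) (sB t)).
Qed.

Lemma trig_limitT : trig_limit [set: T].
Proof.
split => //; exists (fun _ _ => 1); split.
- by move=> _; exact: trig_cst.
- by move=> _ _; rewrite ler01 lexx.
- by move=> t; rewrite indicT; exact: cvg_cst.
Qed.

Lemma trig_limit_measure (m1 m2 : {finite_measure set T -> \bar R}) (A : set T) :
  (forall f, trig_poly f -> Rintegral m1 setT (f : T -> R) = Rintegral m2 setT (f : T -> R)) ->
  trig_limit A -> m1 A = m2 A.
Proof.
move=> m12 [mA [p [tp p01 pA]]].
have lim (m : {finite_measure set T -> \bar R}) :
    (\int[m]_x (p n x)%:E @[n --> \oo] --> m A)%E.
  have <- : (\int[m]_x (\1_A x)%:E = m A)%E by rewrite integral_indic// setIT.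
  have mp n : measurable_fun [set: T] (EFin \o (p n : T -> R)).
    apply/measurable_EFinP; apply: continuous_circle_measurable.
    exact: trig_continuous.
  have mA' : measurable_fun [set: T] (EFin \o (\1_A : T -> R)).
    by apply/measurable_EFinP; exact: measurable_indic.
  have pA' : {ae m, forall x, [set: T] x -> (p n x)%:E @[n --> \oo] --> (\1_A x)%:E}.
    by apply/aeW => t _; apply: cvg_EFin; [exact: nearW|exact: pA].
  have i1 : m.-integrable [set: T] (cst 1%E) by exact: finite_measure_integrable_cst.
  have p1 : {ae m, forall x n, [set: T] x -> (`|(p n x)%:E| <= cst 1 x)%E}.
    apply/aeW => t n _; rewrite lee_fin; have /andP[h1 h2] := p01 n t.
    by rewrite ger0_norm.
  by have [_ _] := dominated_convergence measurableT mp mA' pA' i1 p1.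
have E : (fun n => \int[m1]_x (p n x)%:E)%E = (fun n => \int[m2]_x (p n x)%:E)%E.
  apply/funext => n; have := m12 _ (tp n); rewrite /Rintegral => H.
  rewrite -[LHS]fineK; last exact: integrable_fin_num (trig_integrable m1 (tp n)).
  rewrite -[RHS]fineK; last exact: integrable_fin_num (trig_integrable m2 (tp n)).
  by rewrite H.
have := lim m1; rewrite E => l1.
exact: (cvg_unique _ l1 (lim m2)).
Qed.

Definition circle_arc (r : R) (k : nat) : set T := [set t | chord r t < k.+1%:R^-1].

Lemma trig_limit_arc r k : trig_limit (circle_arc r k).
Proof.
have cch : continuous (chord r) by apply: trig_continuous; exact: trig_chord.
split.
  apply: sub_sigma_algebra.
  apply: (@open_comp _ _ (chord r : circle R -> R) [set y | y < k.+1%:R^-1]).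
    by move=> t _; exact: cch.
  exact: open_lt.
exists (fun n t => threshold k n (chord r t)); split.
- move=> n; apply: trigX.
  rewrite (_ : (fun t => _) = fun t => 1 + -1 * chord r t ^+ (n + n)).
    apply: trigD; first exact: trig_cst.
    by apply: trigZ; apply: trigX; exact: trig_chord.
  by apply/funext => t; rewrite mulN1r.
- by move=> n t; apply: threshold_itv; exact: chord_itv.
- move=> t; have := @threshold_cvg _ k _ (chord_itv r t).
  rewrite indicE; case: ifPn => h.
    by rewrite mem_set.
  by rewrite memNset//; exact/negP.
Qed.

Lemma cos_eq1 (x : R) : cos x = 1 -> exists n : int, x = (pi *+ 2) *~ n.
Proof.
have [k [y [yI ->]]] := reduce_2pi x.
have per : cos (y + (pi *+ 2) *~ k) = cos y.
  case: k => n; first exact: (periodicn (@cosD2pi R)).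
  by rewrite NegzE mulrNz -[in RHS](subrK ((pi *+ 2) *~ n.+1) y) (periodicn (@cosD2pi R)).
rewrite per => y1; have p0 := pi_gt0 R.
move: yI; rewrite in_itv/= => /andP[y0 y2].
have i0 : (0 : R) \in `[0, pi] by rewrite in_itv/= lexx ltW.
have [yp|py] := leP y pi.
  have -> : y = 0 by apply: cos_inj => //; rewrite ?cos0// in_itv/= y0.
  by exists k; rewrite add0r.
have h : pi *+ 2 - y = 0.
  apply: cos_inj => //; last by rewrite cos0 addrC cosD2pi cosN.
  by rewrite in_itv/= mulr2n; apply/andP; split; move: y2; rewrite mulr2n; lra.
have -> : y = pi *+ 2 by apply/esym/eqP; rewrite -subr_eq0 h.
by exists (1 + k); rewrite mulrzDr mulr1z.
Qed.

(** A countable base of the topology. Compactness of the complement of [U] keeps [chord (repr t)]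
    away from 0 there, and [chord_le] passes to a rational centre near [t]; the margin 4 covers
    [2 + 1]. *)
Lemma arc_base (U : set (circle R)) (t : circle R) : open U -> U t ->
  exists (r : rat) (k : nat), circle_arc (ratr r) k t /\ circle_arc (ratr r) k `<=` U.
Proof.
move=> oU Ut.
have [k kU] : exists k : nat, forall s, chord (repr t) s < 4 / k.+1%:R -> U s.
  apply: contrapT => /forallNP H.
  have Hs k : exists s, chord (repr t) s < 4 / k.+1%:R /\ ~ U s.
    by have /existsNP[s /not_implyP[h1 h2]] := H k; exists s.
  have cF : compact (~` U).
    apply: (@subclosed_compact _ _ [set: circle R]) => //; last exact: compact_circle.
    exact: open_closedC.
  have cch : continuous (chord (repr t)) by apply: trig_continuous; exact: trig_chord.
  have cC : closed (chord (repr t) @` ~` U).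
    apply: compact_closed; first exact: Rhausdorff.
    apply: continuous_compact => //; exact: continuous_subspaceT.
  have C0 : (~` (chord (repr t) @` ~` U)) 0.
    move=> [s Us /eqP]; rewrite /chord mulf_eq0 invr_eq0 pnatr_eq0 orbF subr_eq0.
    rewrite eq_sym => /eqP /cos_eq1[n sn]; apply: Us.
    rewrite -(circle_proj_repr s) -(subrK (repr t) (repr s)) sn addrC circle_projD2pi.
    by rewrite circle_proj_repr.
  have /nbhs_ballP[e /= e0 eC] := open_nbhs_nbhs (conj (closed_openC cC) C0).
  pose k := Num.truncn (4 / e).
  have [s [sk Us]] := Hs k.
  apply: (eC (chord (repr t) s)); last by exists s.
  have /andP[h _] := chord_itv (repr t) s.
  rewrite /ball/= sub0r normrN ger0_norm//; apply: lt_le_trans sk _.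
  rewrite ler_pdivrMr// mulrC -ler_pdivrMr//; apply: ltW.
  exact: truncnS_gt.
have k0 : 0 < k.+1%:R^-1 :> R by rewrite invr_gt0.
have [r rk] : exists r : rat, (1 - cos (repr t - ratr r)) < k.+1%:R^-1.
  have cc : {for repr t, continuous (fun y : R => 1 - cos (repr t - y))}.
    apply: (C1_continuous (f := fun y : R => 1 - cos (repr t - y))).
    rewrite (_ : (fun y => _) = fun y : R => 1 + -1 * cos (-1 * y + repr t)).
      apply: C1D; first exact: C1_cst.
      apply: C1M; first exact: C1_cst.
      apply: (C1_comp (@C1_cos R)); apply: C1D; [exact: C1_scale|exact: C1_cst].
    by apply/funext => y; rewrite !mulN1r [- y + _]addrC.
  have /cvgrPdist_lt /(_ _ k0) /nbhs_ballP[e /= e0 eC] := cc.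
  have [r rI] : exists r : rat, ratr r \in `](repr t - e), (repr t)[%R.
    by apply: rat_in_itvoo; rewrite gtrBl.
  exists r; have : ball (repr t) e (ratr r : R).
    by move: rI; rewrite in_itv/= => /andP[h1 h2]; rewrite /ball/= gtr0_norm; lra.
  move=> /eC/=; rewrite subrr cos0 subrr sub0r normrN.
  by apply: le_lt_trans; exact: ler_norm.
exists r, k; split.
  rewrite /circle_arc/= /chord.
  have h : 0 <= 1 - cos (repr t - ratr r) by rewrite subr_ge0 cos_le1.
  by apply: le_lt_trans rk; rewrite ler_pdivrMr// mulr_natr mulr2n lerDl.
move=> s; rewrite /circle_arc/= => hs; apply: kU.
apply: le_lt_trans (chord_le (repr t) (ratr r) s) _.
apply: (@lt_le_trans _ _ (2 * k.+1%:R^-1 + k.+1%:R^-1)); first by rewrite ltrD// ltr_pM2l.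
have -> : 4 / k.+1%:R = 2 * k.+1%:R^-1 + k.+1%:R^-1 + k.+1%:R^-1 :> R by ring.
by rewrite lerDl ltW.
Qed.

(** Every open set is the union of the countably many rational arcs that it contains. *)
Lemma borel_circle_trig_limit : @measurable _ T = <<s trig_limit >>.
Proof.
apply/seteqP; split => A.
  apply: smallest_sub; first exact: smallest_sigma_algebra.
  move=> U oU; pose GT := g_sigma_algebraType trig_limit.
  have -> : U = \bigcup_(r : rat) \bigcup_(k : nat)
      (if `[< circle_arc (ratr r) k `<=` U >] then circle_arc (ratr r) k else set0).
    apply/seteqP; split => t.
      move=> Ut; have [r [k [rt rU]]] := arc_base oU Ut.
      by exists r => //; exists k => //; rewrite asboolT.
    by move=> [r _ [k _]]; case: asboolP => // h; exact: h.
  apply: (@bigcupT_measurable_rat _ GT) => r; apply: (@bigcupT_measurable _ GT) => k.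
  case: asboolP => _; last exact: (@measurable0 _ GT).
  by apply: sub_sigma_algebra; exact: trig_limit_arc.
apply: smallest_sub; first exact: sigma_algebra_measurable.
by move=> B [].
Qed.

Lemma trig_measure_unique (m1 m2 : {finite_measure set T -> \bar R}) (A : set T) :
  (forall f, trig_poly f -> Rintegral m1 setT (f : T -> R) = Rintegral m2 setT (f : T -> R)) ->
  measurable A -> m1 A = m2 A.
Proof.
move=> m12; apply: (measure_unique trig_limit (fun=> setT)).
- exact: borel_circle_trig_limit.
- exact: trig_limitI.
- by move=> _; exact: trig_limitT.
- by rewrite bigcup_const//; exists 0%N.
- by move=> B; exact: trig_limit_measure.
- by move=> _; exact: fin_num_fun_lty.
Qed.

End TrigUniqueness.

(** * No measure on the set *)

Section NoMeasure.
Variable R : realType.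
Implicit Types (f g h : circle R -> R) (c e : R).
Local Notation T := (borel_circle R).

Definition diff_int (m1 m2 : {finite_measure set T -> \bar R}) f : R :=
  Rintegral m1 setT (f : T -> R) - Rintegral m2 setT (f : T -> R).

Section Decay.
Variables m1 m2 : {finite_measure set T -> \bar R}.
Local Notation J := (diff_int m1 m2).

Lemma diff_intD f g : trig_poly f -> trig_poly g ->
  J (fun t => f t + g t) = J f + J g.
Proof.
move=> tf tg; rewrite /diff_int !RintegralD//; try exact: trig_integrable.
ring.
Qed.

Lemma diff_intZ c f : trig_poly f -> J (fun t => c * f t) = c * J f.
Proof.
move=> tf; rewrite /diff_int !RintegralZl//; try exact: trig_integrable.
ring.
Qed.

Definition fourier_decay := forall e, 0 < e -> exists N : nat, forall n : int, (N <= `|n|)%N ->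
  `|J (fun t => cos (n%:~R * repr t))| < e /\ `|J (fun t => sin (n%:~R * repr t))| < e.

(** Multiplication by [cos (v x)] moves the finitely many frequencies of [g] to distance about [v]
    from 0, where the coefficients are small. *)
Lemma diff_int_cos_decay g e : fourier_decay -> trig_poly g -> 0 < e ->
  exists N : nat, forall v : nat, (N <= v)%N ->
    `|J (fun t => g t * cos (v%:Z%:~R * repr t))| <= e.
Proof.
move=> dec tg; elim: tg e => [n|n|h k th Hh tk Hk|c h th Hh] e e0.
- have [N HN] := dec e e0; exists (N + `|n|)%N => v Nv.
  rewrite (_ : (fun t => _) = fun t : circle R => 2^-1 * cos ((n - v%:Z)%:~R * repr t) +
    2^-1 * cos ((n + v%:Z)%:~R * repr t)); last first.
    by apply/funext => t; rewrite cosMcos rmorphB rmorphD/= mulrBl mulrDl.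
  rewrite diff_intD; [|exact/trigZ/trig_cos|exact/trigZ/trig_cos].
  rewrite !diff_intZ; [|exact: trig_cos|exact: trig_cos].
  have [|h1 _] := HN (n - v%:Z); first by move: Nv; clear; lia.
  have [|h2 _] := HN (n + v%:Z); first by move: Nv; clear; lia.
  apply: le_trans (ler_normD _ _) _; rewrite !normrM [`|2^-1|]gtr0_norm ?invr_gt0//.
  have -> : e = 2^-1 * e + 2^-1 * e by field.
  by apply: lerD; rewrite ler_pM2l ?invr_gt0// ltW.
- have [N HN] := dec e e0; exists (N + `|n|)%N => v Nv.
  rewrite (_ : (fun t => _) = fun t : circle R => 2^-1 * sin ((n - v%:Z)%:~R * repr t) +
    2^-1 * sin ((n + v%:Z)%:~R * repr t)); last first.
    by apply/funext => t; rewrite sinMcos rmorphB rmorphD/= mulrBl mulrDl.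
  rewrite diff_intD; [|exact/trigZ/trig_sin|exact/trigZ/trig_sin].
  rewrite !diff_intZ; [|exact: trig_sin|exact: trig_sin].
  have [|_ h1] := HN (n - v%:Z); first by move: Nv; clear; lia.
  have [|_ h2] := HN (n + v%:Z); first by move: Nv; clear; lia.
  apply: le_trans (ler_normD _ _) _; rewrite !normrM [`|2^-1|]gtr0_norm ?invr_gt0//.
  have -> : e = 2^-1 * e + 2^-1 * e by field.
  by apply: lerD; rewrite ler_pM2l ?invr_gt0// ltW.
- have e2 : 0 < e / 2 by rewrite divr_gt0.
  have [N1 H1] := Hh _ e2; have [N2 H2] := Hk _ e2.
  exists (maxn N1 N2) => v; rewrite geq_max => /andP[v1 v2].
  under eq_fun do rewrite mulrDl.
  rewrite diff_intD; [|exact: trigMcos|exact: trigMcos].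
  apply: le_trans (ler_normD _ _) _; have -> : e = e / 2 + e / 2 by field.
  by apply: lerD; [exact: H1|exact: H2].
- have c0 : 0 < `|c| + 1 by rewrite ltr_wpDl.
  have [N HN] := Hh _ (divr_gt0 e0 c0); exists N => v Nv.
  under eq_fun do rewrite -mulrA.
  rewrite diff_intZ; last exact: trigMcos.
  rewrite normrM; apply: le_trans (ler_wpM2l (normr_ge0 c) (HN v Nv)) _.
  rewrite mulrCA ler_piMr ?(ltW e0)// ler_pdivrMr// mul1r.
  by rewrite lerDl.
Qed.

Lemma trig_freq_avg w : trig_poly (fun t : circle R => freq_avg w (repr t)).
Proof.
rewrite /freq_avg; under eq_fun do rewrite mulrC; apply: trigZ.
elim: w => [|v w IH].
  by under eq_fun do rewrite big_nil; exact: trig_cst.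
by under eq_fun do rewrite big_cons; apply: trigD => //; exact: (trig_cos R v%:Z).
Qed.

Lemma diff_int_freq_avg g e (N : nat) w : trig_poly g -> (0 < size w)%N ->
  all (fun v => N < v)%N w ->
  (forall v : nat, (N <= v)%N -> `|J (fun t => g t * cos (v%:Z%:~R * repr t))| <= e) ->
  `|J (fun t => g t * freq_avg w (repr t))| <= e.
Proof.
move=> tg w0 wN H.
have tS s : trig_poly (fun t : circle R => \sum_(v <- s) cos (v%:Z%:~R * repr t)).
  elim: s => [|v s IH]; first by under eq_fun do rewrite big_nil; exact: trig_cst.
  by under eq_fun do rewrite big_cons; apply: trigD => //; exact: trig_cos.
have S : `|J (fun t => g t * \sum_(v <- w) cos (v%:Z%:~R * repr t))| <= e *+ size w.
  elim: {w0} w wN => [_|v w IH /= /andP[Nv wN]].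
    under eq_fun do rewrite big_nil mulr0.
    rewrite (_ : (fun=> 0) = fun t : circle R => 0 * cos (0%:~R * repr t)).
      by rewrite diff_intZ ?mul0r ?normr0//; exact: trig_cos.
    by apply/funext => t; rewrite mul0r.
  under eq_fun do rewrite big_cons mulrDr.
  rewrite diff_intD; [|exact: trigMcos|exact: trigM].
  apply: le_trans (ler_normD _ _) _; rewrite mulrS lerD ?IH//.
  by apply: H; exact: ltnW.
have s0 : 0 < (size w)%:R :> R by rewrite ltr0n.
rewrite (_ : (fun t => _) = fun t : circle R => (size w)%:R^-1 *
    (g t * \sum_(v <- w) cos (v%:Z%:~R * repr t))); last first.
  by apply/funext => t; rewrite /freq_avg mulrA mulrC.
rewrite diff_intZ; last exact: trigM.
rewrite normrM gtr0_norm ?invr_gt0// mulrC ler_pdivrMr//.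
by rewrite mulr_natr.
Qed.

Lemma freq_avg_le1 w (x : R) : freq_avg w x <= 1.
Proof.
rewrite /freq_avg; have [->|s0] := posnP (size w); first by rewrite invr0 mulr0.
rewrite ler_pdivrMr ?ltr0n// mul1r.
apply: (@le_trans _ _ (\sum_(v <- w) 1)); first by apply: ler_sum => v _; exact: cos_le1.
by rewrite big_const_seq count_predT iter_addr_0.
Qed.

(* If [N] is large, multiplying by [1 - freq_avg (w N)] hardly changes the integral, because
   all frequencies in [w N] are large; but on the support the factor is at most [1 - c]. *)
Lemma diff_int_damping c (w : nat -> seq nat) g e (n : nat) : fourier_decay ->
  (forall j, (0 < size (w j))%N /\ all (fun v => j < v)%N (w j)) ->
  trig_poly g -> 0 < e -> exists h, [/\ trig_poly h,
    forall t, (forall j, c <= freq_avg (w j) (repr t)) -> 0 <= h t <= (1 - c) ^+ n &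
    `|J (fun t => g t * h t) - J g| <= e].
Proof.
move=> dec wj tg; elim: n e => [|n IH] e e0.
  exists (fun=> 1); split.
  - exact: trig_cst.
  - by move=> t _; rewrite expr0 ler01 lexx.
  - by under eq_fun do rewrite mulr1; rewrite subrr normr0 ltW.
have e2 : 0 < e / 2 by rewrite divr_gt0.
have [h [th hK hg]] := IH _ e2.
have tgh := trigM tg th.
have [N HN] := diff_int_cos_decay dec tgh e2.
have [w0 wN] := wj N.
have HA := diff_int_freq_avg tgh w0 wN HN.
exists (fun t => h t * (1 + -1 * freq_avg (w N) (repr t))); split.
- apply: trigM => //; apply: trigD; first exact: trig_cst.
  by apply: trigZ; exact: trig_freq_avg.
- move=> t tK; have /andP[h0 hn] := hK t tK; have cN := tK N.
  have := freq_avg_le1 (w N) (repr t); rewrite mulN1r => f1.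
  rewrite exprSr mulr_ge0 ?subr_ge0//= ler_pM ?subr_ge0//.
  by rewrite lerB.
- rewrite (_ : (fun t => _) = fun t => g t * h t + -1 * (g t * h t * freq_avg (w N) (repr t))).
    have tf := trig_freq_avg (w N).
    rewrite diff_intD//; last by apply: trigZ; exact: trigM.
    rewrite diff_intZ; last exact: trigM.
    rewrite mulN1r addrAC; apply: le_trans (ler_normB _ _) _.
    have -> : e = e / 2 + e / 2 by field.
    exact: lerD.
  by apply/funext => t; ring.
Qed.

End Decay.

Lemma Rintegral_supported_le (m : {finite_measure set T -> \bar R}) (K : set T) f (M : R) :
  measurable K -> m (~` K) = 0%E -> trig_poly f -> 0 <= M -> (forall t, K t -> `|f t| <= M) ->
  `|Rintegral m setT (f : T -> R)| <= M * fine (m setT).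
Proof.
move=> mK mK0 tf M0 fM; have fi := trig_integrable m tf.
have mKc : measurable (~` K) by exact: measurableC.
have fiK : m.-integrable K (EFin \o (f : T -> R)) by exact: integrableS fi.
have -> : Rintegral m setT (f : T -> R) = Rintegral m K (f : T -> R).
  rewrite /Rintegral (@negligible_integral _ _ _ m setT (~` K))//.
  by rewrite setTD setCK.
apply: le_trans (le_normr_Rintegral mK fiK) _.
apply: (@le_trans _ _ (Rintegral m K (fun=> M))).
  apply: le_Rintegral => //; first exact: integrable_norm.
  apply: (@integrableS _ _ _ m setT K) => //.
  exact: (finite_measure_integrable_cst m M).
rewrite Rintegral_cst//= ler_wpM2l// fine_le//.
- exact: fin_num_measure.
- exact: fin_num_measure.
- by apply: le_measure; rewrite ?inE.
Qed.

Lemma supported_decay_eq (m1 m2 : {finite_measure set T -> \bar R}) c (w : nat -> seq nat) :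
  fourier_decay m1 m2 -> 0 < c ->
  (forall j, (0 < size (w j))%N /\ all (fun v => j < v)%N (w j)) ->
  m1 (~` freq_avg_set c w) = 0%E -> m2 (~` freq_avg_set c w) = 0%E ->
  forall A : set T, measurable A -> m1 A = m2 A.
Proof.
move=> dec c0 wj K1 K2 A mA; apply: trig_measure_unique => // g tg.
pose K : set T := freq_avg_set c w.
have mK : measurable K.
  rewrite -[K]setCK; apply: measurableC; apply: sub_sigma_algebra.
  by apply: closed_openC; exact: closed_freq_avg_set.
(* For [c > 1] the damping factor [1 - c] would be negative; lowering the threshold keeps
   [0 <= 1 - c' < 1]. *)
pose c' := Num.min c 1.
have c'0 : 0 < c' by rewrite lt_min c0 ltr01.
have c'1 : c' <= 1 by rewrite ge_min lexx orbT.
have c'c : c' <= c by rewrite ge_min lexx.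
have [G gG] := trig_bounded tg.
have G0 : 0 <= G by apply: le_trans (gG (circle_proj 0)).
pose M := fine (m1 setT) + fine (m2 setT).
have M0 : 0 <= M by rewrite addr_ge0// fine_ge0.
have bound n e : 0 < e -> `|diff_int m1 m2 g| <= (1 - c') ^+ n * (G * M) + e.
  move=> e0; have [h [th hK hJ]] := diff_int_damping c' n dec wj tg e0.
  have cn : 0 <= (1 - c') ^+ n by rewrite exprn_ge0// subr_ge0.
  have ghK t : K t -> `|g t * h t| <= G * (1 - c') ^+ n.
    move=> Kt; have [|h0 hn] := andP (hK t _); first by move=> j; exact: le_trans c'c (Kt j).
    by rewrite normrM ler_pM// ger0_norm.
  have tgh := trigM tg th.
  have G' : 0 <= G * (1 - c') ^+ n by rewrite mulr_ge0.
  have h1 := Rintegral_supported_le mK K1 tgh G' ghK.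
  have h2 := Rintegral_supported_le mK K2 tgh G' ghK.
  have Jgh : `|diff_int m1 m2 (fun t => g t * h t)| <= (1 - c') ^+ n * (G * M).
    apply: le_trans (ler_normB _ _) _; apply: le_trans (lerD h1 h2) _.
    by rewrite -mulrDr -/M mulrAC mulrA mulrC mulrA.
  rewrite -[diff_int m1 m2 g](subKr (diff_int m1 m2 (fun t => g t * h t))).
  by apply: le_trans (ler_normB _ _) _; exact: lerD.
have J0 : diff_int m1 m2 g = 0.
  apply/eqP; rewrite -normr_le0; apply/ler_addgt0Pr => e e0; rewrite add0r.
  have e2 : 0 < e / 2 by rewrite divr_gt0.
  have cv : (1 - c') ^+ n * (G * M) @[n --> \oo] --> 0 * (G * M).
    by apply: cvgMl; apply: cvg_expr; rewrite ger0_norm; lra.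
  rewrite mul0r in cv; have /cvgrPdist_le /(_ _ e2) [N _ HN] := cv.
  have := HN N (leqnn N); rewrite /= sub0r normrN => HNN.
  apply: le_trans (bound N _ e2) _; rewrite [leRHS]splitr lerD2r.
  by apply: le_trans HNN; exact: ler_norm.
by apply/eqP; rewrite -subr_eq0; apply/eqP.
Qed.

(** [charge_integral] fixes a Hahn decomposition by choice, and destructing the same choices exposes
    its two parts. Each part of [B] is, up to sign, the value of [nu] on a piece of [B], which gives
    the last clause. *)
Lemma charge_jordan (nu : {charge set T -> \bar R}) :
  exists m1 m2 : {finite_measure set T -> \bar R},
  [/\ forall f : T -> R, charge_integral nu f = Rintegral m1 setT f - Rintegral m2 setT f,
      forall A, measurable A -> nu A = (m1 A - m2 A)%E &
      forall B, measurable B -> (forall A, measurable A -> A `<=` B -> nu A = 0%E) ->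
        m1 B = 0%E /\ m2 B = 0%E].
Proof.
rewrite /charge_integral; case: (cid (Hahn_decomposition nu)) => P exN.
case: (cid exN) => N nuPN; exists (jordan_pos nuPN), (jordan_neg nuPN); split => //.
- by move=> A mA; rewrite (jordan_decomp nuPN mA) /cadd/= cscaleN1.
- have [[mP _] [mN _] _ _] := nuPN.
  move=> B mB B0; split.
    apply: etrans (jordan_posE nuPN B) _; rewrite cjordan_posE /crestr0 mem_set//= /crestr.
    by apply: B0; [exact: measurableI|exact: subIsetl].
  apply: etrans (jordan_negE nuPN B) _; rewrite cjordan_negE /crestr0 mem_set//= /crestr.
  rewrite B0 ?oppe0//; first exact: measurableI.
Qed.

(** A Lindelof argument: the null arcs with rational centre already cover [V], and [pickle]
    enumerates them. *)
Lemma null_covered (m : {finite_measure set T -> \bar R}) (V : set T) : measurable V ->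
  (forall t : circle R, V t -> exists U : set (circle R), [/\ open U, U t & m U = 0%E]) ->
  m V = 0%E.
Proof.
move=> mV VU.
pose F (r : rat) (k : nat) : set T :=
  if `[< m (circle_arc (ratr r) k) = 0%E >] then circle_arc (ratr r) k else set0.
pose G n : set T := if unpickle n is Some p then F p.1 p.2 else set0.
have mF r k : measurable (F r k).
  by rewrite /F; case: asboolP => // _; have [] := @trig_limit_arc R (ratr r) k.
have mG n : measurable (G n) by rewrite /G; case: unpickle.
have G0 n : m (G n) = 0%E.
  rewrite /G; case: unpickle => [[r k]|]; last exact: measure0.
  by rewrite /F/=; case: asboolP => // _; exact: measure0.
have VG : V `<=` \bigcup_n G n.
  move=> t Vt; have [U [oU Ut U0]] := VU t Vt.
  have [r [k [rt rU]]] := arc_base oU Ut.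
  have [mA _] := @trig_limit_arc R (ratr r) k.
  have r0 : m (circle_arc (ratr r) k) = 0%E.
    apply/eqP; rewrite eq_le measure_ge0 andbT -U0.
    by apply: le_measure; rewrite ?inE//; exact: sub_sigma_algebra.
  have Frt : F r k t by rewrite /F asboolT.
  exists (pickle (r, k)); [exact: I|rewrite /G pickleK; exact: Frt].
apply/eqP; rewrite eq_le measure_ge0 andbT.
have nG : m.-negligible (\bigcup_n G n).
  by apply: negligible_bigcup => n; apply/negligibleP; [exact: mG|exact: G0].
have [B [mB B0 GB]] := nG; apply: (@le_trans _ _ (m B)); last by rewrite B0.
by apply: le_measure; rewrite ?inE//; exact: subset_trans VG GB.
Qed.

End NoMeasure.

(** * From signed to complex measures *)

Section NoComplexMeasure.
Variable R : realType.
Local Open Scope complex_scope.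
Local Notation T := (borel_circle R).

Lemma charge_fine_eq0 (nu : {charge set T -> \bar R}) (A : set T) :
  measurable A -> fine (nu A) = 0 -> nu A = 0%E.
Proof. by move=> mA h; rewrite -[LHS]fineK ?h// fin_num_measure. Qed.

(** The positive and negative parts of [nu] turn out to be equal as measures, so their difference
    vanishes. *)
Lemma supported_charge_eq0 (nu : {charge set T -> \bar R}) c (w : nat -> seq nat) :
  (forall e, 0 < e -> exists N : nat, forall n : int, (N <= `|n|)%N ->
    `|charge_integral nu (fun t => cos (n%:~R * repr (t : circle R)))| < e /\
    `|charge_integral nu (fun t => sin (n%:~R * repr (t : circle R)))| < e) ->
  0 < c -> (forall j, (0 < size (w j))%N /\ all (fun v => j < v)%N (w j)) ->
  (forall t : circle R, ~ freq_avg_set c w t -> exists U : set (circle R), [/\ open U, U t &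
    forall A : set T, measurable A -> A `<=` U -> nu A = 0%E]) ->
  forall A : set T, measurable A -> nu A = 0%E.
Proof.
move=> dec c0 wj supp A mA; have [m1 [m2 [int12 nu12 null12]]] := charge_jordan nu.
have dec12 : fourier_decay m1 m2.
  move=> e e0; have [N HN] := dec e e0; exists N => n Nn.
  by have := HN n Nn; rewrite !int12.
have mK : measurable (~` freq_avg_set c w : set T).
  by apply: sub_sigma_algebra; apply: closed_openC; exact: closed_freq_avg_set.
have null t : (~` freq_avg_set c w) t ->
    exists U : set (circle R), [/\ open U, U t, m1 U = 0%E & m2 U = 0%E].
  move=> /supp[U [oU Ut U0]]; exists U.
  by have [||h1 h2] := null12 U => //; exact: sub_sigma_algebra.
have K1 : m1 (~` freq_avg_set c w) = 0%E.
  by apply: null_covered => // t /null[U [? ? ? ?]]; exists U.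
have K2 : m2 (~` freq_avg_set c w) = 0%E.
  by apply: null_covered => // t /null[U [? ? ? ?]]; exists U.
rewrite nu12// (supported_decay_eq dec12 c0 wj K1 K2 mA) subee//.
exact: fin_num_measure.
Qed.

Lemma cm_fourierE (mu : complex_measure R) (n : int) : cm_fourier mu n =
  (charge_integral (cm_Re mu) (fun t => cos (n%:~R * repr (t : circle R)))
   + charge_integral (cm_Im mu) (fun t => sin (n%:~R * repr (t : circle R))))
  +i* (charge_integral (cm_Im mu) (fun t => cos (n%:~R * repr (t : circle R)))
   - charge_integral (cm_Re mu) (fun t => sin (n%:~R * repr (t : circle R)))).
Proof.
have cosE : (fun t : T => complex.Re (character (- n) t)) =
    (fun t => cos (n%:~R * repr (t : circle R))).
  by apply/funext => t; rewrite /character/= rmorphN/= mulNr cosN.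
have sinE : (fun t : T => complex.Im (character (- n) t)) =
    (fun t => -1 * sin (n%:~R * repr (t : circle R))).
  by apply/funext => t; rewrite mulN1r /character/= rmorphN/= mulNr sinN.
have chargeN (nu : {charge set T -> \bar R}) :
    charge_integral nu (fun t => -1 * sin (n%:~R * repr (t : circle R))) =
    - charge_integral nu (fun t => sin (n%:~R * repr (t : circle R))).
  have [m1 [m2 [int12 _ _]]] := charge_jordan nu.
  by rewrite !int12 -!/(diff_int _ _ _) diff_intZ ?mulN1r//; exact: trig_sin.
rewrite /cm_fourier /cm_integral cosE sinE !chargeN opprK.
by congr (_ +i* _); rewrite addrC.
Qed.

Lemma no_decaying_complex_measure (mu : complex_measure R) c (w : nat -> seq nat) :
  (forall e, 0 < e -> exists N : nat, forall n : int, (N <= `|n|)%N ->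
    normc (cm_fourier mu n) < e) ->
  0 < c -> (forall j, (0 < size (w j))%N /\ all (fun v => j < v)%N (w j)) ->
  cm_support mu `<=` freq_avg_set c w -> ~ cm_nonzero mu.
Proof.
move=> dec c0 wj supp [A mA].
pose p (nu : {charge set T -> \bar R}) (n : int) :=
  charge_integral nu (fun t => cos (n%:~R * repr (t : circle R))).
pose s (nu : {charge set T -> \bar R}) (n : int) :=
  charge_integral nu (fun t => sin (n%:~R * repr (t : circle R))).
have pN nu n : p nu (- n) = p nu n.
  by congr charge_integral; apply/funext => t; rewrite rmorphN/= mulNr cosN.
have sN nu n : s nu (- n) = - s nu n.
  rewrite /s; have -> : (fun t : T => sin ((- n)%:~R * repr (t : circle R))) =
      (fun t => -1 * sin (n%:~R * repr (t : circle R))).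
    by apply/funext => t; rewrite mulN1r rmorphN/= mulNr sinN.
  have [m1 [m2 [int12 _ _]]] := charge_jordan nu.
  by rewrite !int12 -!/(diff_int _ _ _) diff_intZ ?mulN1r//; exact: trig_sin.
have bounds e : 0 < e -> exists N : nat, forall n : int, (N <= `|n|)%N ->
    [/\ `|p (cm_Re mu) n| < e, `|s (cm_Re mu) n| < e, `|p (cm_Im mu) n| < e &
        `|s (cm_Im mu) n| < e].
  move=> e0; have [N HN] := dec e e0; exists N => n Nn.
  (* With [p], [s] for the real part of [mu] and [p'], [s'] for the imaginary part, the coefficients
     at [n] and [- n] are [(p + s') + i (p' - s)] and [(p - s') + i (p' + s)]. Half sums and half
     differences isolate the four integrals. *)
  have := HN n Nn; have := HN (- n) _; rewrite abszN => /(_ Nn).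
  rewrite !cm_fourierE -!/(p _ _) -!/(s _ _) !pN !sN => h1 h2.
  have := le_lt_trans (normr_Re_le_normc _ _) h1.
  have := le_lt_trans (normr_Im_le_normc _ _) h1.
  have := le_lt_trans (normr_Re_le_normc _ _) h2.
  have := le_lt_trans (normr_Im_le_normc _ _) h2.
  move: (p _ n) (s _ n) (p _ n) (s _ n) => a b c' d.
  rewrite !ltr_norml => /andP[? ?] /andP[? ?] /andP[? ?] /andP[? ?].
  by split; apply/andP; split; lra.
have null (t : circle R) : ~ freq_avg_set c w t -> exists U : set (circle R), [/\ open U, U t &
    forall A : set T, measurable A -> A `<=` U ->
      cm_Re mu A = 0%E /\ cm_Im mu A = 0%E].
  move=> tK; have := contra_not (supp t) tK.
  move=> /existsNP[U] /not_implyP[oU] /not_implyP[Ut] /forallNP H.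
  exists U; split => // B mB BU.
  have /eqP : mu B == 0 by apply: contraT => mu0; case: (H B).
  rewrite /cm_val => /eqP; rewrite eq_complex/= => /andP[/eqP h1 /eqP h2].
  by split; exact: charge_fine_eq0.
have ReA : cm_Re mu A = 0%E.
  apply: (supported_charge_eq0 (c := c) (w := w)) => // [e e0|t tK].
    by have [N HN] := bounds e e0; exists N => n Nn; have [] := HN n Nn.
  have [U [oU Ut U0]] := null t tK; exists U; split => // B mB BU.
  by have [] := U0 B mB BU.
have ImA : cm_Im mu A = 0%E.
  apply: (supported_charge_eq0 (c := c) (w := w)) => // [e e0|t tK].
    by have [N HN] := bounds e e0; exists N => n Nn; have [] := HN n Nn.
  have [U [oU Ut U0]] := null t tK; exists U; split => // B mB BU.
  by have [] := U0 B mB BU.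
by rewrite /cm_val ReA ImA /= eqxx.
Qed.

End NoComplexMeasure.

Theorem corollary5p2 (R : realType) (q alpha : R) (hq : 2 < q) (halpha : 0 < alpha) :
  exists K : set (circle R),
    [/\ compact K,
        exists S : schwartz_distribution R,
          [/\ dist_nonzero S, dist_support S `<=` K &
              log_summable q alpha (dist_fourier S)] &
        ~ exists mu : complex_measure R,
          [/\ cm_nonzero mu, cm_support mu `<=` K &
              log_summable q alpha (cm_fourier mu)]].
Proof.
pose q' := (q + 2) / 2.
have q'2 : 2 < q' by rewrite /q'; lra.
have q'q : 0 < q' < q by rewrite /q'; apply/andP; split; lra.
have q'0 : 0 < q' by have /andP[] := q'q.
have [c [B [S [w [c0 [S0 CS] wj Sw [SB Sc]]]]]] := riesz_sequence q'2.
have fS : fast_cauchy S by split.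
exists (freq_avg_set c w); split; first exact: compact_freq_avg_set.
- exists (limit_distribution fS); split.
  + exact: limit_distribution_nonzero.
  + exact: limit_distribution_support.
  + have [a [b [aB bB abE]]] := limit_distribution_lq fS q'0 SB.
    exact: lq_bounded_log_summable q'q halpha aB bB abE.
- move=> [mu [mu0 supp sum]]; move: mu0.
  apply: no_decaying_complex_measure c0 wj supp => e e0.
  by apply: log_summable_cvg0 halpha sum e0; lra.
Qed.
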